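(* Let $\mathbb{G}$ be a homogeneous group of homogeneous dimension $Q\geq 2$. For any homogeneous quasi-norm $|\cdot|$ on $\mathbb{G}$, all differentiable $|\cdot|$-radial functions $\phi$, all $p>1$, and all $f\in C_0^1(\mathbb{G})$ we have $$\int_{\mathbb{G}}\frac{\phi'(|x|)}{|x|^{Q-1}}|f(x)|^{p}dx\leq\int_{\mathbb{G}}\left|\mathcal{R}f(x)\right|^{p}dx+(p-1)\int_{\mathbb{G}}\frac{|\phi(|x|)|^{\frac{p}{p-1}}}{|x|^{\frac{p(Q-1)}{p-1}}}|f(x)|^{p}dx,$$ and $$\int_{\mathbb{G}}\frac{\phi'(|x|)}{|x|^{Q-1}}|f(x)|^{p}dx\leq p\left(\int_{\mathbb{G}}\left|\mathcal{R}f(x)\right|^{p}dx\right)^{\frac1p}\left(\int_{\mathbb{G}}\frac{|\phi(|x|)|^{\frac{p}{p-1}}}{|x|^{\frac{p(Q-1)}{p-1}}}|f(x)|^{p}dx\right)^{\frac{p-1}{p}}.$$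
   Context: A homogeneous group $\mathbb{G}$ is a connected simply connected Lie group whose Lie algebra $\mathfrak{g}$ is equipped with a family of dilations $D_\lambda=\mathrm{Exp}(A_0\ln\lambda)$, $\lambda>0$, that are Lie algebra morphisms, where $A_0$ is a diagonalisable linear operator on $\mathfrak{g}$ with positive eigenvalues. The induced dilations on $\mathbb{G}$ are written $x\mapsto\lambda x$, and $Q=\mathrm{Tr}\,A_0$ is the homogeneous dimension. A homogeneous quasi-norm is a continuous function $|\cdot|:\mathbb{G}\to[0,\infty)$ with $|x^{-1}|=|x|$, $|\lambda x|=\lambda|x|$ for $\lambda>0$, and $|x|=0$ iff $x=0$. Haar measure is denoted $dx$. A function is $|\cdot|$-radial if it depends only on $|x|$; for such $\phi$ we write $\phi=\phi(|x|)$, and $\phi'$ is the derivative of $\phi(r)$ with respect to $r=|x|$. $\mathcal{R}=\frac{d}{d|x|}$ is the radial derivative: $(\mathcal{R}f)(ry)=\frac{d}{dr}f(ry)$ for $r>0$, $|y|=1$. $C_0^1(\mathbb{G})$ denotes compactly supported $C^1$ functions.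
   Formalization: Added assumption: p ≤ Q, or f(0)=0, or limsup of φ(r) as r→0+ is ≥ 0. Without it the claim fails, e.g. on R^2 with p=3, f=1 on the unit disc, φ(r)=-exp(-r/ε), ε small, because integration by parts leaves a boundary term at the origin. *)

(* Defs.v *)
From HB Require Import structures.
From mathcomp Require Import all_boot all_order all_algebra.
From mathcomp Require Import all_classical all_reals all_analysis.
From mathcomp Require Import complex.

Set Implicit Arguments.
Unset Strict Implicit.
Unset Printing Implicit Defensive.

Import Order.TTheory GRing.Theory Num.Theory.
Import numFieldNormedType.Exports.

Local Open Scope classical_set_scope.
Local Open Scope ring_scope.

(* Between finite-dimensional spaces this is the usual class C^k: all iterated
   directional derivatives of order at most k exist and are continuous. *)
Fixpoint Ck (R : realType) (V W : normedModType R) (k : nat) (g : V -> W)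
    : Prop :=
  match k with
  | 0 => continuous g
  | k'.+1 => continuous g /\
      forall v, (forall x, derivable g x v) /\ Ck k' (fun x => 'D_v g x)
  end.

Definition smooth (R : realType) (V W : normedModType R) (g : V -> W) : Prop :=
  forall k, Ck k g.

Definition expmx (R : realType) (n : nat) (A : 'M[R]_n.+1) : 'M[R]_n.+1 :=
  limn (series (fun k => (k`!%:R)^-1 *: A ^+ k)).

(* D_lam = Exp (A0 ln lam) for lam > 0; linear maps act on row vectors from the
   right, as in mxalgebra. *)
Definition dilation (R : realType) (n : nat) (A0 : 'M[R]_n.+1) (lam : R)
    (x : 'rV[R]_n.+1) : 'rV[R]_n.+1 :=
  x *m expmx (ln lam *: A0).

(* The Lie bracket of a Lie group given in exponential coordinates:
   [x, y] = d/ds d/dt (exp (s x) exp (t y) - exp (t y) exp (s x)) at s = t = 0. *)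
Definition lie_bracket (R : realType) (n : nat)
    (mul : 'rV[R]_n.+1 -> 'rV[R]_n.+1 -> 'rV[R]_n.+1) (x y : 'rV[R]_n.+1)
    : 'rV[R]_n.+1 :=
  derive1 (fun s : R =>
    derive1 (fun t : R => mul (s *: x) (t *: y) - mul (t *: y) (s *: x)) 0) 0.

(* A homogeneous group of topological dimension n.+1.  Since the eigenvalues of
   A0 are positive, the Lie algebra is nilpotent and the exponential map of a
   connected simply connected group is a global diffeomorphism; the group is
   identified through it with its Lie algebra R^(n.+1).  Thus the identity is 0,
   the lines t |-> t x are the one-parameter subgroups (hg_exp), exp is the
   identity map, and the automorphism of the group induced by D_lam is D_lam
   itself.  Conversely any such group is diffeomorphic to R^(n.+1), hence
   connected and simply connected.  hg_dil_mul says that the Lie algebra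
   morphisms D_lam do integrate to group morphisms; in these coordinates it is
   equivalent to hg_dil_bracket. *)
Record homogeneous_group (R : realType) (n : nat) := HomogeneousGroup {
  hg_mul : 'rV[R]_n.+1 -> 'rV[R]_n.+1 -> 'rV[R]_n.+1 ;
  hg_inv : 'rV[R]_n.+1 -> 'rV[R]_n.+1 ;
  hg_A0 : 'M[R]_n.+1 ;
  hg_mulA : associative hg_mul ;
  hg_mul0x : left_id 0 hg_mul ;
  hg_mulVx : left_inverse 0 hg_inv hg_mul ;
  hg_mul_smooth :
    smooth (fun z : 'rV[R]_n.+1 * 'rV[R]_n.+1 => hg_mul z.1 z.2) ;
  hg_inv_smooth : smooth hg_inv ;
  hg_exp : forall (s t : R) (x : 'rV[R]_n.+1),
    hg_mul (s *: x) (t *: x) = (s + t) *: x ;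
  hg_A0_diag : diagonalizable hg_A0 ;
  hg_A0_pos : forall a : R, eigenvalue hg_A0 a -> 0 < a ;
  hg_dil_bracket : forall (lam : R) (x y : 'rV[R]_n.+1), 0 < lam ->
    dilation hg_A0 lam (lie_bracket hg_mul x y) =
    lie_bracket hg_mul (dilation hg_A0 lam x) (dilation hg_A0 lam y) ;
  hg_dil_mul : forall (lam : R) (x y : 'rV[R]_n.+1), 0 < lam ->
    dilation hg_A0 lam (hg_mul x y) =
    hg_mul (dilation hg_A0 lam x) (dilation hg_A0 lam y)
}.

Definition dil (R : realType) (n : nat) (G : homogeneous_group R n) (lam : R)
    (x : 'rV[R]_n.+1) : 'rV[R]_n.+1 :=
  dilation (hg_A0 G) lam x.

Definition hom_dim (R : realType) (n : nat) (G : homogeneous_group R n) : R :=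
  \tr (hg_A0 G).

Definition quasi_norm (R : realType) (n : nat) (G : homogeneous_group R n)
    (N : 'rV[R]_n.+1 -> R) : Prop :=
  [/\ continuous N,
      forall x, 0 <= N x,
      forall x, N (hg_inv G x) = N x,
      forall (lam : R) x, 0 < lam -> N (dil G lam x) = lam * N x
    & forall x, N x = 0 <-> x = 0].

Definition borel_space (R : realType) (n : nat) :=
  g_sigma_algebraType (@open 'rV[R]_n.+1).

(* On R^(n.+1) a Borel measure that is finite on compact sets is automatically
   regular. *)
Definition haar_measure (R : realType) (n : nat) (G : homogeneous_group R n)
    (mu : {measure set (borel_space R n) -> \bar R}) : Prop :=
  [/\ forall (x : 'rV[R]_n.+1) (E : set (borel_space R n)), measurable E ->
        mu (hg_mul G x @` E) = mu E,
      forall K : set 'rV[R]_n.+1, compact K -> (mu K < +oo)%E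
    & mu setT <> 0%E].

(* C_0^1(G), for complex-valued functions *)
Definition C1_compact_support (R : realType) (n : nat)
    (f : 'rV[R]_n.+1 -> R[i]) : Prop :=
  [/\ Ck 1 (fun x => complex.Re (f x)),
      Ck 1 (fun x => complex.Im (f x))
    & compact (closure [set x | f x != 0])].

(* The value at r = |x| of d/dr g(r y), where y = |x|^-1 x is on the unit
   quasi-sphere; the value at x = 0 is irrelevant. *)
Definition radial_derivative_real (R : realType) (n : nat)
    (G : homogeneous_group R n) (N g : 'rV[R]_n.+1 -> R) (x : 'rV[R]_n.+1)
    : R :=
  derive1 (fun r : R => g (dil G r (dil G (N x)^-1 x))) (N x).

Definition radial_derivative (R : realType) (n : nat)
    (G : homogeneous_group R n) (N : 'rV[R]_n.+1 -> R)
    (f : 'rV[R]_n.+1 -> R[i]) (x : 'rV[R]_n.+1) : R[i] :=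
  Complex (radial_derivative_real G N (fun z => complex.Re (f z)) x)
          (radial_derivative_real G N (fun z => complex.Im (f z)) x).

(* Main.v *)
(* Let Q be the homogeneous dimension.  Along a ray s |-> D_s y the left-hand
   integrand times s^(Q-1) is phi' |f|^p up to a constant factor, that is, the
   derivative of phi |f|^p minus phi (|f|^p)', and Young's inequality bounds
   |phi (|f|^p)'| by |R f|^p plus p - 1 times the potential term.  Since phi' is
   only a derivative and need not be integrable, the fundamental theorem of
   calculus is replaced by q b - q a <= \int_a^b k whenever q' <= k, k >= 0 and k is
   measurable; this compares the positive part of the left-hand side with its
   negative part plus the right-hand side, on every ray.  Polar coordinates then
   give the first inequality.  They rest on mu (D_s E) = s^Q mu E: uniqueness of
   Haar measure gives mu (D_s E) = c(s) mu E, and c(s) = s^Q follows by counting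
   translates of small cells in boxes.  The second inequality is the first one for
   c phi, optimised over c > 0. *)

From HB Require Import structures.
Require Import Defs.
From mathcomp Require Import all_boot all_order all_algebra.
From mathcomp Require Import all_classical all_reals all_analysis.
From mathcomp Require Import measurable_realfun complex.
From mathcomp Require Import ring lra.

Set Implicit Arguments.
Unset Strict Implicit.
Unset Printing Implicit Defensive.

Import Order.TTheory GRing.Theory Num.Theory.
Import numFieldNormedType.Exports.

Local Open Scope classical_set_scope.
Local Open Scope ring_scope.

(** * Growth bounded by an integral *)

(** The left-hand side is a difference of two integrals that may both be infinite, so the
    comparisons are made between nonnegative integrals and the subtraction comes last; with
    [+oo - +oo = -oo] nothing is to be shown when the negative part is infinite. On a ray this
    forces a truncation of the positive part at a level [m], which makes the quantity to be
    cancelled finite. At the origin, [phi |f|^p] has to be controlled from one side only, and only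
    along some points tending to 0. That Haar measure is Lebesgue measure is never shown, as this
    would need the Jacobian of the translations. A Lipschitz bound for translations on a compact box
    compares boxes up to a constant factor, and powers of a single dilation remove the factor. The
    product form is not a mere rescaling of the additive one when an integral on the right is 0: by
    [0 * +oo = 0] a vanishing factor must by itself make the left-hand side nonpositive, which takes
    a separate argument for each factor. *)

(* Continuous induction: the set of points reached by [P] is closed under
   limits from the left and has no maximum below [b]. *)
Lemma right_induction (R : realType) (a b : R) (P : R -> Prop) : a <= b ->
  P a ->
  (forall c, a < c <= b ->
     (forall e, 0 < e -> exists2 x, a <= x <= b /\ c - e < x <= c & P x) ->
     P c) ->
  (forall c, a <= c < b -> P c -> exists2 y, c < y <= b & P y) ->
  P b.
Proof.
move=> ab Pa Pcl Pst.
pose S := [set x | a <= x <= b /\ P x].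
have Sa : S a by split => //; rewrite lexx.
have hS : has_sup S by split; [exists a | exists b => x [/andP[]]].
pose c := sup S.
have ac : a <= c by apply: ub_le_sup => //; exact: hS.2.
have cb : c <= b by apply: ge_sup => //; [exists a | move=> x [/andP[]]].
have Pc : P c.
  move: ac; rewrite le_eqVlt => /orP[/eqP <- //|ac].
  apply: Pcl; first by rewrite ac.
  move=> e e0; have [x [xab Px] cx] := sup_adherent e0 hS.
  exists x => //; split => //; rewrite cx/=.
  by apply: ub_le_sup; [exact: hS.2|split].
move: cb; rewrite le_eqVlt => /orP[/eqP <- //|cb].
have [|y /andP[cy yb] Py] := Pst c _ Pc; first by rewrite ac.
suff : y <= c by rewrite leNgt cy.
apply: ub_le_sup; first exact: hS.2.
by split => //; rewrite yb andbT (le_trans ac)// ltW.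
Qed.

Lemma derivable_right_growth (R : realType) (q : R -> R) (x e : R) :
  derivable q x 1 -> 0 < e ->
  exists2 d, 0 < d & forall y, x < y < x + d ->
    q y - q x <= (derive1 q x + e) * (y - x).
Proof.
move=> dq e0.
have /cvgr_dist_lt/(_ _ e0) [d/= d0 dd] : h^-1 *: (q (h + x) - q x) @[h --> 0^'] --> derive1 q x.
  move: dq; rewrite /derivable/=; under eq_fun do rewrite [_%:A]mulr1.
  exact: id.
exists d => // y /andP[xy yd].
have /= := dd (y - x); rewrite /ball_/= sub0r normrN gtr0_norm ?subr_gt0//.
rewrite ltrBlDl => /(_ yd) /(_ (lt0r_neq0 _)); rewrite subr_gt0 => /(_ xy).
rewrite subrK ltr_norml => /andP[h _].
have {h} : (y - x)^-1 * (q y - q x) <= derive1 q x + e.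
  by move: h; rewrite /GRing.scale/=; lra.
by rewrite ler_pdivrMl ?subr_gt0// mulrC.
Qed.

Lemma derivable_near_dist (R : realType) (q : R -> R) (x e : R) :
  derivable q x 1 -> 0 < e ->
  exists2 d, 0 < d & forall y, `|x - y| < d -> `|q x - q y| < e.
Proof.
move=> dq e0; move: dq => /derivable1_diffP/differentiable_continuous/cvgr_dist_lt/(_ _ e0)[d/= d0 dd].
by exists d.
Qed.

(* For open sets [U j] slightly larger than [{k > (j + 1) * e}], this is the
   integral over [[a, x]] of a lower semicontinuous function exceeding [k - e]. *)
Definition cover_mass (R : realType) (a e : R) (U : nat -> set R) (x : R) :=
  (\sum_(0 <= j <oo) (e%:E * @lebesgue_measure R (U j `&` `[a, x])))%E.

(** Each of the first [J] sets contains [[x, y]], so its term gains [e * (y - x)]; the later terms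
    can only grow. The case [J = 0] is monotonicity of the mass. *)
Lemma cover_mass_growth (R : realType) (a e : R) (U : nat -> set R) x y J :
  0 < e -> (forall j, open (U j)) -> a <= x -> x <= y ->
  (forall j, (j < J)%N -> `[x, y] `<=` U j) ->
  (cover_mass a e U x + (J%:R * e * (y - x))%:E <= cover_mass a e U y)%E.
Proof.
move=> e0 oU ax; rewrite le_eqVlt => /orP[/eqP<- _|xy sU].
  by rewrite subrr mulr0 adde0.
pose lam := @lebesgue_measure R.
have mU j z : measurable (U j `&` `[a, z]).
  by apply: measurableI => //; exact: open_measurable.
have g0 (z : R) j : (0 <= e%:E * lam (U j `&` `[a, z]))%E.
  by apply: mule_ge0; [rewrite lee_fin ltW|exact: measure_ge0].
have le_lam j : (lam (U j `&` `[a, x]) <= lam (U j `&` `[a, y]))%E.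
  apply: le_measure; rewrite ?inE; try exact: mU.
  by apply: setIS; apply: subset_itvl; rewrite bnd_simp ltW.
have lt_lam j : (j < J)%N ->
    (lam (U j `&` `[a, x]) + (y - x)%:E <= lam (U j `&` `[a, y]))%E.
  move=> jJ; have -> : ((y - x)%:E = lam `]x, y]%classic)%E.
    by rewrite /lam lebesgue_measure_itv/= lte_fin xy EFinB.
  rewrite -measureU//; try exact: mU.
  - apply: le_measure; rewrite ?inE; try exact: mU.
      by apply: measurableU; [exact: mU|exact: measurable_itv].
    rewrite subUset; split.
      by apply: setIS; apply: subset_itvl; rewrite bnd_simp ltW.
    move=> z /=; rewrite in_itv/= => /andP[xz zy]; split.
      by apply: (sU _ jJ); rewrite /= in_itv/= (ltW xz).
    by rewrite in_itv/= zy (le_trans ax)// ltW.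
  - rewrite -subset0 => z [[_]] /=; rewrite !in_itv/= => /andP[_ zx] /andP[xz _].
    by move: xz; rewrite ltNge zx.
rewrite /cover_mass !(nneseries_split 0 J)//= add0n addeAC leeD//; last first.
  by apply: lee_nneseries => // j _; rewrite lee_pmul2l// ?lte_fin.
have -> : (J%:R * e * (y - x))%:E = (\sum_(0 <= j < J) (e * (y - x))%:E)%E.
  by rewrite sumEFin big_const_nat subn0 iter_addr_0 -mulrA mulr_natl.
rewrite -big_split/= !big_mkord; apply: lee_sum => j _.
rewrite EFinM -ge0_muleDr//; last by rewrite lee_fin subr_ge0 ltW.
by rewrite lee_pmul2l// ?lte_fin//; exact: lt_lam.
Qed.

Lemma cover_mass_ge0 (R : realType) (a e : R) (U : nat -> set R) x :
  0 <= e -> (0 <= cover_mass a e U x)%E.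
Proof.
by move=> e0; apply: nneseries_ge0 => j _ _; rewrite mule_ge0 ?measure_ge0.
Qed.

(** The number of [j] with [k x > (j + 1) * e], times [e], is a staircase below [k x], so the sets
    [{k > (j + 1) * e}] alone contribute at most the integral. Replacing the j-th of them by [U j]
    costs at most [e / 2^(j + 1)], in total [e]. *)
Lemma cover_mass_le (R : realType) (a b e : R) (k : R -> R) (U : nat -> set R) :
  0 < e -> {in `[a, b], forall x, 0 <= k x} -> measurable_fun `[a, b] k ->
  (forall j, open (U j)) ->
  (forall j, (@lebesgue_measure R (U j `\` (`[a, b] `&` [set x | (j.+1%:R * e < k x)%R]))
     <= (1 / (2 ^ j.+1)%:R)%:E)%E) ->
  (cover_mass a e U b <=
    \int[lebesgue_measure]_(x in `[a, b]) (k x)%:E + e%:E)%E.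
Proof.
move=> e0 k0 mk oU sU; pose lam := @lebesgue_measure R.
pose E j : set (measurableTypeR R) := `[a, b] `&` [set x | (j.+1%:R * e < k x)%R].
have mE j : measurable (E j : set (measurableTypeR R)).
  have := @measurable_fun_ltr _ _ _ _ _ _ (measurable_cst ((j.+1)%:R * e)) mk.
  by move=> /(_ (measurable_itv _) [set true]); apply.
have step1 : (\sum_(0 <= j <oo) (e%:E * lam (E j)) <=
    \int[lebesgue_measure]_(x in `[a, b]) (k x)%:E)%E.
  have -> : (\sum_(0 <= j <oo) (e%:E * lam (E j)) =
      \int[lebesgue_measure]_(x in `[a, b])
        \sum_(0 <= j <oo) (e%:E * (\1_(E j) x)%:E))%E.
    rewrite integral_nneseries//; last 2 first.
    - move=> j; apply: measurable_funeM.
      by apply/measurable_EFinP; exact: measurable_indic (mE j).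
    - by move=> j x _; rewrite mule_ge0// lee_fin ltW.
    apply: eq_eseriesr => j _; rewrite ge0_integralZl//.
    - rewrite (integral_indic _ _ (mE j)); last exact: measurable_itv.
      have -> : E j `&` `[a, b] = E j; last by [].
      by apply/setIidPl => x [].
    - by apply/measurable_EFinP; exact: measurable_indic (mE j).
    - by rewrite lee_fin ltW.
  apply: ge0_le_integral => //.
  - move=> x _; apply: nneseries_ge0 => j _ _.
    by rewrite mule_ge0// lee_fin ltW.
  - apply: ge0_emeasurable_sum => [j x _ _|j _].
      by rewrite mule_ge0// lee_fin ltW.
    apply: measurable_funeM.
    by apply/measurable_EFinP; exact: measurable_indic (mE j).
  - exact/measurable_EFinP.
  - move=> x abx; apply: lime_le.
      by apply: is_cvg_nneseries => j _ _; rewrite mule_ge0// lee_fin ltW.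
    apply: nearW => m; under eq_bigr do rewrite -EFinM.
    rewrite sumEFin lee_fin big_mkord.
    (* If [k x <= (m + 1) * e] the new term is 0; otherwise all [m + 1] terms together are at most
       [(m + 1) * e < k x]. *)
    elim: m => [|m IH]; first by rewrite big_ord0 k0.
    have [kx|kx] := ltP (m.+1%:R * e) (k x); last first.
      rewrite big_ord_recr/= indicE memNset ?mulr0 ?addr0//.
      by move=> [_ /=]; rewrite ltNge kx.
    apply: (le_trans _ (ltW kx)).
    rewrite [leRHS](_ : _ = \sum_(i < m.+1) e); last first.
      by rewrite sumr_const card_ord mulr_natl.
    by apply: ler_sum => i _; rewrite indicE ler_piMr ?(ltW e0)//; case: (_ \in _) => //=; rewrite ler01.
apply: (@le_trans _ _ (\sum_(0 <= j <oo) (e%:E * lam (E j) + (e / (2 ^ j.+1)%:R)%:E))%E).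
  apply: lee_nneseries => [j _ _|j _].
    by rewrite mule_ge0 ?measure_ge0// lee_fin ltW.
  rewrite -[(e / _)%:E]/((e * _)%:E) EFinM -ge0_muleDr ?measure_ge0//.
  rewrite lee_pmul2l ?lte_fin//.
  apply: (@le_trans _ _ (lam (E j `|` (U j `\` E j)))).
    apply: le_measure; rewrite ?inE.
    - by apply: measurableI => //; exact: open_measurable.
    - apply: measurableU => //; apply: measurableD => //; exact: open_measurable.
    - by move=> x [Ux _]; case: (pselect (E j x)) => ?; [left|right].
  apply: (@le_trans _ _ (lam (E j) + lam (U j `\` E j))%E).
    apply: measureU2 => //.
    by apply: measurableD => //; exact: open_measurable.
  by rewrite leeD2l// -[X in X%:E]div1r; exact: sU.
apply: (le_trans (epsilon_trick _ _ _)).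
- by move=> j; rewrite mule_ge0 ?measure_ge0// lee_fin ltW.
- exact: ltW.
- by rewrite leeD2r.
Qed.

(** The idea is that of Vitali and Caratheodory: up to a small error [k] is dominated by a lower
    semicontinuous function with almost the same integral, and a bound on [q'] at a single point
    then persists on a short interval to its right. Continuous induction joins these intervals. *)
Lemma le_integral_derive1 (R : realType) (a b : R) (q k : R -> R) : a <= b ->
  {in `[a, b], forall x, derivable q x 1} ->
  {in `[a, b], forall x, 0 <= k x} -> measurable_fun `[a, b] k ->
  {in `[a, b], forall x, derive1 q x <= k x} ->
  ((q b - q a)%:E <= \int[lebesgue_measure]_(x in `[a, b]) (k x)%:E)%E.
Proof.
move=> ab dq k0 mk qk; pose lam := @lebesgue_measure R.
set I := (\int[lebesgue_measure]_(x in `[a, b]) (k x)%:E)%E.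
have [->|Ioo] := eqVneq I +oo%E; first exact: leey.
have I0 : (0 <= I)%E by apply: integral_ge0 => x /k0; rewrite lee_fin.
have Ifin : I \is a fin_num by rewrite ge0_fin_numE// ltey.
suff main e : 0 < e -> q b - q a <= fine I + e + 2 * e * (b - a).
  rewrite -(fineK Ifin) lee_fin; apply/ler_addgt0Pr => e e0.
  have d0 : 0 < 1 + 2 * (b - a) by rewrite ltr_pwDl// mulr_ge0// subr_ge0.
  have := main _ (divr_gt0 e0 d0).
  by rewrite -addrA mulrAC -[X in _ + (X + _)]mul1r -mulrDl mulrC divfK ?gt_eqF.
move=> e0.
have mE j : measurable (`[a, b] `&` [set x | (j.+1%:R * e < k x)%R]
    : set (measurableTypeR R)).
  have := @measurable_fun_ltr _ _ _ _ _ _ (measurable_cst (j.+1%:R * e)) mk.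
  by move=> /(_ (measurable_itv _) [set true]); apply.
have /choice[U UP] j : exists U : set R, [/\ open U,
    `[a, b] `&` [set x | (j.+1%:R * e < k x)%R] `<=` U &
    (lam (U `\` (`[a, b] `&` [set x | (j.+1%:R * e < k x)%R])) <
      (1 / (2 ^ j.+1)%:R)%:E)%E].
  apply: lebesgue_regularity_outer.
  - exact: mE.
  - apply: (@le_lt_trans _ _ (lam `[a, b]%classic)).
      by apply: le_measure; rewrite ?inE; [exact: mE|exact: measurable_itv|move=> x []].
    by rewrite /lam lebesgue_measure_itv/=; case: ifP => _; rewrite ?ltry// -EFinB ltry.
  - by rewrite divr_gt0// ltr0n expn_gt0.
have oU j : open (U j) by case: (UP j).
have EU j : `[a, b] `&` [set x | (j.+1%:R * e < k x)%R] `<=` U j by case: (UP j).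
have Fle := @cover_mass_le R a b e k U e0 k0 mk oU
  (fun j => ltW (let: And3 _ _ h := UP j in h)).
(* The slack [2 * e] per unit length pays once for the error of the difference quotient and once for
   rounding [k] to a multiple of [e]. *)
pose P x : Prop := ((q x - q a)%:E <= cover_mass a e U x + (2 * e * (x - a))%:E)%E.
suff Pb : P b.
  rewrite -lee_fin !EFinD (fineK Ifin).
  by apply: (le_trans Pb); rewrite leeD2r.
have Fmono x y : a <= x -> x <= y -> (cover_mass a e U x <= cover_mass a e U y)%E.
  move=> ax xy; have := @cover_mass_growth R a e U x y 0 e0 oU ax xy.
  by rewrite !mul0r adde0; apply.
apply: (@right_induction R a b P ab).
- by rewrite /P !subrr mulr0 adde0; apply: cover_mass_ge0; exact: ltW.
(* Limits from the left: continuity of [q] at [c] is enough, because the cover mass is monotone. *)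
- move=> c /andP[ac cb] h; apply/lee_addgt0Pr => d d0.
  have [|r r0 hr] := @derivable_near_dist R q c d _ d0.
    by apply: dq; rewrite in_itv/= (ltW ac).
  have [x [/andP[ax xb] /andP[rx xc]] Px] := h _ r0.
  have := hr x; rewrite ger0_norm ?subr_ge0// ltrBlDr -ltrBlDl => /(_ rx).
  rewrite ltr_norml => /andP[_ hd].
  apply: (@le_trans _ _ ((q x - q a)%:E + d%:E)%E).
    by rewrite -EFinD lee_fin; lra.
  rewrite leeD2r//; apply: (le_trans Px); apply: leeD; first exact: Fmono.
  by rewrite lee_fin ler_wpM2l ?lerD2r// mulr_ge0// ltW.
- move=> c /andP[ac cb] Pc.
  have cab : c \in `[a, b] by rewrite in_itv/= ac ltW.
  have [|r r0 hr] := @derivable_right_growth R q c e _ e0; first exact: dq.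
  (* By minimality [c] lies in the [J] sets [U 0], ..., [U (J - 1)], while [k c <= (J + 1) * e]:
     rounding loses a single [e]. *)
  have /ex_minnP[J kJ Jmin] : exists m : nat, k c <= m.+1%:R * e.
    exists (Num.truncn (k c / e)); rewrite -ler_pdivrMr//.
    have /truncn_itv/andP[_ /ltW//] : 0 <= k c / e by rewrite divr_ge0 ?k0// ltW.
  have inU j : (j < J)%N -> U j c.
    move=> jJ; apply: EU; split => //=; rewrite ltNge; apply/negP => /Jmin.
    by rewrite leqNgt jJ.
  have : \forall y \near c, forall j : 'I_J, U j y.
    by apply: (@filter_forall R 'I_J (fun j => U j) (nbhs c)) => j; apply: open_nbhs_nbhs; split => //; exact: inU.
  move=> [s /= s0 hs].
  pose y := c + Num.min (Num.min (r / 2) (s / 2)) (b - c).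
  have m0 : 0 < Num.min (Num.min (r / 2) (s / 2)) (b - c).
    by rewrite !lt_min !divr_gt0//= subr_gt0.
  have yr : y < c + r.
    by rewrite ltrD2l !gt_min; apply/orP; left; apply/orP; left; lra.
  have ys : y < c + s.
    by rewrite ltrD2l !gt_min; apply/orP; left; apply/orP; right; lra.
  have cy : c < y by rewrite ltrDl.
  have yb : y <= b by rewrite -lerBrDl ge_min lexx orbT.
  exists y; first by rewrite cy.
  have hq : q y - q c <= (J.+2%:R * e) * (y - c).
    have := hr y; rewrite cy yr => /(_ isT) /le_trans; apply.
    rewrite ler_wpM2r ?subr_ge0 ?(ltW cy)//.
    rewrite -[J.+2]addn1 natrD mulrDl mul1r lerD2r.
    exact: le_trans (qk _ cab) kJ.
  have := @cover_mass_growth R a e U c y J e0 oU ac (ltW cy).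
  have sub j : (j < J)%N -> `[c, y] `<=` U j.
    move=> jJ z /=; rewrite in_itv/= => /andP[cz zy].
    suff /hs/(_ (Ordinal jJ)) : ball_ [eta Num.Def.normr] c s z by [].
    rewrite /ball_/= distrC ger0_norm ?subr_ge0// ltrBlDl.
    exact: le_lt_trans ys.
  move=> /(_ sub) hF; rewrite /P.
  apply: (@le_trans _ _ (cover_mass a e U c + (J%:R * e * (y - c))%:E +
     (2 * e * (y - a))%:E)%E); last by rewrite leeD2r.
  apply: (@le_trans _ _ ((q c - q a)%:E + (J.+2%:R * e * (y - c))%:E)%E).
    by rewrite -EFinD lee_fin; lra.
  rewrite -addeA; apply: (@le_trans _ _ (cover_mass a e U c +
     (2 * e * (c - a))%:E + (J.+2%:R * e * (y - c))%:E)%E); first by rewrite leeD2r.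
  rewrite -addeA leeD2l// -!EFinD lee_fin -(addn2 J) natrD.
  by clearbody y; lra.
Qed.

(** * Dilations in eigencoordinates *)

Lemma coord_le_mx_norm (R : realType) (m n : nat) (x : 'M[R]_(m, n)) i j :
  `|x i j| <= `|x|.
Proof.
by rewrite [leRHS]/Num.Def.normr/= mx_normrE; exact: (le_bigmax _ _ (i, j)).
Qed.

Lemma mx_norm_le_coord (R : realType) (m n : nat) (x : 'M[R]_(m, n)) e :
  0 <= e -> (forall i j, `|x i j| <= e) -> `|x| <= e.
Proof.
by move=> e0 xe; rewrite [leLHS]/Num.Def.normr/= mx_normrE bigmax_le.
Qed.

Lemma mx_norm_lt_coord (R : realType) (m n : nat) (x : 'M[R]_(m, n)) e :
  0 < e -> (forall i j, `|x i j| < e) -> `|x| < e.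
Proof.
by move=> e0 xe; rewrite [ltLHS]/Num.Def.normr/= mx_normrE; apply/bigmax_ltP.
Qed.

Lemma cvg_mx (R : realType) (m n : nat) (T : Type) (F : set_system T)
    {FF : Filter F} (f : T -> 'M[R]_(m, n)) (l : 'M[R]_(m, n)) :
  (forall i j, f x i j @[x --> F] --> l i j) -> f x @[x --> F] --> l.
Proof.
move=> fl; apply/cvgrPdist_lt => e e0; near=> x.
apply: mx_norm_lt_coord => // i j; rewrite !mxE.
suff : forall ij : 'I_m * 'I_n, `|l ij.1 ij.2 - f x ij.1 ij.2| < e.
  by move/(_ (i, j)).
near: x; apply: filter_forall => -[i j] /=.
by have /cvgrPdist_lt/(_ _ e0) := fl i j.
Unshelve. all: by end_near. Qed.

(** Row [i] of [P] is an eigenvector for [d 0 i], nonzero because [P] is invertible; the trace does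
    not see the conjugation. *)
Lemma diag_conj_positive (R : realType) (n : nat) (A : 'M[R]_n.+1) :
  diagonalizable A -> (forall a, eigenvalue A a -> 0 < a) ->
  exists P : 'M[R]_n.+1, exists d : 'rV[R]_n.+1,
    [/\ P \in unitmx, A = invmx P *m diag_mx d *m P, forall i, 0 < d 0 i
      & \tr A = \sum_i d 0 i].
Proof.
move=> [P Pu /(similar_diagLR Pu)[d ]]; rewrite conjVmx// => AE Apos.
exists P, d; split => //.
  move=> i; apply: Apos; apply/eigenvalueP; exists (row i P).
    by rewrite AE !mulmxA -row_mul mulmxV// row1 -rowE row_diag_mx -scalemxAl -rowE.
  apply/eqP => Pi0; have : row i (P *m invmx P) = 0 by rewrite row_mul Pi0 mul0mx.
  rewrite mulmxV// row1 => /rowP/(_ i); rewrite !mxE !eqxx/=.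
  by apply/eqP; rewrite oner_eq0.
by rewrite AE -mulmxA mxtrace_mulC -mulmxA mulmxV// mulmx1 mxtrace_diag.
Qed.

Lemma mulmx_diag_mulmxE (R : comNzRingType) (m n p : nat) (A : 'M[R]_(m, n))
    (d : 'rV[R]_n) (B : 'M[R]_(n, p)) i j :
  (A *m diag_mx d *m B) i j = \sum_l A i l * d 0 l * B l j.
Proof.
rewrite mxE; apply: eq_bigr => l _; congr (_ * _).
rewrite mxE (bigD1 l)//= mxE eqxx mulr1n big1 ?addr0// => u ul.
by rewrite mxE (negbTE ul) mulr0n mulr0.
Qed.

Lemma expmx_conj_diag (R : realType) (n : nat) (P : 'M[R]_n.+1)
    (d : 'rV[R]_n.+1) (t : R) : P \in unitmx ->
  expmx (t *: (invmx P *m diag_mx d *m P)) =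
  invmx P *m diag_mx (\row_i expR (t * d 0 i)) *m P.
Proof.
move=> Pu.
have pow k : (t *: (invmx P *m diag_mx d *m P)) ^+ k =
    invmx P *m diag_mx (\row_i (t * d 0 i) ^+ k) *m P.
  elim: k => [|k IH].
    rewrite expr0 (_ : diag_mx _ = 1%:M) ?mulmx1 ?mulVmx//.
    by apply/matrixP => i j; rewrite !mxE expr0.
  rewrite exprS IH -mulmxE -scalemxAl -!mulmxA scalemxAr; congr (_ *m _).
  rewrite [P *m _]mulmxA mulmxV// mul1mx [diag_mx d *m _]mulmxA scalemxAl.
  congr (_ *m _); rewrite mulmx_diag; apply/matrixP => i j; rewrite !mxE.
  by rewrite mulrnAr exprS mulrA.
rewrite /expmx; apply/cvg_lim => //.
have serE k : series (fun k => (k`!%:R)^-1 *: (t *: (invmx P *m diag_mx d *m P)) ^+ k) k =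
    invmx P *m diag_mx (\row_i series (exp_coeff (t * d 0 i)) k) *m P.
  rewrite /series/=; elim: k => [|k IH].
    rewrite big_geq// (_ : diag_mx _ = 0) ?mulmx0 ?mul0mx//.
    by apply/matrixP => i j; rewrite !mxE big_geq// mul0rn.
  rewrite big_nat_recr//= IH pow scalemxAl scalemxAr -mulmxDl -mulmxDr.
  congr (_ *m _ *m _); apply/matrixP => i j; rewrite !mxE.
  rewrite big_nat_recr//= mulrnDl; congr (_ + _).
  by rewrite mulrnAr /exp_coeff/= mulrC.
rewrite (funext serE).
apply: cvg_mx => i j.
under eq_fun do rewrite mulmx_diag_mulmxE; rewrite mulmx_diag_mulmxE.
apply: (cvg_big add_continuous) => l _; apply: cvgMr_tmp; apply: cvgMl_tmp.
under eq_fun do rewrite mxE; rewrite mxE.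
exact: is_cvg_series_exp_coeff.
Qed.

Lemma dil_coordE (R : realType) (n : nat) (G : homogeneous_group R n) :
  exists P : 'M[R]_n.+1, exists d : 'rV[R]_n.+1,
    [/\ P \in unitmx, forall i, 0 < d 0 i, hom_dim G = \sum_i d 0 i &
      forall t (x : 'rV[R]_n.+1), x *m expmx (t *: hg_A0 G) =
        x *m invmx P *m diag_mx (\row_i expR (t * d 0 i)) *m P].
Proof.
have [P [d [Pu AE d0 trE]]] := diag_conj_positive (hg_A0_diag G) (@hg_A0_pos _ _ G).
exists P, d; split => // t x.
by rewrite AE expmx_conj_diag// !mulmxA.
Qed.

(** The parameter is [t = ln s], because [ln] is not continuous at 0. Joint measurability in
    [(s, x)] follows later by composing with the measurable function [ln]. *)
Lemma dil_continuous (R : realType) (n : nat) (G : homogeneous_group R n) :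
  continuous (fun z : R * 'rV[R]_n.+1 => z.2 *m expmx (z.1 *: hg_A0 G)).
Proof.
have [P [d [_ _ _ dE]]] := dil_coordE G.
under eq_fun do rewrite dE.
move=> z; apply: cvg_mx => i j.
under eq_fun do rewrite mulmx_diag_mulmxE; rewrite mulmx_diag_mulmxE.
apply: (cvg_big add_continuous) => l _; apply: cvgMr_tmp; apply: cvgM.
  under eq_fun do rewrite mxE; rewrite mxE.
  apply: (cvg_big add_continuous) => u _; apply: cvgMr_tmp.
  apply: (@cvg_comp _ _ _ snd (fun y : 'rV[R]_n.+1 => y i u) _ (nbhs z.2)).
    exact: cvg_snd.
  exact: coord_continuous.
under eq_fun do rewrite mxE; rewrite mxE.
apply: continuous_cvg; first exact: continuous_expR.
by apply: cvgMr_tmp; exact: cvg_fst.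
Qed.

Section dilations.
Variables (R : realType) (n : nat) (G : homogeneous_group R n).
Implicit Types (a b s : R) (x y : 'rV[R]_n.+1).

Lemma dilM a b x : 0 < a -> 0 < b -> dil G a (dil G b x) = dil G (a * b) x.
Proof.
move=> a0 b0; rewrite /dil /dilation; have [P [d [Pu _ _ dE]]] := dil_coordE G.
rewrite !dE -!mulmxA; congr (_ *m (_ *m _)).
rewrite (mulmxA P) mulmxV// mul1mx mulmxA mulmx_diag; congr (diag_mx _ *m _); apply/rowP => i; rewrite !mxE.
by rewrite -expRD -mulrDl lnM ?posrE// addrC.
Qed.

Lemma dil1 x : dil G 1 x = x.
Proof.
rewrite /dil /dilation; have [P [d [Pu _ _ dE]]] := dil_coordE G.
rewrite dE (_ : diag_mx _ = 1%:M) ?mulmx1 ?mulmxKV//.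
by apply/matrixP => i j; rewrite !mxE ln1 mul0r expR0.
Qed.

Lemma dilK s : 0 < s -> cancel (dil G s) (dil G s^-1).
Proof. by move=> s0 x; rewrite dilM ?invr_gt0// mulVf ?gt_eqF// dil1. Qed.

Lemma dilVK s : 0 < s -> cancel (dil G s^-1) (dil G s).
Proof. by move=> s0 x; rewrite dilM ?invr_gt0// mulfV ?gt_eqF// dil1. Qed.

Lemma dil0 s : dil G s 0 = 0.
Proof. by rewrite /dil /dilation mul0mx. Qed.

Lemma continuous_dil s : continuous (dil G s).
Proof.
move=> x; rewrite /dil /dilation.
apply: (@continuous_comp _ _ _ (fun y : 'rV[R]_n.+1 => (ln s, y))
  (fun z : R * 'rV[R]_n.+1 => z.2 *m expmx (z.1 *: hg_A0 G)) x).
  exact: (@cvg_pair _ _ _ (nbhs x) (nbhs (ln s)) (nbhs x) _ _ _ (cst (ln s)) id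
    (@cvg_cst _ (ln s) _ (nbhs x) _) cvg_id).
exact: (@dil_continuous R n G (ln s, x)).
Qed.

Lemma derivable_dil s x : 0 < s -> derivable (fun r => dil G r x) s 1.
Proof.
move=> s0; have [P [d [Pu _ _ dE]]] := dil_coordE G.
apply/derivable_mxP => i j.
have -> : (fun r => dil G r x i j) =
    \sum_l (fun r : R => (x *m invmx P) i l * expR (ln r * d 0 l) * P l j).
  apply/funext => r; rewrite /dil /dilation dE mulmx_diag_mulmxE fct_sumE.
  by apply: eq_bigr => l _; rewrite [X in _ * X * _]mxE.
apply: derivable_sum => l.
have h1 : derivable (fun r : R => ln r * d 0 l) s 1.
  by apply: derivableM => //; exact: (@ex_derive _ _ _ _ _ _ _ (is_derive1_ln s0)).
have h : derivable (fun r : R => expR (ln r * d 0 l)) s 1.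
  apply/derivable1_diffP.
  apply: (@differentiable_comp _ _ _ _ (fun r => ln r * d 0 l) expR).
    exact/derivable1_diffP.
  exact/derivable1_diffP/derivable_expR.
apply: (@derivableM _ _ (fun r : R => (x *m invmx P) i l * expR (ln r * d 0 l))
  (cst (P l j))); last exact: derivable_cst.
exact: (@derivableM _ _ (cst ((x *m invmx P) i l)) _ _ _ (derivable_cst _ _ _) h).
Qed.

(** In eigencoordinates [D_s] multiplies the i-th coordinate by [s^(d i)], and all exponents are
    positive. *)
Lemma dil_near0 x e : 0 < e ->
  exists2 r, 0 < r & forall s, 0 < s < r -> `|dil G s x| < e.
Proof.
move=> e0; have [P [d [Pu d0 _ dE]]] := dil_coordE G.
have h : dil G s x @[s --> 0^'+] --> (0 : 'rV[R]_n.+1).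
  rewrite /dil /dilation; under eq_fun do rewrite dE.
  apply: cvg_mx => i j; under eq_fun do rewrite mulmx_diag_mulmxE.
  have -> : (0 : 'rV[R]_n.+1) i j = \sum_l (x *m invmx P) i l * 0 * P l j.
    by rewrite mxE big1// => l _; rewrite mulr0 mul0r.
  apply: (cvg_big add_continuous) => l _; apply: cvgMr_tmp; apply: cvgMl_tmp.
  under eq_fun do rewrite mxE.
  apply/cvgrPdist_lt => u u0.
  near=> s; rewrite sub0r normrN gtr0_norm ?expR_gt0//.
  have s0 : 0 < s by near: s; exact: nbhs_right_gt.
  rewrite -ltr_ln ?posrE ?expR_gt0// expRK -ltr_pdivlMr//.
  by rewrite -ltr_expR lnK ?posrE//; near: s; apply: nbhs_right_lt; exact: expR_gt0.
have /cvgrPdist_lt/(_ _ e0)[r/= r0 hr] := h.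
exists r => // s /andP[s0 sr]; have := hr s; rewrite /ball_/= !sub0r !normrN.
by rewrite gtr0_norm//; apply.
Unshelve. all: by end_near. Qed.

End dilations.

(** * C1 functions along curves *)

Lemma mean_value_direction (R : realType) (V : normedModType R) (g : V -> R)
    (v x : V) (t : R) : (forall y, derivable g y v) ->
  exists2 c, Num.min 0 t <= c <= Num.max 0 t &
    g (x + t *: v) - g x = t * 'D_v g (x + c *: v).
Proof.
move=> dg; pose q u := g (x + u *: v).
have quot (u h : R) : h^-1 *: ((q \o shift u) h%:A - q u) =
    h^-1 *: ((g \o shift (x + u *: v)) (h *: v) - g (x + u *: v)).
  by rewrite /q /= scaler1 scalerDl (addrC (h *: v)) addrA (addrC _ (h *: v)).
have dq (u : R) : is_derive u 1 q ('D_v g (x + u *: v)).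
  split; first by rewrite /derivable (funext (quot u)); exact: dg.
  by rewrite /derive (funext (quot u)).
have cq (a b : R) : {within `[a, b], continuous q}.
  by apply: derivable_within_continuous => u _; apply: ex_derive.
have [t0|t0] := leP 0 t.
  have [c] := @MVT_segment _ q (fun u => 'D_v g (x + u *: v)) 0 t t0 (fun u _ => dq u) (cq _ _).
  rewrite in_itv/= => ct E; exists c => //.
  by move: E; rewrite /q scale0r addr0 subr0 mulrC.
have [c] := @MVT_segment _ q (fun u => 'D_v g (x + u *: v)) t 0 (ltW t0) (fun u _ => dq u) (cq _ _).
rewrite in_itv/= => ct E; exists c => //.
move: E; rewrite /q scale0r addr0 sub0r => /(congr1 -%R).
by rewrite opprB mulrN opprK mulrC.
Qed.

(** One walks from [x] to [y] changing one coordinate at a time and applies the mean value theorem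
    on each edge. [Ck] provides directional derivatives only, and this formula replaces total
    differentiability below. *)
Lemma mean_value_coords (R : realType) (n : nat) (g : 'rV[R]_n -> R)
    (x y : 'rV[R]_n) : (forall k y, derivable g y (delta_mx 0 k)) ->
  exists xi : 'I_n -> 'rV[R]_n,
    (forall k i, Num.min (x 0 i) (y 0 i) <= xi k 0 i
                 <= Num.max (x 0 i) (y 0 i)) /\
    g y - g x = \sum_k (y - x) 0 k * 'D_(delta_mx 0 k) g (xi k).
Proof.
move=> dg; pose h := y - x.
have yE : y = x + h by rewrite /h addrC subrK.
have yiE i : y 0 i = x 0 i + h 0 i by rewrite yE mxE.
(* [hd k] keeps the first [k] coordinates of the increment: the k-th vertex of the staircase
   path. *)
rewrite -/h; clearbody h; pose hd (k : nat) : 'rV[R]_n := \row_i (if (i < k)%N then h 0 i else 0).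
have hdS (k : 'I_n) : hd k.+1 = hd k + h 0 k *: delta_mx 0 k.
  apply/rowP => i; rewrite !mxE eqxx/= ltnS leq_eqVlt.
  have [->|ik] := eqVneq i k; first by rewrite eqxx/= ltnn mulr1 add0r.
  by rewrite -val_eqE/= in ik; rewrite (negbTE ik)/= mulr0 addr0.
have /choice[c cP] (k : 'I_n) : exists c, Num.min 0 (h 0 k) <= c <= Num.max 0 (h 0 k) /\
    g (x + hd k.+1) - g (x + hd k) =
    h 0 k * 'D_(delta_mx 0 k) g (x + hd k + c *: delta_mx 0 k).
  have [c c1 c2] := mean_value_direction (x + hd k) (h 0 k) (dg k).
  by exists c; split => //; rewrite hdS addrA.
exists (fun k : 'I_n => x + hd k + c k *: delta_mx 0 k); split.
  move=> k i; rewrite yiE !mxE eqxx/=; have [ck _] := cP k.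
  have [->|ik] := eqVneq i k.
    rewrite ltnn addr0 mulr1; move: ck.
    by rewrite !minEle !maxEle lerDl; case: ifP => _ /andP[? ?]; apply/andP; split; lra.
  rewrite mulr0 addr0; case: ifP => _.
    by rewrite ge_min le_max !lexx !orbT.
  by rewrite addr0 ge_min le_max !lexx.
rewrite -(eq_bigr _ (fun k _ => (cP k).2)).
rewrite yE; have -> : h = hd n by apply/rowP => i; rewrite mxE ltn_ord.
rewrite -[X in g X]addr0 -[X in _ - g X]addr0 -[0 in X in _ - X](_ : hd 0%N = 0).
  by rewrite addr0 -(big_mkord xpredT (fun k => g (x + hd k.+1) - g (x + hd k))) telescope_sumr.
by apply/rowP => i; rewrite !mxE.
Qed.

(** The difference quotient is a sum of quotients of the coordinates of [c], each multiplied by a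
    partial derivative of [g] at an intermediate point; these points are squeezed towards [c s],
    where the partial derivatives are continuous. *)
Lemma derivable_comp_coords (R : realType) (n : nat) (g : 'rV[R]_n -> R)
    (c : R -> 'rV[R]_n) (s : R) :
  (forall k y, derivable g y (delta_mx 0 k)) ->
  (forall k, continuous (fun y => 'D_(delta_mx 0 k) g y)) ->
  derivable c s 1 -> derivable (fun r => g (c r)) s 1.
Proof.
move=> dg cg dc.
have /choice[xi xiP] t := mean_value_coords (c s) (c (t + s)) dg.
pose D k := 'D_(delta_mx 0 k) g.
have dck k : derivable (fun r => c r 0 k) s 1 by have /derivable_mxP := dc; apply.
have cshift : c (t + s) @[t --> 0^'] --> c s.
  have /derivable1_diffP/differentiable_continuous cc := dc.
  apply: (cvg_comp (fun t : R => t + s) c _ cc).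
  suff h : t + s @[t --> (0 : R)^'] --> 0 + s by rewrite add0r in h.
  by apply: cvgD; [exact: (@cvg_within _ (nbhs (0 : R)))|exact: cvg_cst].
have cxi k : xi t k @[t --> 0^'] --> c s.
  apply/cvgrPdist_lt => e e0; have /cvgrPdist_lt/(_ _ e0) := cshift.
  apply: filterS => t; have [xik _] := xiP t => ct.
  apply: mx_norm_lt_coord => // i j; rewrite ord1 !mxE.
  have /andP[l u] := xik k j.
  have : `|(c s - c (t + s)) 0 j| < e.
    by apply: le_lt_trans ct; exact: coord_le_mx_norm.
  rewrite !mxE !ltr_norml => /andP[h1 h2].
  by move: l u; rewrite minEle maxEle; case: ifP => _ l u; apply/andP; split; lra.
apply/cvg_ex; exists (\sum_k 'D_1 (fun r => c r 0 k) s * D k (c s)).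
have -> : (fun h : R => h^-1 *: (((fun r => g (c r)) \o shift s) h%:A - g (c s))) =
   (fun h : R => \sum_k (h^-1 *: (((fun r => c r 0 k) \o shift s) h%:A - c s 0 k)) * D k (xi h k)).
  apply/funext => h; rewrite /= scaler1; have [_] := xiP h.
  move=> ->; rewrite scaler_sumr; apply: eq_bigr => k _.
  by rewrite !mxE /D scalerAl.
apply: (cvg_big add_continuous) => k _; apply: cvgM; first exact: dck.
apply: (cvg_comp (fun t => xi t k) (D k) (cxi k)).
exact: cg.
Qed.

Lemma Ck1_coord (R : realType) (V : normedModType R) (m : nat)
    (g : V -> 'rV[R]_m) (v : V) (j : 'I_m) : Ck 1 g ->
  (forall x, derivable (fun y => g y 0 j) x v) /\
  continuous (fun x => 'D_v (fun y => g y 0 j) x).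
Proof.
move=> [_ /(_ v)[dg cg]].
have dgj x : derivable (fun y => g y 0 j) x v by have /derivable_mxP := dg x; apply.
split => //; rewrite (_ : (fun x => _) = (fun M : 'rV[R]_m => M 0 j) \o (fun x => 'D_v g x)).
  by move=> x; apply: continuous_comp; [exact: cg|exact: coord_continuous].
by apply/funext => x /=; rewrite derive_mx// mxE.
Qed.

Lemma Ck1_real (R : realType) (V : normedModType R) (g : V -> R) (v : V) :
  Ck 1 g -> (forall x, derivable g x v) /\ continuous (fun x => 'D_v g x).
Proof. by move=> [_ /(_ v)]. Qed.

Definition mx_box (R : realType) (n : nat) (M : R) : set 'rV[R]_n :=
  [set x | forall i, x 0 i \in `[- M, M]].

Lemma compact_mx_box (R : realType) (n : nat) (M : R) : compact (@mx_box R n M).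
Proof.
apply: (@rV_compact _ _ (fun=> `[- M, M]%classic)).
by move=> _; exact: segment_compact.
Qed.

Lemma compact_bound (R : realType) (T : topologicalType) (A : set T) (F : T -> R) :
  compact A -> continuous F -> exists2 C, 0 < C & forall x, A x -> `|F x| <= C.
Proof.
move=> cA cF.
have : compact [set F x | x in A].
  by apply: continuous_compact => //; exact: continuous_subspaceT.
move=> /compact_bounded[M [_ hM]].
exists (Num.max M 0 + 1); first by rewrite ltr_pwDr// le_max lexx orbT.
move=> x Ax; apply: hM; last by exists x.
by rewrite (@le_lt_trans _ _ (Num.max M 0)) ?le_max ?lexx// ltrDl.
Qed.

(** The partial derivatives are bounded on the compact product of boxes, and the intermediate points
    stay in the box, which is a product of intervals. Applied to the group law, it bounds all left
    translations by [a] in a box with one constant. *)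
Lemma Ck1_lipschitz_snd (R : realType) (n m p : nat)
    (g : 'rV[R]_n * 'rV[R]_m -> 'rV[R]_p) (M : R) : Ck 1 g ->
  exists2 C, 0 < C & forall a x y, mx_box M a -> mx_box M x -> mx_box M y ->
    `|g (a, x) - g (a, y)| <= C * `|x - y|.
Proof.
move=> gC1.
pose v (k : 'I_m) : 'rV[R]_n * 'rV[R]_m := (0, delta_mx 0 k).
pose g_ (j : 'I_p) z := g z 0 j.
have /choice[C CP] (jk : 'I_p * 'I_m) : exists C, 0 < C /\ forall z,
    (mx_box M `*` mx_box M) z -> `|'D_(v jk.2) (g_ jk.1) z| <= C.
  have [_ cD] := Ck1_coord (v jk.2) jk.1 gC1.
  have [C C0 hC] := compact_bound (compact_setX (@compact_mx_box R n M) (@compact_mx_box R m M)) cD.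
  by exists C.
exists (1 + \sum_jk C jk); first by rewrite ltr_pwDl// sumr_ge0// => jk _; have [/ltW] := CP jk.
move=> a x y aM xM yM.
apply: mx_norm_le_coord => [|i j].
  by rewrite mulr_ge0// addr_ge0// sumr_ge0// => jk _; have [/ltW] := CP jk.
rewrite ord1 !mxE.
pose q z := g_ j (a, z).
have quot k z (h : R) : h^-1 *: ((q \o shift z) (h *: delta_mx 0 k) - q z) =
    h^-1 *: ((g_ j \o shift (a, z)) (h *: v k) - g_ j (a, z)).
  rewrite /q /v /=; congr (_ *: (g_ j _ - _)).
  by apply/pair_equal_spec; split => /=; rewrite ?scaler0 ?add0r.
have dq k z : derivable q z (delta_mx 0 k).
  rewrite /derivable (funext (quot k z)).
  by have [dgv _] := Ck1_coord (v k) j gC1; exact: dgv.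
have DqE k z : 'D_(delta_mx 0 k) q z = 'D_(v k) (g_ j) (a, z).
  by rewrite /derive (funext (quot k z)).
have [xi [xiP]] := mean_value_coords y x dq.
rewrite /q /g_ => ->.
apply: (le_trans (ler_norm_sum _ _ _)).
rewrite mulrDl mul1r mulr_suml; apply: (@le_trans _ _ (\sum_k C (j, k) * `|x - y|)).
  apply: ler_sum => k _; rewrite normrM mulrC ler_pM//; last exact: coord_le_mx_norm.
  rewrite DqE; apply: (CP (j, k)).2; split => //= l.
  have /andP[h1 h2] := xiP k l; rewrite in_itv/=.
  move: (xM l) (yM l); rewrite !in_itv/= => /andP[? ?] /andP[? ?].
  by move: h1 h2; rewrite minEle maxEle; case: ifP => _ ? ?; apply/andP; split; lra.
rewrite ler_wpDl// (bigID (fun jk : 'I_p * 'I_m => jk.1 == j))/=.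
rewrite -[leLHS]addr0 lerD//; last first.
  by rewrite sumr_ge0// => jk _; rewrite mulr_ge0//; have [/ltW] := CP jk.
rewrite (reindex (fun k => (j, k)))/=.
  by rewrite le_eqVlt; apply/orP; left; apply/eqP/eq_bigl => k; rewrite eqxx.
exists snd => // -[j' k]; rewrite inE/= => /eqP ->//.
Qed.

(** * Borel maps *)

(** Only the topology of the codomain enters, so maps into [R] and into row vectors are treated
    alike. *)
Definition borel_map d (T : measurableType d) (V : topologicalType) (f : T -> V) :=
  forall U : set V, open U -> measurable (f @^-1` U).

Definition dense_sequence (R : realType) (V : normedModType R) (u : nat -> V) :=
  forall x e, 0 < e -> exists i, `|x - u i| < e.

Lemma dense_sequence_rV (R : realType) (n : nat) :
  exists u : nat -> 'rV[R]_n.+1, dense_sequence u.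
Proof.
exists (fun i => map_mx ratr (odflt 0 (@unpickle 'rV[rat]_n.+1 i))) => x e e0.
have /choice[q qP] (j : 'I_n.+1) : exists q : rat, ratr q \in `]x 0 j - e, x 0 j + e[.
  by apply: rat_in_itvoo; lra.
exists (pickle (\row_j q j : 'rV[rat]_n.+1)); rewrite pickleK/=.
apply: mx_norm_lt_coord => // i j; rewrite ord1 !mxE.
by have := qP j; rewrite in_itv/= ltr_norml => /andP[? ?]; apply/andP; split; lra.
Qed.

Lemma dense_sequence_R (R : realType) : exists u : nat -> R, dense_sequence (u : nat -> R^o).
Proof.
exists (fun i => ratr (odflt 0 (@unpickle rat i))) => x e e0.
have [q] := @rat_in_itvoo R (x - e) (x + e) ltac:(lra).
rewrite in_itv/= => /andP[? ?]; exists (pickle q); rewrite pickleK/=.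
by rewrite ltr_norml; apply/andP; split; lra.
Qed.

(** The product sigma-algebra contains the open sets of [V1 * V2] by separability: an open set is a
    countable union of products of balls with centres in the dense sequences and radii
    [1 / (k + 1)]. *)
Lemma borel_map_continuous2 d (T : measurableType d) (R : realType)
    (V1 V2 : normedModType R) (V : topologicalType) (u1 : nat -> V1) (u2 : nat -> V2)
    (f : T -> V1) (g : T -> V2) (h : V1 * V2 -> V) :
  dense_sequence u1 -> dense_sequence u2 ->
  borel_map f -> borel_map g -> continuous h -> borel_map (fun t => h (f t, g t)).
Proof.
move=> du1 du2 mf mg ch U oU.
have oO : open (h @^-1` U) by apply: open_comp => // z _; exact: ch.
pose r k : R := k.+1%:R^-1.
have r0 k : 0 < r k by rewrite invr_gt0.
pose B (ijk : nat * nat * nat) : set T :=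
  if `[< ball (u1 ijk.1.1) (r ijk.2) `*` ball (u2 ijk.1.2) (r ijk.2) `<=` h @^-1` U >]
  then f @^-1` ball (u1 ijk.1.1) (r ijk.2) `&` g @^-1` ball (u2 ijk.1.2) (r ijk.2)
  else set0.
suff -> : (fun t => h (f t, g t)) @^-1` U = \bigcup_ijk B ijk.
  apply: countable_bigcupT_measurable => // ijk; rewrite /B; case: asboolP => _ //.
  by apply: measurableI; [apply: mf|apply: mg]; exact: ball_open.
apply/seteqP; split => [t /= ht|t [[[i j] k] _]]; last first.
  by rewrite /B/=; case: asboolP => // s [ft gt]; exact: s.
have : nbhs (f t, g t) (h @^-1` U) by apply: open_nbhs_nbhs.
move=> /nbhs_ballP[e /= e0 he].
(* A ball of radius [r k] whose centre is within [r k] of a point lies in the ball of radius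
   [2 * r k] about that point. *)
have [k ke] : exists k, r k < e / 2.
  have [k] := @ltr_add_invr R 0 (e / 2) ltac:(by rewrite divr_gt0).
  by rewrite add0r => ?; exists k.
have [i fi] := du1 (f t) _ (r0 k); have [j gj] := du2 (g t) _ (r0 k).
exists (i, j, k) => //; rewrite /B/=; case: asboolP => [_|]; last first.
  case => -[x y] [/= xi yj]; apply: he; split => /=.
    rewrite -ball_normE/=; rewrite -ball_normE/= in xi.
    by rewrite -(subrKA (u1 i)) (le_lt_trans (ler_normD _ _))//; lra.
  rewrite -ball_normE/=; rewrite -ball_normE/= in yj.
  by rewrite -(subrKA (u2 j)) (le_lt_trans (ler_normD _ _))//; lra.
by split; rewrite /= -ball_normE/= distrC.
Qed.

Section borel_space.
Variables (R : realType) (n : nat).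
Local Notation B := (borel_space R n).

Lemma borel_open (U : set 'rV[R]_n.+1) : open U -> measurable (U : set B).
Proof. by move=> oU; exact: sub_sigma_algebra. Qed.

Lemma borel_closed (U : set 'rV[R]_n.+1) : closed U -> measurable (U : set B).
Proof. by move=> cU; rewrite -[U]setCK; apply: measurableC; apply: borel_open; exact: closed_openC. Qed.

Lemma borel_compact (U : set 'rV[R]_n.+1) : compact U -> measurable (U : set B).
Proof. by move=> cU; apply: borel_closed; apply: compact_closed cU; exact: norm_hausdorff. Qed.

Lemma borel_map_id : borel_map (fun x : B => (x : 'rV[R]_n.+1)).
Proof. by move=> U oU; exact: borel_open. Qed.

Lemma borel_map_measurable d (T : measurableType d) (f : T -> 'rV[R]_n.+1) :
  borel_map f -> measurable_fun setT (f : T -> B).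
Proof.
move=> mf; apply: (@measurability _ _ T B setT f (@open 'rV[R]_n.+1)) => // _ [U oU <-].
by rewrite setTI; exact: mf.
Qed.

Lemma borel_map_continuous d (T : measurableType d) (V W : topologicalType)
    (f : T -> V) (h : V -> W) :
  borel_map f -> continuous h -> borel_map (h \o f).
Proof.
by move=> mf ch U oU; apply: (mf (h @^-1` U)); apply: open_comp => // z _; exact: ch.
Qed.

Lemma borel_map_measurableR d (T : measurableType d) (f : T -> R) :
  borel_map (f : T -> R^o) <-> measurable_fun setT f.
Proof.
split=> [mf|mf U oU].
  apply: (measurability _ (RGenOpens.measurableE R)) => _ [_ [a [b ->] <-]].
  by rewrite setTI; apply: mf; exact: interval_open.
by rewrite -[X in measurable X]setTI; apply: mf => //; exact: open_measurable.
Qed.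

Lemma borel_continuous_measurable (h : 'rV[R]_n.+1 -> R) :
  continuous h -> measurable_fun setT (h : B -> R).
Proof.
move=> ch; apply/borel_map_measurableR.
exact: (@borel_map_continuous _ _ _ _ _ (h : 'rV[R]_n.+1 -> R^o) borel_map_id ch).
Qed.

End borel_space.

Section tonelli.
Context d1 d2 (T1 : measurableType d1) (T2 : measurableType d2) (R : realType).

(** Haar measure is given as a plain measure; the Tonelli theorems want a bundled sigma-finite one,
    so the proof of sigma-finiteness is attached to it here. *)
Definition sigma_finite_pack d (T : measurableType d) (m : {measure set T -> \bar R})
    (s : sigma_finite setT m) : {sigma_finite_measure set T -> \bar R} :=
  HB.pack_for (SigmaFiniteMeasure.type T R) (Measure.sort m)
    (isSFinite.Build _ _ _ _ (sfinite_measure_sigma_finite s))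
    (isSigmaFinite.Build _ _ _ _ s).

Variables (m1 : {measure set T1 -> \bar R}) (m2 : {measure set T2 -> \bar R}).
Hypotheses (s1 : sigma_finite setT m1) (s2 : sigma_finite setT m2).

Lemma tonelli_swap (f : T1 * T2 -> \bar R) : measurable_fun setT f ->
  (forall z, (0 <= f z)%E) ->
  (\int[m1]_x \int[m2]_y f (x, y) = \int[m2]_y \int[m1]_x f (x, y))%E.
Proof.
move=> mf f0.
exact: (@fubini_tonelli _ _ _ _ _ (sigma_finite_pack s1) (sigma_finite_pack s2)).
Qed.

Lemma measurable_integral_snd (f : T1 * T2 -> \bar R) : measurable_fun setT f ->
  (forall z, (0 <= f z)%E) ->
  measurable_fun setT (fun x => \int[m2]_y f (x, y))%E.
Proof.
move=> mf f0.
exact: (@measurable_fun_fubini_tonelli_F _ _ _ _ _ (sigma_finite_pack s2)).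
Qed.

Lemma measurable_integral_fst (f : T1 * T2 -> \bar R) : measurable_fun setT f ->
  (forall z, (0 <= f z)%E) ->
  measurable_fun setT (fun y => \int[m1]_x f (x, y))%E.
Proof.
move=> mf f0.
exact: (@measurable_fun_fubini_tonelli_G _ _ _ _ _ (sigma_finite_pack s1)).
Qed.
End tonelli.

(** * Haar measure and its uniqueness *)

Section group_laws.
Variables (R : realType) (n : nat) (G : homogeneous_group R n).
Local Notation V := 'rV[R]_n.+1.
Local Notation "x ** y" := (hg_mul G x y) (at level 40, left associativity).
Local Notation inv := (hg_inv G).

Lemma hg_mulK x y : inv x ** (x ** y) = y.
Proof. by rewrite hg_mulA hg_mulVx hg_mul0x. Qed.

Lemma hg_mulxV x : x ** inv x = 0.
Proof. by rewrite -[LHS](hg_mulK (inv x)) (hg_mulA G (inv x) x) hg_mulVx hg_mul0x hg_mulVx. Qed.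

Lemma hg_mulx0 x : x ** 0 = x.
Proof. by rewrite -(hg_mulVx G x) hg_mulA hg_mulxV hg_mul0x. Qed.

Lemma hg_mulVK x y : x ** (inv x ** y) = y.
Proof. by rewrite hg_mulA hg_mulxV hg_mul0x. Qed.

Lemma hg_mulKr x y : x ** y ** inv y = x.
Proof. by rewrite -hg_mulA hg_mulxV hg_mulx0. Qed.

Lemma hg_mulVKr x y : x ** inv y ** y = x.
Proof. by rewrite -hg_mulA hg_mulVx hg_mulx0. Qed.

Lemma hg_invK : involutive inv.
Proof. by move=> x; rewrite -[LHS]hg_mulx0 -(hg_mulVx G x) hg_mulK. Qed.

Lemma hg_invM x y : inv (x ** y) = inv y ** inv x.
Proof.
rewrite -[LHS]hg_mulx0 -(hg_mulxV x) -[X in _ ** (X ** _)](hg_mulKr x y).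
by rewrite -(hg_mulA G (x ** y)) hg_mulK.
Qed.

Lemma hg_image (a : V) (E : set V) : hg_mul G a @` E = hg_mul G (inv a) @^-1` E.
Proof.
apply/seteqP; split => [_ [x Ex <-] /=|x /= Ex]; first by rewrite hg_mulK.
by exists (inv a ** x) => //; rewrite hg_mulVK.
Qed.

Lemma continuous_hg_mul : continuous (fun z : V * V => hg_mul G z.1 z.2).
Proof. exact: (hg_mul_smooth G 0%N). Qed.

Lemma continuous_hg_inv : continuous inv.
Proof. exact: (hg_inv_smooth G 0%N). Qed.

Lemma continuous_hg_mull a : continuous (hg_mul G a).
Proof.
move=> x; apply: (@continuous_comp _ _ _ (fun y : V => (a, y))
  (fun z : V * V => hg_mul G z.1 z.2) x).
  exact: (@cvg_pair _ _ _ (nbhs x) (nbhs a) (nbhs x) _ _ _ (cst a) id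
    (@cvg_cst _ a _ (nbhs x) _) cvg_id).
exact: (@continuous_hg_mul (a, x)).
Qed.

Lemma continuous_hg_mulr a : continuous (fun x => hg_mul G x a).
Proof.
move=> x; apply: (@continuous_comp _ _ _ (fun y : V => (y, a))
  (fun z : V * V => hg_mul G z.1 z.2) x).
  exact: (@cvg_pair _ _ _ (nbhs x) (nbhs x) (nbhs a) _ _ _ id (cst a)
    cvg_id (@cvg_cst _ a _ (nbhs x) _)).
exact: (@continuous_hg_mul (x, a)).
Qed.

End group_laws.

(** Preimages are the form in which pushforwards use invariance; the image under [a] is the preimage
    under the inverse of [a], so letting [a] vary gives the same condition. *)
Definition left_invariant (R : realType) (n : nat) (G : homogeneous_group R n)
    (mu : set (borel_space R n) -> \bar R) :=
  forall a (E : set (borel_space R n)), measurable E ->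
    mu (hg_mul G a @^-1` E) = mu E.

Lemma haar_left_invariant (R : realType) (n : nat) (G : homogeneous_group R n)
    (mu : {measure set (borel_space R n) -> \bar R}) :
  haar_measure G mu -> left_invariant G mu.
Proof.
move=> [h _ _] a E mE; rewrite -[in RHS](h (hg_inv G a) _ mE) hg_image.
by rewrite hg_invK.
Qed.

Lemma compact_finite_sigma_finite (R : realType) (n : nat)
    (mu : {measure set (borel_space R n) -> \bar R}) :
  (forall K : set 'rV[R]_n.+1, compact K -> (mu K < +oo)%E) ->
  sigma_finite setT mu.
Proof.
move=> muK; exists (fun k => mx_box k%:R : set 'rV[R]_n.+1).
  apply/esym/seteqP; split => // x _; exists (Num.truncn (`|x|)).+1 => //= i.
  have : `|x| <= (Num.truncn `|x|).+1%:R.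
    by have /truncn_itv/andP[_ /ltW] : 0 <= `|x| by [].
  by move=> /(le_trans (coord_le_mx_norm x 0 i)); rewrite ler_norml in_itv.
move=> k; split; first by apply: borel_compact; exact: compact_mx_box.
by apply: muK; exact: compact_mx_box.
Qed.

Lemma mx_box_nbhs0 (R : realType) (n : nat) (M : R) (x : 'rV[R]_n) :
  `|x| < M -> mx_box M x.
Proof.
by move=> xM i; rewrite in_itv/= -ler_norml (le_trans (coord_le_mx_norm x 0 i))// ltW.
Qed.

Section haar.
Variables (R : realType) (n : nat) (G : homogeneous_group R n).
Local Notation V := 'rV[R]_n.+1.
Local Notation B := (borel_space R n).
Local Notation "x ** y" := (hg_mul G x y) (at level 40, left associativity).
Local Notation inv := (hg_inv G).

Lemma measurable_hg_mull a : measurable_fun setT (hg_mul G a : B -> B).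
Proof.
apply: borel_map_measurable.
exact: (borel_map_continuous (@borel_map_id R n) (@continuous_hg_mull _ _ G a)).
Qed.

Lemma measurable_hg_inv : measurable_fun setT (inv : B -> B).
Proof.
apply: borel_map_measurable.
exact: (borel_map_continuous (@borel_map_id R n) (@continuous_hg_inv _ _ G)).
Qed.

Lemma measurable_continuous2_borel (h : V * V -> V) : continuous h ->
  measurable_fun setT (fun z : B * B => h (z.1, z.2) : B).
Proof.
move=> ch; have [u du] := dense_sequence_rV R n.
apply: borel_map_measurable; apply: (borel_map_continuous2 du du _ _ ch).
  move=> U oU; rewrite -[X in measurable X]setTI.
  by apply: measurable_fst => //; exact: borel_open.
move=> U oU; rewrite -[X in measurable X]setTI.
by apply: measurable_snd => //; exact: borel_open.
Qed.

Lemma left_invariant_integral (mu : {measure set B -> \bar R}) a (F : B -> \bar R) :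
  left_invariant G mu -> measurable_fun setT F -> (forall x, (0 <= F x)%E) ->
  (\int[mu]_x F (a ** x) = \int[mu]_x F x)%E.
Proof.
move=> hmu mF F0.
have := ge0_integral_pushforward (measurable_hg_mull a) mu measurableT mF
  (fun y _ => F0 y).
rewrite preimage_setT => /esym; rewrite /comp => ->.
apply: eq_measure_integral; first exact: measurable_hg_mull.
by move=> ? A mA _; exact: hmu.
Qed.

End haar.

Section haar_uniqueness.
Variables (R : realType) (n : nat) (G : homogeneous_group R n).
Local Notation V := 'rV[R]_n.+1.
Local Notation B := (borel_space R n).
Local Notation "x ** y" := (hg_mul G x y) (at level 40, left associativity).
Local Notation inv := (hg_inv G).

(** The left translates of [U] by a dense sequence cover the group; if [U] were null, so would be
    the whole space. *)
Lemma haar_open_gt0 (mu : {measure set B -> \bar R}) (U : set V) :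
  left_invariant G mu -> mu setT <> 0%E -> open U -> U !=set0 -> (0 < mu U)%E.
Proof.
move=> hmu muT oU [g0 Ug0]; rewrite lt0e measure_ge0 andbT; apply/eqP => mU0.
have [u du] := dense_sequence_rV R n.
apply: muT; apply/eqP; rewrite eq_le measure_ge0 andbT.
have mUi i : measurable ((hg_mul G (inv (u i)) @^-1` U) : set B).
  apply: borel_open; apply: open_comp => // z _; exact: continuous_hg_mull.
apply: (@le_trans _ _ (mu (\bigcup_i (hg_mul G (inv (u i)) @^-1` U)))).
  apply: le_measure; rewrite ?inE//; first exact: bigcupT_measurable.
  move=> x _.
  (* The [y] whose translate of [U] contains [x] form an open set; it contains [x ** inv g0], hence
     a point of the dense sequence. *)
  have oW : open ((fun y => inv y ** x) @^-1` U).
    apply: open_comp => // z _.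
    apply: (@continuous_comp _ _ _ inv (fun y => y ** x)).
      exact: continuous_hg_inv.
    exact: continuous_hg_mulr.
  have : nbhs (x ** inv g0) ((fun y => inv y ** x) @^-1` U).
    apply: open_nbhs_nbhs; split => //=.
    by rewrite hg_invM hg_invK hg_mulVKr.
  move=> /nbhs_ballP[e /= e0 he]; have [i ui] := du (x ** inv g0) e e0.
  by exists i => //=; apply: (he (u i)); rewrite -ball_normE.
apply: (le_trans (measure_sigma_subadditive _ _ _ _)).
- by move=> i; exact: (mUi i).
- exact: bigcupT_measurable.
- by [].
- rewrite eseries0// => i _ _; rewrite /=.
  by rewrite -[RHS]mU0; apply: hmu; exact: borel_open.
Qed.

Variables (mu nu : {measure set B -> \bar R}).
Hypotheses (hmu : left_invariant G mu) (hnu : left_invariant G nu).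
Hypotheses (cmu : forall K : set V, compact K -> (mu K < +oo)%E).
Hypotheses (cnu : forall K : set V, compact K -> (nu K < +oo)%E).

Let sf_mu := compact_finite_sigma_finite cmu.
Let sf_nu := compact_finite_sigma_finite cnu.

Lemma measurable_indicE d (T : measurableType d) (A : set T) : measurable A ->
  measurable_fun setT (fun x => (\1_A x : R)%:E).
Proof. by move=> mA; apply/measurable_EFinP; exact: measurable_indic. Qed.

Lemma continuous_comp2_hg_mul (T : topologicalType) (f g : T -> V) :
  continuous f -> continuous g -> continuous (fun t => f t ** g t).
Proof.
move=> cf cg t; apply: (@continuous_comp _ _ _ (fun t => (f t, g t))
  (fun z : V * V => hg_mul G z.1 z.2) t).
  exact: (cvg_pair (cf t) (cg t)).
exact: continuous_hg_mul.
Qed.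

(* The measure-preserving shear [(x, y) |-> (y^-1 x, y)] followed by
   [(x, y) |-> (x, x y)] sends [a x 1_K(y)] to [a (y^-1) 1_K(x y)]. *)
Lemma haar_shear (K : set B) (a : B -> \bar R) : measurable K ->
  measurable_fun setT a -> (forall x, (0 <= a x)%E) ->
  ((\int[mu]_x a x) * nu K = \int[nu]_y (a (inv y) * mu [set x | K (x ** y)]))%E.
Proof.
move=> mK ma a0.
have c1 : continuous (fst : V * V -> V) by move=> z; exact: cvg_fst.
have c2 : continuous (snd : V * V -> V) by move=> z; exact: cvg_snd.
have mI : measurable_fun setT (fun x => (\1_K x : R)%:E) by exact: measurable_indicE.
have mcomp (h : V * V -> V) (F : B -> \bar R) : measurable_fun setT F -> continuous h ->
    measurable_fun setT (fun z : B * B => F (h z)).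
  move=> mF ch; apply: (measurableT_comp mF).
  have := measurable_continuous2_borel ch.
  by under eq_fun do rewrite -surjective_pairing.
have I0 (x : B) : (0 <= (\1_K x : R)%:E)%E by rewrite lee_fin.
have cinv (T : topologicalType) (f : T -> V) : continuous f -> continuous (fun t => inv (f t)).
  by move=> cf t; apply: continuous_comp; [exact: cf|exact: continuous_hg_inv].
pose f1 (z : B * B) : \bar R := ((\1_K z.2 : R)%:E * a (inv z.2 ** z.1))%E.
have mf1 : measurable_fun setT f1.
  apply: emeasurable_funM.
    exact: (@mcomp snd (fun x => (\1_K x : R)%:E)).
  apply: (@mcomp (fun z => inv z.2 ** z.1) a) => //.
  exact: (@continuous_comp2_hg_mul _ (fun z => inv z.2) fst (cinv _ _ c2) c1).
pose f2 (z : B * B) : \bar R := ((\1_K (z.1 ** z.2) : R)%:E * a (inv z.2))%E.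
have mf2 : measurable_fun setT f2.
  apply: emeasurable_funM.
    apply: (@mcomp (fun z => z.1 ** z.2) (fun x => (\1_K x : R)%:E)) => //.
    exact: (@continuous_comp2_hg_mul _ fst snd c1 c2).
  by apply: (@mcomp (fun z => inv z.2) a) => //; exact: cinv.
have f10 z : (0 <= f1 z)%E by rewrite mule_ge0.
have f20 z : (0 <= f2 z)%E by rewrite mule_ge0.
transitivity (\int[nu]_y \int[mu]_x f1 (x, y))%E.
  rewrite -[in LHS](setIT K) -(integral_indic nu measurableT mK).
  rewrite -ge0_integralZl//; last by apply: integral_ge0.
  apply: eq_integral => y _; rewrite /f1/= ge0_integralZl//; last first.
    by apply: (measurableT_comp ma); exact: measurable_hg_mull.
  by rewrite (left_invariant_integral _ hmu)// muleC.
rewrite -(tonelli_swap sf_mu sf_nu)//.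
transitivity (\int[mu]_x \int[nu]_y f2 (x, y))%E.
  apply: eq_integral => x _.
  rewrite -(@left_invariant_integral _ _ G nu x (fun y => f1 (x, y)))//.
    by apply: eq_integral => y _; rewrite /f1/f2/= hg_invM hg_mulVKr.
  exact: measurableT_comp mf1 (pair1_measurable _).
rewrite (tonelli_swap sf_mu sf_nu)//.
apply: eq_integral => y _; rewrite /f2/=.
have mr : measurable_fun setT (fun x : B => (x ** y : B)).
  apply: borel_map_measurable.
  exact: (borel_map_continuous (@borel_map_id R n) (@continuous_hg_mulr _ _ G y)).
have mKy : measurable ((fun x => x ** y) @^-1` K : set B).
  by rewrite -[X in measurable X]setTI; exact: mr.
rewrite ge0_integralZr//; last exact: (measurableT_comp mI).
rewrite muleC; congr (_ * _)%E.
have := integral_indic mu measurableT mKy; rewrite setIT => <-.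
exact: eq_integral.
Qed.

Lemma measurable_right_translates (K : set B) : measurable K ->
  measurable_fun setT (fun y : B => mu [set x | K (x ** y)]).
Proof.
move=> mK.
have mf : measurable_fun setT (fun z : B * B => (\1_K (z.1 ** z.2) : R)%:E).
  apply: (@measurableT_comp _ _ _ _ _ _ (fun x : B => (\1_K x : R)%:E)).
    exact: measurable_indicE.
  have := measurable_continuous2_borel (@continuous_hg_mul _ _ G).
  by under eq_fun do rewrite -surjective_pairing.
have := measurable_integral_fst sf_mu mf (fun z => _).
move=> /(_ ltac:(by move=> z; rewrite lee_fin)).
apply: eq_measurable_fun => y _.
have mKy : measurable ((fun x => x ** y) @^-1` K : set B).
  have mr : measurable_fun setT (fun x : B => (x ** y : B)).
    apply: borel_map_measurable.
    exact: (borel_map_continuous (@borel_map_id R n) (@continuous_hg_mulr _ _ G y)).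
  by rewrite -[X in measurable X]setTI; exact: mr.
have := integral_indic mu measurableT mKy; rewrite setIT => <-.
exact: eq_integral.
Qed.

End haar_uniqueness.

(** In [haar_shear] take for [a] the function [1_E / theta] composed with inversion, [theta y] being
    the [mu]-measure of [{x | x ** y in K}]: the right-hand side becomes [nu E]. With [mu] in place
    of [nu] it becomes [mu E], with the same integral of [a]; hence the ratio is [nu K / mu K]. *)
Lemma haar_proportional (R : realType) (n : nat) (G : homogeneous_group R n)
    (mu nu : {measure set (borel_space R n) -> \bar R}) :
  left_invariant G mu -> left_invariant G nu ->
  (forall K : set 'rV[R]_n.+1, compact K -> (mu K < +oo)%E) ->
  (forall K : set 'rV[R]_n.+1, compact K -> (nu K < +oo)%E) ->
  mu setT <> 0%E ->
  exists2 c : R, 0 <= c & forall E : set (borel_space R n), measurable E ->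
    nu E = (c%:E * mu E)%E.
Proof.
move=> hmu hnu cmu cnu muT.
pose K : set 'rV[R]_n.+1 := mx_box 1.
have cK : compact K by exact: compact_mx_box.
have mK : measurable (K : set (borel_space R n)) by exact: borel_compact.
have trans_compact y : compact ((fun x => hg_mul G x y) @^-1` K).
  rewrite (_ : _ @^-1` _ = (fun x => hg_mul G x (hg_inv G y)) @` K).
    apply: continuous_compact => //; apply: continuous_subspaceT.
    exact: continuous_hg_mulr.
  apply/seteqP; split => [x /= Kx|_ [x Kx <-] /=]; last by rewrite hg_mulVKr.
  by exists (hg_mul G x y) => //; rewrite hg_mulKr.
pose theta y := fine (mu [set x | K (hg_mul G x y)]).
have thetaE y : (theta y)%:E = mu [set x | K (hg_mul G x y)].
  by rewrite fineK// ge0_fin_numE//; exact: (cmu _ (trans_compact y)).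
(* The right translate of [K] contains a right translate of the open unit ball, so the division by
   [theta] is legitimate. *)
have theta0 y : 0 < theta y.
  rewrite -lte_fin thetaE.
  apply: (@lt_le_trans _ _ (mu ((fun x => hg_mul G x y) @^-1` ball 0 1))).
    apply: (haar_open_gt0 hmu) => //.
      by apply: open_comp => [x _|]; [exact: continuous_hg_mulr|exact: ball_open].
    by exists (hg_inv G y); rewrite /= hg_mulVx; exact: ballxx.
  apply: le_measure; rewrite ?inE.
  - apply: borel_open; apply: open_comp => [x _|]; last exact: ball_open.
    exact: continuous_hg_mulr.
  - exact: (borel_compact (trans_compact y)).
  - move=> x xb; have : ball (0 : 'rV[R]_n.+1) 1 (hg_mul G x y) by [].
    by rewrite -ball_normE /ball_/= sub0r normrN; exact: mx_box_nbhs0.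
have mtheta : measurable_fun setT (theta : borel_space R n -> R).
  apply: (measurableT_comp (@fine_measurable R setT measurableT)).
  exact: measurable_right_translates.
have muK0 : (0 < mu K)%E.
  rewrite (_ : (K : set _) = [set x | K (hg_mul G x 0)]).
    by rewrite -thetaE lte_fin.
  by apply/seteqP; split => x /=; rewrite hg_mulx0.
have muKfin : mu K \is a fin_num by rewrite ge0_fin_numE//; exact: cmu.
have nuKfin : nu K \is a fin_num by rewrite ge0_fin_numE//; exact: cnu.
exists (fine (nu K) / fine (mu K)).
  by rewrite divr_ge0// fine_ge0.
move=> E mE.
pose a (x : borel_space R n) : \bar R :=
  (\1_E (hg_inv G x) * theta (hg_inv G x) `^ (-1))%:E.
have ma : measurable_fun setT a.
  apply/measurable_EFinP; apply: measurable_funM.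
    have mE1 : measurable_fun setT (\1_E : borel_space R n -> R).
      exact: measurable_indic.
    exact: measurableT_comp mE1 (measurable_hg_inv G).
  have mt := measurableT_comp (measurable_powR (-1)) mtheta.
  exact: measurableT_comp mt (measurable_hg_inv G).
have a0 x : (0 <= a x)%E by rewrite lee_fin mulr_ge0// powR_ge0.
have aE (m : {measure set (borel_space R n) -> \bar R}) :
    (\int[m]_y (a (hg_inv G y) * mu [set x | K (hg_mul G x y)]) = m E)%E.
  rewrite -[in RHS](setIT E) -(integral_indic m measurableT mE).
  apply: eq_integral => y _; rewrite /a hg_invK -thetaE -EFinM -mulrA.
  by rewrite powR_inv1 ?ltW// mulVf ?mulr1// gt_eqF.
have := haar_shear hmu hnu cmu cnu mK ma a0; rewrite aE => <-.
have := haar_shear hmu hmu cmu cmu mK ma a0; rewrite aE => <-.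
rewrite -[X in (_ = _ * (_ * X))%E](fineK muKfin) -[X in (_ * X = _)%E](fineK nuKfin).
rewrite muleCA -EFinM divfK// gt_eqF// -lte_fin fineK//.
Qed.

(** * Haar measure scales by the homogeneous dimension *)

Section finite_covers.
Context d (T : measurableType d) (R : realType) (mu : {measure set T -> \bar R}).
Variables (I : finType) (A : set T) (C : I -> set T).
Hypotheses (mA : measurable A) (mC : forall i, measurable (C i)).

Let fsum : (\sum_(i \in [set: I]) mu (C i) = \sum_i mu (C i))%E.
Proof.
have -> : [set: I] = [set` index_enum I].
  by apply/seteqP; split => // i _ /=; rewrite mem_index_enum.
by rewrite -fsbig_seq ?index_enum_uniq.
Qed.

Lemma measure_le_cover_sum : (forall x, A x -> exists i, C i x) ->
  (mu A <= \sum_i mu (C i))%E.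
Proof.
move=> cov; rewrite -fsum; apply: content_sub_fsum => //; first exact: finite_finset.
by move=> x /cov[i Cx]; exists i.
Qed.

Lemma disjoint_sum_le_measure : (forall i, C i `<=` A) ->
  (forall i j x, C i x -> C j x -> i = j) -> (\sum_i mu (C i) <= mu A)%E.
Proof.
move=> sub disj; rewrite -fsum -measure_fin_bigcup//; last 2 first.
  exact: finite_finset.
  by move=> i j _ _ [x [Cix Cjx]]; exact: disj Cix Cjx.
apply: le_measure; rewrite ?inE//; last by move=> x [i _ /sub].
by apply: fin_bigcup_measurable => //; exact: finite_finset.
Qed.
End finite_covers.

(** If [x / y = 1 + h] with [h > 0], its powers are at least [k * h] and exceed every [K]. This is
    what removes the constant from comparisons that hold for all powers. *)
Lemma ler_of_expr_le (R : realType) (x y K : R) : 0 < x -> 0 < y ->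
  (forall k : nat, x ^+ k <= K * y ^+ k) -> x <= y.
Proof.
move=> x0 y0 xyK; rewrite leNgt; apply/negP => yx.
pose h := x / y - 1.
have h0 : 0 < h by rewrite subr_gt0 ltr_pdivlMr// mul1r.
have xyE : x / y = 1 + h by rewrite /h addrC subrK.
have bern k : k%:R * h <= (x / y) ^+ k.
  rewrite xyE; elim: k => [|k IH]; first by rewrite mul0r expr0 ler01.
  have q1 : 1 <= (1 + h) ^+ k by rewrite exprn_ege1// lerDl ltW.
  rewrite exprS -natr1 mulrDl mul1r; set q := (1 + h) ^+ k in IH q1 *.
  by rewrite mulrDl mul1r lerD// ler_peMr// ltW.
have bK k : (x / y) ^+ k <= K.
  by rewrite expr_div_n ler_pdivrMr ?exprn_gt0.
have := le_trans (bern (Num.truncn (K / h)).+1) (bK _).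
rewrite -ler_pdivlMr// leNgt => /negP; apply.
have K0 : 0 <= K by have := bK 0%N; rewrite expr0; apply: le_trans.
by have /truncn_itv/andP[] : 0 <= K / h by rewrite divr_ge0// ltW.
Qed.

Section grid.
Variables (R : realType) (D : nat) (T : Type) (z : T -> 'I_D -> R).

(** A box in the coordinates [z] with corner [g] and side lengths [b]; it is half-open so that equal
    cells tile without overlap. *)
Definition grid_cell (g : 'I_D -> R) (b : 'I_D -> R) : set T :=
  [set x | forall i, g i <= z x i < g i + b i].

Lemma grid_cell_cover (N : 'I_D -> nat) (b : 'I_D -> R) (del : R) : 0 < del ->
  (forall i, b i <= (N i)%:R * del) ->
  forall x, grid_cell (fun=> 0) b x ->
    exists k : {dffun forall i : 'I_D, 'I_(N i)},
      grid_cell (fun i => (k i)%:R * del) (fun=> del) x.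
Proof.
move=> d0 bN x bx.
have h i : (Num.truncn (z x i / del) < N i)%N.
  have /andP[z0 zb] := bx i; rewrite add0r in zb.
  have /truncn_itv/andP[l _] : 0 <= z x i / del by rewrite divr_ge0// ltW.
  rewrite -(ltr_nat R); apply: le_lt_trans l _.
  by rewrite ltr_pdivrMr//; exact: lt_le_trans zb _.
exists (finfun (fun i => Ordinal (h i))) => i; rewrite ffunE/=.
have /andP[z0 zb] := bx i.
have /truncn_itv/andP[l u] : 0 <= z x i / del by rewrite divr_ge0// ltW.
rewrite -ler_pdivlMr// l/= -[X in _ + X]mul1r -mulrDl -ltr_pdivrMr//.
by rewrite -natr1 in u.
Qed.

Lemma grid_cell_sub (N : 'I_D -> nat) (b : 'I_D -> R) (del : R) : 0 < del ->
  (forall i, (N i)%:R * del <= b i) ->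
  forall k : {dffun forall i : 'I_D, 'I_(N i)},
    grid_cell (fun i => (k i)%:R * del) (fun=> del) `<=` grid_cell (fun=> 0) b.
Proof.
move=> d0 Nb k x kx i; have /andP[l u] := kx i.
rewrite add0r (le_trans _ l)/=; last by rewrite mulr_ge0// ltW.
apply: (lt_le_trans u); apply: le_trans (Nb i).
by rewrite -[X in _ + X]mul1r -mulrDl ler_pM2r// natr1 ler_nat.
Qed.

Lemma grid_cell_disjoint (N : 'I_D -> nat) (del : R) : 0 < del ->
  forall (k l : {dffun forall i : 'I_D, 'I_(N i)}) x,
    grid_cell (fun i => (k i)%:R * del) (fun=> del) x ->
    grid_cell (fun i => (l i)%:R * del) (fun=> del) x -> k = l.
Proof.
move=> d0 k l x kx lx; apply/ffunP => i; apply/val_inj => /=.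
have lt (a b : nat) : a%:R * del <= z x i -> z x i < b%:R * del + del -> (a <= b)%N.
  move=> h1 h2; rewrite -ltnS -(ltr_nat R) -natr1 -(ltr_pM2r d0) mulrDl mul1r.
  exact: le_lt_trans h2.
have /andP[k1 k2] := kx i; have /andP[l1 l2] := lx i.
by apply/eqP; rewrite eqn_leq (lt _ _ k1 l2) (lt _ _ l1 k2).
Qed.

Lemma card_grid (N : 'I_D -> nat) :
  #|{dffun forall i : 'I_D, 'I_(N i)}| = (\prod_i N i)%N.
Proof.
rewrite card_dep_ffun -[RHS]big_enum/= foldrE big_map.
by apply: eq_big_seq => i _; rewrite card_ord.
Qed.

End grid.

Lemma powRVl (R : realType) (s r : R) : 0 < s -> s^-1 `^ r = (s `^ r)^-1.
Proof. by move=> s0; rewrite -(powR_inv1 (ltW s0)) -powRrM mulN1r powRN. Qed.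

Lemma mulmx_bounded (R : realType) (m n : nat) (A : 'M[R]_(m, n)) :
  exists2 c : R, 0 < c & forall y : 'rV[R]_m, `|y *m A| <= c * `|y|.
Proof.
have S0 : 0 <= \sum_(kj : 'I_m * 'I_n) `|A kj.1 kj.2| by rewrite sumr_ge0.
exists (1 + \sum_(kj : 'I_m * 'I_n) `|A kj.1 kj.2|); first by rewrite ltr_pwDl.
move=> y; apply: mx_norm_le_coord => [|i j]; first by rewrite mulr_ge0// addr_ge0.
rewrite ord1 mxE (le_trans (ler_norm_sum _ _ _))// mulrDl mul1r ler_wpDl//.
rewrite mulr_suml; pose F (kj : 'I_m * 'I_n) := `|A kj.1 kj.2| * `|y|.
apply: (@le_trans _ _ (\sum_k F (k, j))).
  by apply: ler_sum => k _; rewrite normrM mulrC ler_wpM2l// coord_le_mx_norm.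
rewrite -/(\sum_kj F kj) -(pair_bigA _ (fun k j => F (k, j)))/=.
by apply: ler_sum => k _; rewrite (bigD1 j)//= lerDl sumr_ge0// => l _; exact: mulr_ge0.
Qed.

(** * The modulus of the dilations, by counting cells *)

Section dilation_scaling.
Variables (R : realType) (n : nat) (G : homogeneous_group R n).
Local Notation V := 'rV[R]_n.+1.
Local Notation B := (borel_space R n).
Local Notation "x ** y" := (hg_mul G x y) (at level 40, left associativity).
Local Notation inv := (hg_inv G).
Variable mu : {measure set B -> \bar R}.
Hypothesis hmu : left_invariant G mu.
Hypothesis cmu : forall K : set V, compact K -> (mu K < +oo)%E.
Hypothesis muT : mu setT <> 0%E.
Variable P : 'M[R]_n.+1.
Hypothesis Pu : P \in unitmx.

(** Coordinates with respect to the rows of [P], which become eigencoordinates of the dilations once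
    [dE] is assumed; [p] below is the inverse map. *)
Let z (x : V) (i : 'I_n.+1) : R := (x *m invmx P) 0 i.
Let cell := @grid_cell R n.+1 V z.

Let cz i : continuous (fun x => z x i).
Proof.
rewrite /z; under eq_fun do rewrite mxE.
move=> x; apply: (@cvg_big _ _ _ _ _ add_continuous _ (nbhs x)) => l _.
by apply: cvgMr_tmp; exact: coord_continuous.
Qed.

Lemma measurable_grid_cell g b : measurable (cell g b : set B).
Proof.
rewrite /cell (_ : grid_cell _ _ _ =
    \bigcap_(i in [set: 'I_n.+1]) ((fun x : B => z x i) @^-1` `[g i, g i + b i[)).
  apply: fin_bigcap_measurable => [|i _]; first exact: finite_finset.
  rewrite -[X in measurable X]setTI.
  exact: (@borel_continuous_measurable R n _ (@cz i) measurableT _ (measurable_itv _)).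
apply/seteqP; split => [x xc i _ /=|x xc i]; first by rewrite in_itv/=; exact: xc.
by have := xc i Logic.I; rewrite /= in_itv.
Qed.

Let p (g : 'I_n.+1 -> R) : V := (\row_i g i) *m P.

Let zp g i : z (p g) i = g i.
Proof. by rewrite /z /p mulmxK// mxE. Qed.

Let pz x : p (z x) = x.
Proof.
rewrite /p (_ : \row_i _ = x *m invmx P) ?mulmxKV//.
by apply/rowP => i; rewrite mxE.
Qed.

(** Left translation by [t] carries the corner of the small cell to the centre of the large one and
    distorts distances by a bounded factor, so the image of the small cell fits into the large one.
    The bounds on [g], [g'] and [C * del] keep all points in one fixed box, where a single Lipschitz
    constant serves. *)
Lemma grid_cell_translate : exists2 C : nat, (0 < C)%N &
  forall (g g' : 'I_n.+1 -> R) (del : R),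
    (forall i, 0 <= g i <= 2) -> (forall i, 0 <= g' i <= 2) ->
    0 < del -> C%:R * del <= 1 ->
    (mu (cell g (fun=> del)) <= mu (cell g' (fun=> (C%:R * del)%R)))%E.
Proof.
have [c1 c10 hc1] := mulmx_bounded P; have [c2 c20 hc2] := mulmx_bounded (invmx P).
pose M1 := 3 * c1.
have pM g : (forall i, 0 <= g i <= 3) -> mx_box M1 (p g).
  move=> g3 i; rewrite in_itv/= -ler_norml.
  apply: (le_trans (coord_le_mx_norm _ _ _)); apply: (le_trans (hc1 _)).
  rewrite /M1 mulrC ler_pM2r//; apply: mx_norm_le_coord => [|i' j]; first exact: ler0n.
  by rewrite mxE; have /andP[? ?] := g3 j; rewrite ger0_norm.
have cF : continuous (fun w : V * V => `|w.1 ** inv w.2|).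
  move=> w; apply: (@continuous_comp _ _ _ (fun w : V * V => w.1 ** inv w.2) Num.norm).
    apply: continuous_comp2_hg_mul; first by move=> ?; exact: cvg_fst.
    by move=> u; apply: continuous_comp; [exact: cvg_snd|exact: continuous_hg_inv].
  exact: norm_continuous.
have [M2 M20 hM2] := compact_bound (compact_setX (@compact_mx_box R n.+1 M1) (@compact_mx_box R n.+1 M1)) cF.
have mono M N : M <= N -> mx_box M `<=` (mx_box N : set V).
  by move=> MN x xM i; have := xM i; rewrite !in_itv/= => /andP[? ?]; apply/andP; split; lra.
have [C0 C00 hC0] := Ck1_lipschitz_snd (M1 + M2) (hg_mul_smooth G 1%N).
(* Distances grow by [c1] from coordinates to points, by [C0] under the translation and by [c2] back
   to coordinates; the factor 2 is there because the centre is only half a side, [C * del / 2], away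
   from the faces. *)
pose C := (Num.truncn (2 * (c2 * (C0 * c1)))).+1.
exists C => // g g' del g2 g'2 d0 Cd.
have kappa0 : 0 < c2 * (C0 * c1) by rewrite !mulr_gt0.
have hC : 2 * (c2 * (C0 * c1)) < C%:R.
  by have /truncn_itv/andP[] : 0 <= 2 * (c2 * (C0 * c1)) by rewrite mulr_ge0// ltW.
have C1 : 1 <= C%:R :> R by rewrite ler1n.
have d1 : del <= 1 by apply: le_trans Cd; rewrite ler_peMl// ltW.
pose c' i := g' i + C%:R * del / 2.
have aM : mx_box M1 (p g).
  by apply: pM => i; have /andP[? ?] := g2 i; apply/andP; split; lra.
have c'M : mx_box M1 (p c').
  apply: pM => i; have /andP[? ?] := g'2 i; rewrite /c'.
  have : 0 < C%:R * del by rewrite mulr_gt0// ltr0n.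
  by move=> ?; apply/andP; split; lra.
pose t := p c' ** inv (p g).
have tM : mx_box M2 t.
  move=> i; rewrite in_itv/= -ler_norml (le_trans (coord_le_mx_norm _ _ _))//.
  by have := hM2 (p c', p g) (conj c'M aM); rewrite normr_id.
rewrite -(hmu t (measurable_grid_cell g' (fun=> C%:R * del))).
have mt : measurable (hg_mul G t @^-1` cell g' (fun=> C%:R * del) : set B).
  rewrite -[X in measurable X]setTI.
  by apply: (measurable_hg_mull G t) => //; exact: measurable_grid_cell.
apply: le_measure; rewrite ?inE//; first exact: measurable_grid_cell.
move=> x xc i /=.
have xM : mx_box M1 x.
  rewrite -[x]pz; apply: pM => j; have /andP[? ?] := xc j; have /andP[? ?] := g2 j.
  by apply/andP; split; lra.
have xa : `|x - p g| <= c1 * del.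
  rewrite -[x]pz /p -mulmxBl; apply: (le_trans (hc1 _)); rewrite ler_pM2l//.
  apply: mx_norm_le_coord => [|i' j]; first exact: ltW.
  by rewrite ord1 !mxE; have /andP[? ?] := xc j; rewrite ger0_norm; lra.
have txa : `|t ** x - p c'| <= C0 * (c1 * del).
  have -> : p c' = t ** p g by rewrite /t hg_mulVKr.
  apply: le_trans (hC0 t x (p g) _ _ _) _.
  - by apply: mono tM; rewrite lerDr /M1 mulr_ge0// ltW.
  - by apply: mono xM; rewrite lerDl ltW.
  - by apply: mono aM; rewrite lerDl ltW.
  - by rewrite ler_pM2l.
have : `|z (t ** x) i - c' i| <= c2 * (C0 * (c1 * del)).
  rewrite -(zp c' i) /z; set u := t ** x; set v := p c'.
  have -> : (u *m invmx P) 0 i - (v *m invmx P) 0 i = ((u - v) *m invmx P) 0 i.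
    by rewrite mulmxBl !mxE.
  apply: (le_trans (coord_le_mx_norm _ _ _)); apply: (le_trans (hc2 _)).
  by rewrite ler_pM2l.
have : c2 * (C0 * (c1 * del)) < C%:R * del / 2.
  have -> : c2 * (C0 * (c1 * del)) = (2 * (c2 * (C0 * c1))) * del / 2 by field.
  by rewrite ltr_pM2r// ltr_pM2r.
rewrite /c' ler_norml => h1 /andP[h2 h3].
by apply/andP; split; lra.
Qed.

Lemma grid_cell_fin_num g b : mu (cell g b) \is a fin_num.
Proof.
have [c1 c10 hc1] := mulmx_bounded P.
rewrite ge0_fin_numE//.
pose M := c1 * (`|\row_i g i| + `|\row_i b i|).
apply: le_lt_trans (cmu (@compact_mx_box R n.+1 M)).
apply: le_measure; rewrite ?inE; first exact: measurable_grid_cell.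
  by apply: borel_compact; exact: compact_mx_box.
move=> x xc i; rewrite in_itv/= -ler_norml -[x]pz.
apply: (le_trans (coord_le_mx_norm _ _ _)); apply: (le_trans (hc1 _)).
rewrite /M ler_pM2l//; apply: mx_norm_le_coord => [|i' j]; first exact: addr_ge0.
rewrite ord1 mxE; have /andP[l u] := xc j.
have := coord_le_mx_norm (\row_i g i) 0 j; have := coord_le_mx_norm (\row_i b i) 0 j.
by rewrite !mxE !ler_norml => /andP[? ?] /andP[? ?]; apply/andP; split; lra.
Qed.

Let m (g b : 'I_n.+1 -> R) : R := fine (mu (cell g b)).

Let mE g b : mu (cell g b) = (m g b)%:E.
Proof. by rewrite fineK// grid_cell_fin_num. Qed.

Let m_ge0 g b : 0 <= m g b.
Proof. by rewrite -lee_fin -mE. Qed.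

(** The box [b] is covered by [\prod_i N i] cells of side [del], and [b'] contains [\prod_i N' i]
    disjoint cells of side [C * del]. Any cell of the first kind weighs at most as much as any of
    the second; this is summed over all pairs. *)
Lemma grid_count_compare (C : nat) (N N' : 'I_n.+1 -> nat) (b b' : 'I_n.+1 -> R) (del : R) :
  (forall (g g' : 'I_n.+1 -> R),
    (forall i, 0 <= g i <= 2) -> (forall i, 0 <= g' i <= 2) ->
    (mu (cell g (fun=> del)) <= mu (cell g' (fun=> (C%:R * del)%R)))%E) ->
  (0 < C)%N -> 0 < del -> (forall i, b i <= (N i)%:R * del <= 2) ->
  (forall i, (N' i)%:R * (C%:R * del) <= b' i <= 1) ->
  \prod_i (N' i)%:R * m (fun=> 0) b <= \prod_i (N i)%:R * m (fun=> 0) b'.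
Proof.
move=> tr C0 d0 bN Nb.
have Cd0 : 0 < C%:R * del by rewrite mulr_gt0// ltr0n.
pose I := {dffun forall i : 'I_n.+1, 'I_(N i)}.
pose I' := {dffun forall i : 'I_n.+1, 'I_(N' i)}.
pose u (k : I) := m (fun i => (k i)%:R * del) (fun=> del).
pose u' (k : I') := m (fun i => (k i)%:R * (C%:R * del)) (fun=> C%:R * del).
have up : m (fun=> 0) b <= \sum_k u k.
  rewrite -lee_fin -mE -sumEFin; under eq_bigr do rewrite -mE.
  apply: measure_le_cover_sum => [|i|]; try exact: measurable_grid_cell.
  by apply: grid_cell_cover => // i; have /andP[] := bN i.
have low : \sum_k u' k <= m (fun=> 0) b'.
  rewrite -lee_fin -mE -sumEFin; under eq_bigr do rewrite -mE.
  apply: disjoint_sum_le_measure => [|i| |]; try exact: measurable_grid_cell.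
    by apply: grid_cell_sub => // i; have /andP[] := Nb i.
  exact: grid_cell_disjoint.
have uu' k k' : u k <= u' k'.
  rewrite -lee_fin -!mE; apply: tr => i.
    rewrite mulr_ge0 ?(ltW d0)//=; have /andP[_] := bN i; apply: le_trans.
    by rewrite ler_pM2r// ler_nat ltnW.
  rewrite mulr_ge0 ?(ltW Cd0)//=; have /andP[h1 h2] := Nb i.
  apply: (@le_trans _ _ 1); last by rewrite ler1n.
  by apply: le_trans h2; apply: le_trans h1; rewrite ler_pM2r// ler_nat ltnW.
have <- : (#|I|)%:R = \prod_i (N i)%:R :> R by rewrite card_grid natr_prod.
have <- : (#|I'|)%:R = \prod_i (N' i)%:R :> R by rewrite card_grid natr_prod.
apply: (@le_trans _ _ (\sum_(k' : I') \sum_k u k)).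
  by rewrite sumr_const mulr_natl lerMn2r up orbT.
apply: (@le_trans _ _ (\sum_(k' : I') \sum_(k : I) u' k')).
  by apply: ler_sum => k' _; apply: ler_sum => k _; exact: uu'.
under eq_bigr do rewrite sumr_const.
by rewrite sumrMnl mulr_natl lerMn2r low orbT.
Qed.

(** The ratio of [mu] to coordinate volume is thus the same for all boxes at the origin up to the
    factor [K], however thin they are. In [(4 * C)^(n + 1)] each coordinate contributes 2 for
    rounding [N] up, 2 for rounding [N'] down and [C] for the larger side. *)
Lemma grid_box_compare : exists2 K : R, 0 < K & forall b b' : 'I_n.+1 -> R,
  (forall i, 0 < b i <= 1) -> (forall i, 0 < b' i <= 1) ->
  \prod_i b' i * m (fun=> 0) b <= K * \prod_i b i * m (fun=> 0) b'.
Proof.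
have [C C0 tr] := grid_cell_translate.
have CR0 : 0 < C%:R :> R by rewrite ltr0n.
exists ((4 * C%:R) ^+ n.+1); first by rewrite exprn_gt0// mulr_gt0.
move=> b b' b1 b'1.
pose f i := Num.min (b i) (b' i / C%:R).
have f0 i : 0 < f i.
  have /andP[? _] := b1 i; have /andP[? _] := b'1 i.
  by rewrite /f lt_min divr_gt0 ?andbT.
pose S := \sum_i (f i)^-1.
have S0 : 0 <= S by rewrite sumr_ge0// => i _; rewrite invr_ge0 ltW.
(* An explicit positive number below all [f i], hence below every [b i] and every [b' i / C]. *)
pose del := (1 + S)^-1.
have d0 : 0 < del by rewrite invr_gt0 ltr_pwDl.
have df i : del <= f i.
  rewrite /del invf_ple ?posrE//; last by rewrite ltr_pwDl.
  rewrite ler_wpDl// /S (bigD1 i)//= lerDl sumr_ge0// => j _.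
  by rewrite invr_ge0 ltW.
have db i : del <= b i by have := df i; rewrite le_min => /andP[].
have db' i : C%:R * del <= b' i.
  by have := df i; rewrite le_min => /andP[_]; rewrite ler_pdivlMr// mulrC.
have Cd0 : 0 < C%:R * del by rewrite mulr_gt0.
pose N i := (Num.truncn (b i / del)).+1.
pose N' i := Num.truncn (b' i / (C%:R * del)).
have NP i : b i <= (N i)%:R * del <= 2 * b i.
  have /andP[b0 _] := b1 i.
  have /truncn_itv/andP[l u] : 0 <= b i / del by rewrite divr_ge0// ltW.
  rewrite -ler_pdivrMr// (ltW u)/= /N -natr1 mulrDl mul1r.
  by move: l; rewrite ler_pdivlMr// => l; have := db i; lra.
have N'P i : (N' i)%:R * (C%:R * del) <= b' i <= 2 * ((N' i)%:R * (C%:R * del)).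
  have /andP[b0 _] := b'1 i.
  have /truncn_itv/andP[l u] : 0 <= b' i / (C%:R * del) by rewrite divr_ge0// ltW.
  rewrite -ler_pdivlMr// l/=.
  have N'1 : 1 <= (N' i)%:R :> R.
    rewrite ler1n /N' -ltnS -(ltr_nat R); apply: le_lt_trans u.
    by rewrite ler_pdivlMr// mul1r.
  move: u; rewrite ltr_pdivrMr// -natr1 mulrDl mul1r -/(N' i) => u.
  by have : C%:R * del <= (N' i)%:R * (C%:R * del) by [rewrite ler_peMl// ltW]; lra.
have main : \prod_i (N' i)%:R * m (fun=> 0) b <= \prod_i (N i)%:R * m (fun=> 0) b'.
  apply: (@grid_count_compare C N N' b b' del) => //.
  - move=> g g' hg hg'; apply: tr => //.
    by apply: le_trans (db' ord0) _; have /andP[] := b'1 ord0.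
  - by move=> i; have /andP[-> h]/= := NP i; have /andP[_ ?] := b1 i; lra.
  - by move=> i; have /andP[-> _]/= := N'P i; have /andP[] := b'1 i.
have P'le : \prod_i b' i <= (2 * C%:R * del) ^+ n.+1 * \prod_i (N' i)%:R.
  rewrite -[X in _ ^+ X](card_ord n.+1) -prodr_const -big_split/=.
  apply: ler_prod => i _; have /andP[h0 _] := b'1 i; rewrite (ltW h0)/=.
  by have /andP[_] := N'P i; rewrite -!mulrA [(N' i)%:R * _]mulrC -!mulrA.
have Ple : del ^+ n.+1 * \prod_i (N i)%:R <= 2 ^+ n.+1 * \prod_i b i.
  rewrite -[X in _ ^+ X * _ <= _](card_ord n.+1) -[X in _ <= _ ^+ X * _](card_ord n.+1).
  rewrite -!prodr_const -!big_split/=.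
  apply: ler_prod => i _; rewrite mulr_ge0 ?(ltW d0)//=.
  by have /andP[_] := NP i; rewrite mulrC.
apply: (le_trans (ler_wpM2r (m_ge0 _ _) P'le)); rewrite -[leLHS]mulrA.
apply: (le_trans (ler_wpM2l _ main)); first by rewrite exprn_ge0// !mulr_ge0// ltW.
rewrite mulrA ler_wpM2r// ?m_ge0//.
have -> : 2 * C%:R * del = del * (2 * C%:R) by rewrite mulrC.
rewrite exprMn mulrAC.
apply: (le_trans (ler_wpM2r _ Ple)); first by rewrite exprn_ge0// mulr_ge0// ltW.
rewrite mulrAC -exprMn mulrA.
by have -> : 2 * 2 = 4 :> R by ring.
Qed.

(** The cell contains a small ball about its centre, and nonempty open sets have positive
    measure. *)
Lemma grid_cell_unit_gt0 : 0 < m (fun=> 0) (fun=> 1).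
Proof.
have [c2 c20 hc2] := mulmx_bounded (invmx P).
rewrite -lte_fin -mE.
pose a := p (fun=> 2^-1).
have r0 : 0 < (4 * c2)^-1 by rewrite invr_gt0 mulr_gt0.
apply: (@lt_le_trans _ _ (mu (ball a (4 * c2)^-1))).
  apply: (haar_open_gt0 hmu muT); first exact: ball_open.
  by exists a; exact: ballxx.
apply: le_measure; rewrite ?inE.
- by apply: borel_open; exact: ball_open.
- exact: measurable_grid_cell.
move=> x; rewrite -ball_normE/= => ax i; rewrite add0r.
have : `|z a i - z x i| < 2^-1.
  have -> : z a i - z x i = ((a - x) *m invmx P) 0 i by rewrite /z mulmxBl !mxE.
  apply: le_lt_trans (coord_le_mx_norm _ _ _) _; apply: le_lt_trans (hc2 _) _.
  rewrite -ltr_pdivlMl//; apply: lt_trans ax _.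
  by rewrite -invfM ltf_pV2 ?posrE ?mulr_gt0// mulrC ltr_pM2r// ltr_nat.
by rewrite zp ltr_norml => /andP[? ?]; apply/andP; split; lra.
Qed.

Variable d : 'rV[R]_n.+1.
Hypothesis d0 : forall i, 0 < d 0 i.
Hypothesis trE : hom_dim G = \sum_i d 0 i.
Hypothesis dE : forall t (x : V), x *m expmx (t *: hg_A0 G) =
  x *m invmx P *m diag_mx (\row_i expR (t * d 0 i)) *m P.

Let z_dil s x i : 0 < s -> z (dil G s x) i = s `^ d 0 i * z x i.
Proof.
move=> s0; rewrite /z /dil /dilation dE mulmxK// mul_mx_diag !mxE.
by rewrite mulrC /powR gt_eqF// (mulrC (ln s)).
Qed.

Let dil_preimage_cell s b : 0 < s ->
  dil G s^-1 @^-1` cell (fun=> 0) b = cell (fun=> 0) (fun i => s `^ d 0 i * b i).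
Proof.
move=> s0; have sd0 i : 0 < s `^ d 0 i by rewrite powR_gt0.
apply/seteqP; split => x h i; have := h i; rewrite !add0r.
  rewrite z_dil ?invr_gt0// powRVl//.
  by rewrite pmulr_rge0 ?invr_gt0// ltr_pdivrMl.
rewrite z_dil ?invr_gt0// powRVl//.
by rewrite pmulr_rge0 ?invr_gt0// ltr_pdivrMl.
Qed.

(* Boxes are compared only up to the factor [K]; iterating the dilation turns
   this into [s^(Q k) <= K c^k] and [c^k <= K s^(Q k)] for all [k]. *)
Lemma dil_modulus_lt1 s c : 0 < s < 1 ->
  (forall E : set B, measurable E -> mu (dil G s^-1 @^-1` E) = (c%:E * mu E)%E) ->
  c = s `^ hom_dim G.
Proof.
move=> /andP[s0 s1] hc; have [K K0 hK] := grid_box_compare.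
pose lam (k : nat) i := (s `^ d 0 i) ^+ k.
(* This is where [s < 1] enters: all iterated boxes stay inside the unit box, as [grid_box_compare]
   requires. *)
have lam1 k i : 0 < lam k i <= 1.
  rewrite /lam exprn_gt0 ?powR_gt0//= exprn_ile1 ?powR_ge0//.
  have <- : 1 `^ d 0 i = 1 by rewrite powR1.
  by rewrite ge0_ler_powR ?nnegrE ?ltW.
have mlam k : m (fun=> 0) (lam k) = c ^+ k * m (fun=> 0) (fun=> 1).
  elim: k => [|k IH]; first by rewrite expr0 mul1r.
  have -> : lam k.+1 = fun i => s `^ d 0 i * lam k i by apply/funext => i; rewrite /lam exprS.
  apply: EFin_inj; rewrite -mE -dil_preimage_cell// hc; last exact: measurable_grid_cell.
  by rewrite mE IH -EFinM exprS mulrA.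
have prodlam k : \prod_i lam k i = (s `^ hom_dim G) ^+ k.
  rewrite /lam prodrXl trE; congr (_ ^+ _).
  apply/esym; apply: (big_morph (powR s)) => [x y|]; last exact: powRr0.
  by rewrite powRD// (gt_eqF s0) implybT.
have u0 := grid_cell_unit_gt0.
have one1 (i : 'I_n.+1) : 0 < (1 : R) <= 1 by rewrite ltr01 lexx.
have le1 k : (s `^ hom_dim G) ^+ k <= K * c ^+ k.
  have := hK (fun=> 1) (lam k) one1 (lam1 k).
  by rewrite mlam prodlam big1// mulr1 mulrA ler_pM2r.
have le2 k : c ^+ k <= K * (s `^ hom_dim G) ^+ k.
  have := hK (lam k) (fun=> 1) (lam1 k) one1.
  by rewrite mlam prodlam big1// mul1r ler_pM2r.
have sQ0 : 0 < s `^ hom_dim G by rewrite powR_gt0.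
have c0 : 0 < c.
  have := le1 1%N; rewrite !expr1 => /(lt_le_trans sQ0).
  by rewrite pmulr_rgt0.
apply/eqP; rewrite eq_le; apply/andP; split; exact: ler_of_expr_le.
Qed.

End dilation_scaling.

Section haar_dilation.
Variables (R : realType) (n : nat) (G : homogeneous_group R n).
Local Notation V := 'rV[R]_n.+1.
Local Notation B := (borel_space R n).
Variable mu : {measure set B -> \bar R}.
Hypothesis hmu : haar_measure G mu.

Lemma measurable_dil s : measurable_fun setT (dil G s : B -> B).
Proof.
apply: borel_map_measurable.
exact: (borel_map_continuous (@borel_map_id R n) (@continuous_dil _ _ G s)).
Qed.

(** Since [D_s] is an automorphism, pushing [mu] forward gives another left-invariant measure that
    is finite on compact sets, so it is a multiple of [mu]; the factor is known for [s < 1] by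
    counting cells. *)
Lemma haar_dil (s : R) (E : set B) : 0 < s -> measurable E ->
  mu (dil G s^-1 @^-1` E) = ((s `^ hom_dim G)%:E * mu E)%E.
Proof.
have linv := haar_left_invariant hmu; have [_ cmu muT] := hmu.
have [P [d [Pu d0 trE dE]]] := dil_coordE G.
have modulus (r : R) : 0 < r -> exists2 c : R, 0 <= c & forall F : set B, measurable F ->
    mu (dil G r^-1 @^-1` F) = (c%:E * mu F)%E.
  move=> r0.
  have mdil := @measurable_dil r^-1.
  have := @haar_proportional R n G mu (pushforward mu (dil G r^-1 : B -> B)).
  apply => //.
  - move=> a F mF.
    have mF' : measurable (dil G r^-1 @^-1` F : set B).
      by rewrite -[X in measurable X]setTI; exact: mdil.
    transitivity (mu (hg_mul G (dil G r a) @^-1` (dil G r^-1 @^-1` F))); last exact: linv.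
    congr (mu _); apply/funext => x; rewrite /preimage/=.
    have -> : dil G r^-1 (hg_mul G (dil G r a) x) = hg_mul G a (dil G r^-1 x).
      by rewrite -[in RHS](dilK G r0 a); apply: hg_dil_mul; rewrite invr_gt0.
    by [].
  - move=> K cK; rewrite /pushforward; apply: cmu.
    rewrite (_ : _ @^-1` _ = dil G r @` K).
      by apply: continuous_compact => //; apply: continuous_subspaceT; exact: continuous_dil.
    apply/seteqP; split => [x /= Kx|_ [x Kx <-] /=]; last by rewrite dilK.
    by exists (dil G r^-1 x) => //; rewrite dilVK.
have lt1 (r : R) : 0 < r < 1 -> forall F : set B, measurable F ->
    mu (dil G r^-1 @^-1` F) = ((r `^ hom_dim G)%:E * mu F)%E.
  move=> /andP[r0 r1] F mF; have [c c0 hc] := modulus r r0.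
  rewrite hc//; congr (_%:E * _)%E.
  by apply: (dil_modulus_lt1 linv cmu muT Pu d0 trE dE) => //; rewrite r0.
move=> s0 mE; have [s1|s1|->] := ltgtP s 1; last 1 first.
- rewrite invr1 powR1 mul1e; congr (mu _).
  by apply/seteqP; split => x /=; rewrite dil1.
- by apply: lt1; rewrite ?s0.
(* For [s > 1] the case of [s^-1] is applied to the dilated set, and the factor is inverted. *)
have mEs : measurable (dil G s^-1 @^-1` E : set B).
  by rewrite -[X in measurable X]setTI; exact: measurable_dil.
have := lt1 s^-1 _ _ mEs; rewrite invr_gt0 s0 invf_lt1// s1 => /(_ isT).
have -> : dil G s^-1^-1 @^-1` (dil G s^-1 @^-1` E) = E.
  by apply/seteqP; split => x /=; rewrite invrK dilK.
move=> ->; rewrite muleA -EFinM powRVl//.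
by rewrite mulfV ?mul1e// gt_eqF// powR_gt0.
Qed.

Lemma haar_dil_integral (s : R) (F : B -> \bar R) : 0 < s ->
  measurable_fun setT F -> (forall x, (0 <= F x)%E) ->
  (\int[mu]_x F (dil G s^-1 x) = (s `^ hom_dim G)%:E * \int[mu]_x F x)%E.
Proof.
move=> s0 mF F0.
have := ge0_integral_pushforward (@measurable_dil s^-1) mu measurableT mF
  (fun y _ => F0 y).
rewrite preimage_setT => /esym; rewrite /comp => ->.
have sQ0 : 0 <= s `^ hom_dim G by exact: powR_ge0.
rewrite -(@ge0_integral_mscale _ _ _ mu setT measurableT (NngNum sQ0) F)//.
apply: eq_measure_integral; first exact: measurable_dil.
by move=> ? A mA _; rewrite /mscale/=; exact: haar_dil.
Qed.

End haar_dilation.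

(** * Polar coordinates *)

Lemma integral_inv_ln2 (R : realType) (a : R) : 0 < a ->
  (\int[lebesgue_measure]_(s in `[(a / 2)%R, a]) (s `^ (-1))%:E = (ln 2)%:E)%E.
Proof.
move=> a0.
have a2 : a / 2 < a by rewrite ltr_pdivrMr// ltr_pMr// ltr1n.
have a20 : 0 < a / 2 by rewrite divr_gt0.
have pos s : s \in `[a / 2, a] -> 0 < s.
  by rewrite in_itv/= => /andP[h _]; exact: lt_le_trans h.
have dln (s : R) : 0 < s -> is_derive s 1 (@ln R) s^-1 by exact: is_derive1_ln.
have cln (s : R) : 0 < s -> {for s, continuous (@ln R)} by move=> ?; exact: continuous_ln.
rewrite (@continuous_FTC2 R (fun s => s `^ (-1)) (@ln R) (a / 2) a a2).
- rewrite -EFinB; congr EFin.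
  by rewrite ln_div ?posrE// opprB addrC subrK.
- apply: derivable_within_continuous => s /pos s0.
  exact: (@ex_derive _ _ _ _ _ _ _ (is_derive1_powR (-1) s0)).
- split.
  + by move=> s /[!in_itv]/= /andP[h _]; apply: ex_derive; apply: dln; exact: lt_trans h.
  + by apply: cvg_at_right_filter; exact: cln.
  + by apply: cvg_at_left_filter; exact: cln.
- move=> s /[!in_itv]/= /andP[h _]; have s0 : 0 < s by exact: lt_trans h.
  by rewrite derive1E (@derive_val _ _ _ _ _ _ _ (dln s s0)) powR_inv1// ltW.
Qed.

Section polar.
Variables (R : realType) (n : nat) (G : homogeneous_group R n).
Local Notation V := 'rV[R]_n.+1.
Local Notation B := (borel_space R n).
Variable mu : {measure set B -> \bar R}.
Hypothesis hmu : haar_measure G mu.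
Variable N : V -> R.
Hypothesis hN : quasi_norm G N.
Hypothesis Q0 : 0 < hom_dim G.

Let Q := hom_dim G.
Let lam := @lebesgue_measure R.
Let L0 := `]0, +oo[%classic : set (measurableTypeR R).

Let cN : continuous N. Proof. by case: hN. Qed.
Let N_ge0 x : 0 <= N x. Proof. by case: hN. Qed.
Let N_dil s x : 0 < s -> N (dil G s x) = s * N x.
Proof. by case: hN => _ _ _ + _; apply. Qed.
Let N_eq0 x : N x = 0 <-> x = 0. Proof. by case: hN => _ _ _ _; apply. Qed.

Lemma quasi_norm_gt0 x : x <> 0 -> 0 < N x.
Proof.
by move=> x0; rewrite lt_neqAle N_ge0 andbT eq_sym; apply/eqP => /N_eq0.
Qed.

(** The origin is fixed by [D_2], so its finite mass equals [2^Q] times itself with [2^Q <> 1]. *)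
Lemma haar_set0 : mu [set (0 : V)] = 0%E.
Proof.
have m0 : measurable ([set (0 : V)] : set B).
  by apply: borel_closed; apply: accessible_closed_set1; exact: hausdorff_accessible (@norm_hausdorff _ _).
have := haar_dil hmu (ltr0Sn R 1) m0.
have -> : dil G 2^-1 @^-1` [set (0 : V)] = [set (0 : V)].
  apply/seteqP; split => x /= => [h|->]; last by rewrite dil0.
  by rewrite -[x](@dilVK _ _ G 2)// h dil0.
have fin0 : mu [set (0 : V)] \is a fin_num.
  have [_ cmu _] := hmu; rewrite ge0_fin_numE//; apply: cmu.
  exact: compact_set1.
rewrite -(fineK fin0) -EFinM => -[] /eqP.
rewrite -subr_eq0 -{1}[fine _]mul1r -mulrBl mulf_eq0 subr_eq0 => /orP[/eqP h|/eqP->//].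
have := congr1 (fun r => r `^ (hom_dim G)^-1) h.
rewrite powR1 -powRrM mulfV ?gt_eqF// powRr1// => /eqP.
by rewrite lt_eqF// ltr1n.
Qed.

(** For [x <> 0] the point [D_(1/s) x] lies in it exactly when [N x / 2 <= s <= N x]; the
    [ds / s]-length [ln 2] of this interval does not depend on [x]. *)
Definition annulus : set B := [set y | 1 <= N y <= 2].

Lemma measurable_annulus : measurable annulus.
Proof.
rewrite /annulus (_ : [set _ | _] = N @^-1` `[1, 2]%classic).
  rewrite -[X in measurable X]setTI.
  by apply: (@borel_continuous_measurable R n N cN measurableT).
by apply/seteqP; split => x /=; rewrite in_itv.
Qed.

(** The dilation in logarithmic time: [E (ln s)] and, for [s > 0], [E (- ln s)] are [D_s] and
    [D_(1/s)], both jointly measurable in [(x, s)]. *)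
Let E (t : R) (x : V) := x *m expmx (t *: hg_A0 G).

Let borel_snd_fun (h : R -> R) : measurable_fun setT h ->
  borel_map (fun z : B * measurableTypeR R => h z.2 : R^o).
Proof.
move=> mh U oU; rewrite -[X in measurable X]setTI.
have mh2 : measurable_fun setT (fun z : B * measurableTypeR R => h z.2).
  exact: (measurableT_comp mh measurable_snd).
by apply: mh2 => //; exact: open_measurable.
Qed.

Let borel_fst_id : borel_map (fun z : B * measurableTypeR R => z.1 : V).
Proof.
move=> U oU; rewrite -[X in measurable X]setTI.
by apply: measurable_fst => //; exact: borel_open.
Qed.

Let measurable_E (h : R -> R) : measurable_fun setT h ->
  measurable_fun setT (fun z : B * measurableTypeR R => E (h z.2) z.1 : B).
Proof.
move=> mh; apply: borel_map_measurable.
have [u du] := dense_sequence_rV R n; have [v dv] := dense_sequence_R R.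
exact: (borel_map_continuous2 dv du (borel_snd_fun mh) borel_fst_id (@dil_continuous R n G)).
Qed.

Lemma measurable_dil_pair (F : B -> \bar R) : measurable_fun setT F ->
  measurable_fun setT (fun z : B * measurableTypeR R => F (dil G z.2 z.1)).
Proof. by move=> mF; exact: (measurableT_comp mF (measurable_E (@measurable_ln R))). Qed.

(** The cut-off to [s > 0] is part of the integrand, so that Tonelli is applied on the full
    product. *)
Let weight (r s : R) : \bar R := ((\1_L0 s : R) * s `^ r)%:E.

Let measurable_weight r : measurable_fun setT (weight r : measurableTypeR R -> \bar R).
Proof.
apply/measurable_EFinP; apply: measurable_funM; last exact: measurable_powR.
by apply: measurable_indic; exact: measurable_itv.
Qed.

Let weight_ge0 r s : (0 <= weight r s)%E.
Proof. by rewrite lee_fin mulr_ge0// powR_ge0. Qed.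

Let weightE r s : weight r s = if 0 < s then (s `^ r)%:E else 0%E.
Proof.
rewrite /weight indicE (_ : (s \in L0) = (0 < s)); last first.
  by rewrite mem_setE in_itv/= andbT.
by case: ifP => _; rewrite ?mul1r ?mul0r.
Qed.

Definition ray_integral (F : B -> \bar R) (y : V) : \bar R :=
  (\int[lebesgue_measure]_(s in `]0%R, +oo[) (F (dil G s y) * (s `^ (hom_dim G - 1))%:E))%E.

Let ray_integralE (F : B -> \bar R) y :
  ray_integral F y = (\int[lam]_s (weight (Q - 1) s * F (dil G s y)))%E.
Proof.
rewrite /ray_integral integral_mkcond; apply: eq_integral => s _.
rewrite weightE /patch mem_setE in_itv/= andbT.
by case: ifP => _; rewrite ?mul0e// muleC.
Qed.

Let m_weight_F (F : B -> \bar R) : measurable_fun setT F ->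
  measurable_fun setT (fun z : B * measurableTypeR R =>
    weight (Q - 1) z.2 * F (dil G z.2 z.1))%E.
Proof.
move=> mF; apply: emeasurable_funM; last exact: measurable_dil_pair.
exact: (measurableT_comp (measurable_weight (Q - 1))).
Qed.

Let sf_mu : sigma_finite setT mu.
Proof. by apply: compact_finite_sigma_finite; case: hmu. Qed.
Let sf_lam : sigma_finite setT lam. Proof. exact: sigma_finiteT. Qed.

Lemma measurable_ray_integral (F : B -> \bar R) : measurable_fun setT F ->
  (forall x, (0 <= F x)%E) -> measurable_fun setT (ray_integral F : B -> \bar R).
Proof.
move=> mF F0; rewrite (funext (ray_integralE F)).
apply: (@measurable_integral_snd _ _ _ _ _ lam sf_lam
  (fun z : B * measurableTypeR R => weight (Q - 1) z.2 * F (dil G z.2 z.1))%E).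
  exact: m_weight_F.
by move=> z; rewrite mule_ge0.
Qed.

Lemma ray_integral_ge0 (F : B -> \bar R) y : (forall x, (0 <= F x)%E) ->
  (0 <= ray_integral F y)%E.
Proof. by move=> F0; apply: integral_ge0 => s _; rewrite mule_ge0// lee_fin powR_ge0. Qed.

Let annulus_slice (x : V) : x <> 0 ->
  (\int[lam]_s (weight (-1) s * (\1_annulus (E (- ln s) x) : R)%:E) = (ln 2)%:E)%E.
Proof.
move=> /quasi_norm_gt0 Nx.
rewrite -(integral_inv_ln2 Nx) [RHS]integral_mkcond; apply: eq_integral => s _.
rewrite weightE /patch mem_setE in_itv/=.
have [s0|s0] := ltP 0 s; last first.
  rewrite mul0e; case: ifP => // /andP[h _].
  by have := lt_le_trans (divr_gt0 Nx (ltr0Sn R 1)) h; rewrite ltNge s0.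
have -> : E (- ln s) x = dil G s^-1 x by rewrite /E /dil /dilation lnV.
rewrite indicE /annulus.
have -> : (dil G s^-1 x \in ([set y | 1 <= N y <= 2] : set B)) = (N x / 2 <= s <= N x).
  apply/idP/idP; rewrite inE/= N_dil ?invr_gt0//.
    by rewrite ler_pdivlMl// mulr1 ler_pdivrMl// ler_pdivrMr// andbC.
  by rewrite ler_pdivlMl// mulr1 ler_pdivrMl// ler_pdivrMr// andbC.
by case: ifP => _; rewrite ?mule1// mule0.
Qed.

(* Inserting the constant [int 1_annulus (D_(1/s) x) ds / s = ln 2] and changing
   variables by [x = D_s y] avoids constructing the measure on the unit
   quasi-sphere. *)
Lemma polar_coordinates (F : B -> \bar R) : measurable_fun setT F ->
  (forall x, (0 <= F x)%E) ->
  ((ln 2)%:E * \int[mu]_x F x = \int[mu]_(y in annulus) ray_integral F y)%E.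
Proof.
move=> mF F0.
have mI : measurable_fun setT (fun x : B => (\1_annulus x : R)%:E).
  by apply: measurable_indicE; exact: measurable_annulus.
have mlnN : measurable_fun setT (fun s : R => - ln s).
  exact: measurableT_comp (@measurable_ln R).
pose f1 (z : B * measurableTypeR R) : \bar R :=
  (weight (-1) z.2 * (F z.1 * (\1_annulus (E (- ln z.2) z.1) : R)%:E))%E.
have mf1 : measurable_fun setT f1.
  apply: emeasurable_funM; first exact: (measurableT_comp (measurable_weight (-1))).
  apply: emeasurable_funM; first exact: (measurableT_comp mF).
  exact: (measurableT_comp mI (measurable_E mlnN)).
have f10 z : (0 <= f1 z)%E.
  by rewrite mule_ge0// mule_ge0// lee_fin.
pose f2 (z : B * measurableTypeR R) : \bar R :=
  ((\1_annulus z.1 : R)%:E * (weight (Q - 1) z.2 * F (dil G z.2 z.1)))%E.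
have mf2 : measurable_fun setT f2.
  apply: emeasurable_funM; first exact: (measurableT_comp mI).
  exact: m_weight_F.
have f20 z : (0 <= f2 z)%E by rewrite mule_ge0 ?lee_fin// mule_ge0.
transitivity (\int[mu]_x \int[lam]_s f1 (x, s))%E.
  rewrite -ge0_integralZl//; last by rewrite lee_fin ln_ge0// ler1n.
  (* The integral over [s] equals [ln 2] only for [x <> 0]; the origin is a null set. *)
  apply: ge0_ae_eq_integral => //.
  - exact: measurable_funeM.
  - exact: measurable_integral_snd.
  - by move=> x _; rewrite mule_ge0// lee_fin ln_ge0// ler1n.
  - by move=> x _; exact: integral_ge0.
  exists [set (0 : V)]; split.
  - by apply: borel_closed; apply: accessible_closed_set1; exact: hausdorff_accessible (@norm_hausdorff _ _).
  - exact: haar_set0.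
  move=> x /= h; apply: contrapT => x0; apply: h => _.
  rewrite /f1/=; under eq_integral do rewrite muleCA.
  rewrite ge0_integralZl//.
  - by rewrite annulus_slice// muleC.
  - apply: emeasurable_funM; first exact: measurable_weight.
    apply: (measurableT_comp mI).
    exact: (measurableT_comp (measurable_E mlnN) (pair1_measurable x)).
  - by move=> s _; rewrite mule_ge0// lee_fin.
rewrite (tonelli_swap sf_mu sf_lam)//.
transitivity (\int[lam]_s \int[mu]_y f2 (y, s))%E.
  apply: eq_integral => s _; rewrite /f1 /f2/=.
  pose H (y : B) := (F (dil G s y) * (\1_annulus y : R)%:E)%E.
  have mH : measurable_fun setT H.
    by apply: emeasurable_funM => //; exact: (measurableT_comp mF (@measurable_dil _ _ G s)).
  have H0 y : (0 <= H y)%E by rewrite mule_ge0 ?lee_fin.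
  transitivity (weight (Q - 1) s * \int[mu]_y H y)%E; last first.
    rewrite -ge0_integralZl//; apply: eq_integral => y _.
    by rewrite [RHS]muleCA /H [X in (_ * X)%E = _]muleC.
  have [s0|s0] := ltP 0 s; last first.
    under eq_integral do rewrite weightE ltNge s0 mul0e.
    by rewrite integral0 weightE ltNge s0 mul0e.
  under eq_integral => x _.
    have -> : E (- ln s) x = dil G s^-1 x by rewrite /E /dil /dilation lnV.
    rewrite -[X in (F X * _)%E](dilVK G s0 x).
    over.
  rewrite (_ : (fun x => _) = fun x => (weight (-1) s * H (dil G s^-1 x))%E)//.
  rewrite ge0_integralZl//; last exact: (measurableT_comp mH (@measurable_dil _ _ G s^-1)).
  (* The factor [s^Q] of the change of variables and the weight [s^(-1)] combine to [s^(Q - 1)]. *)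
  rewrite haar_dil_integral// muleA; congr (_ * _)%E.
  by rewrite !weightE s0 -EFinM addrC powRD// (gt_eqF s0) implybT.
rewrite -(tonelli_swap sf_mu sf_lam)// [RHS]integral_mkcond.
apply: eq_integral => y _; rewrite /f2/= ge0_integralZl//.
- rewrite -ray_integralE indicE /patch; case: ifP => _; first by rewrite mul1e.
  by rewrite mul0e.
- exact: (measurableT_comp (m_weight_F mF) (pair1_measurable y)).
- by move=> s _; rewrite mule_ge0.
Qed.

End polar.

(** * The inequality along a ray *)

Lemma powR_near0 (R : realType) (q e : R) : 0 < q -> 0 < e ->
  exists2 d, 0 < d & forall t, 0 <= t < d -> t `^ q < e.
Proof.
move=> q0 e0; exists (e `^ q^-1); first exact: powR_gt0.
move=> t /andP[t0 td].
have tn : t \is Num.nneg by rewrite nnegrE.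
have en : e `^ q^-1 \is Num.nneg by rewrite nnegrE powR_ge0.
have := gt0_ltr_powR q0 tn en td.
by rewrite /= -powRrM mulVf ?gt_eqF// powRr1 ?(ltW e0).
Qed.

Lemma sqrt_sum_lipschitz (R : realType) (x y C D h : R) :
  `|x| <= C * h -> `|y| <= D * h -> 0 <= h -> Num.sqrt (x ^+ 2 + y ^+ 2) <= (C + D) * h.
Proof.
move=> xC yD h0.
have C0 : 0 <= C * h by exact: le_trans xC.
have D0 : 0 <= D * h by exact: le_trans yD.
rewrite mulrDl -(ler_pXn2r (ltn0Sn 1)) ?nnegrE ?sqrtr_ge0 ?addr_ge0//.
rewrite sqr_sqrtr ?addr_ge0 ?sqr_ge0// sqrrD -(real_normK (num_real x)) -(real_normK (num_real y)).
have h1 : `|x| ^+ 2 <= (C * h) ^+ 2 by rewrite ler_pXn2r// nnegrE.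
have h2 : `|y| ^+ 2 <= (D * h) ^+ 2 by rewrite ler_pXn2r// nnegrE.
have h3 : 0 <= C * h * (D * h) by rewrite mulr_ge0.
by rewrite mulr2n; lra.
Qed.

Lemma cauchy_schwarz2 (R : rcfType) (a b c d : R) :
  `|a * c + b * d| <= Num.sqrt (a ^+ 2 + b ^+ 2) * Num.sqrt (c ^+ 2 + d ^+ 2).
Proof.
rewrite -sqrtrM ?addr_ge0 ?sqr_ge0// -sqrtr_sqr ler_sqrt; last first.
  by rewrite mulr_ge0 ?addr_ge0 ?sqr_ge0.
rewrite -subr_ge0 (_ : _ - _ = (a * d - b * c) ^+ 2) ?sqr_ge0//; ring.
Qed.
Lemma derivable_lipschitz_at (R : realType) (q : R -> R) (x : R) :
  derivable q x 1 -> exists2 C, 0 < C &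
    exists2 d : R, 0 < d & forall y, `|y - x| < d -> `|q y - q x| <= C * `|y - x|.
Proof.
move=> dq; have dNq : derivable (- q) x 1 by exact: derivableN.
exists (`|derive1 q x| + 1); first by rewrite ltr_wpDl.
have /cvgrPdist_lt/(_ _ ltr01) := dq.
rewrite near_withinE => /nbhs_ballP[d /= d0 hd].
exists d => // y yd; have [->|yx] := eqVneq y x; first by rewrite !subrr normr0 mulr0.
have := hd (y - x); rewrite /ball/= sub0r normrN => /(_ yd).
rewrite subr_eq0 => /(_ yx).
rewrite /GRing.scale/= mulr1 subrK -/(derive q x 1).
have yx0 : 0 < `|y - x| by rewrite normr_gt0 subr_eq0.
move=> h.
have : `|(y - x)^-1 * (q y - q x)| <= `|derive1 q x| + 1.
  rewrite derive1E -lerBlDl; apply: le_trans (ltW h).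
  rewrite distrC; exact: lerB_dist.
by rewrite normrM normfV ler_pdivrMl// mulrC.
Qed.

(** For [p > 1] the function [|f|^p] is differentiable along a ray even at zeros of [f]. Elsewhere
    it is the power [p / 2] of the smooth expression [a^2 + b^2], and Cauchy-Schwarz bounds the
    derivative. *)
Lemma derivable_powR_sqrt (R : realType) (a b : R -> R) (p s : R) : 1 < p ->
  derivable a s 1 -> derivable b s 1 ->
  let u r := Num.sqrt (a r ^+ 2 + b r ^+ 2) in
  derivable (fun r => u r `^ p) s 1 /\
  `|derive1 (fun r => u r `^ p) s| <=
    p * u s `^ (p - 1) * Num.sqrt (derive1 a s ^+ 2 + derive1 b s ^+ 2).
Proof.
move=> p1 da db u; have p0 : 0 < p by exact: lt_trans p1.
pose w r := a r ^+ 2 + b r ^+ 2.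
have w0 r : 0 <= w r by rewrite addr_ge0 ?sqr_ge0.
have uw r : u r `^ p = w r `^ (p / 2).
  by rewrite mulrC powRrM powR12_sqrt ?w0.
suff [v [dv hv]] : exists v, is_derive s 1 (fun r => u r `^ p) v /\
    `|v| <= p * u s `^ (p - 1) * Num.sqrt (derive1 a s ^+ 2 + derive1 b s ^+ 2).
  by split; [exact: (@ex_derive _ _ _ _ _ _ _ dv)|rewrite derive1E (@derive_val _ _ _ _ _ _ _ dv)].
have [ws0|ws0] := eqVneq (w s) 0.
  exists 0; split; last by rewrite normr0 !mulr_ge0 ?powR_ge0 ?sqrtr_ge0// ltW.
  have [as0 bs0] : a s = 0 /\ b s = 0.
    have /eqP : w s = 0 by [].
    rewrite /w paddr_eq0 ?sqr_ge0// !expf_eq0/= => /andP[/eqP -> /eqP ->]//.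
  have [C C0 [c c0 hC]] := derivable_lipschitz_at da.
  have [D D0 [d d0 hD]] := derivable_lipschitz_at db.
  have us0 : u s `^ p = 0 by rewrite uw ws0 powR0// gt_eqF// divr_gt0.
  (* At a zero both components are [O(h)], so the quotient is at most a constant times
     [|h|^(p - 1)], which tends to 0. *)
  suff cv : h^-1 *: (((fun r => u r `^ p) \o shift s) (h *: 1) - u s `^ p) @[h --> 0^'] --> (0 : R).
    by apply: DeriveDef; [apply: cvgP cv|exact: (cvg_lim _ cv)].
  have K0 : 0 < (C + D) `^ p by rewrite powR_gt0 ?addr_gt0.
  apply/cvgrPdist_lt => e e0.
  have pm1 : 0 < p - 1 by rewrite subr_gt0.
  have [k k0 hk] := powR_near0 pm1 (divr_gt0 e0 K0).
  near=> h.
  have hn0 : h != 0 by near: h; exact: nbhs_dnbhs_neq.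
  rewrite sub0r normrN /GRing.scale/= mulr1 us0 subr0.
  have hp : 0 < `|h| by rewrite normr_gt0.
  have uh : u (h + s) <= (C + D) * `|h|.
    apply: sqrt_sum_lipschitz => //.
      by have := hC (h + s); rewrite as0 subr0 addrK; apply; near: h; exact: dnbhs0_lt.
    by have := hD (h + s); rewrite bs0 subr0 addrK; apply; near: h; exact: dnbhs0_lt.
  rewrite normrM normfV ltr_pdivrMl// ger0_norm ?powR_ge0//.
  apply: (@le_lt_trans _ _ (((C + D) * `|h|) `^ p)).
    by apply: (ge0_ler_powR (ltW p0)) => //; rewrite nnegrE ?sqrtr_ge0// mulr_ge0// addr_ge0 ?ltW.
  rewrite powRM// ?addr_ge0 ?(ltW C0) ?(ltW D0)// -(mulr_powRB1 (normr_ge0 h) p0) mulrCA ltr_pM2l//.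
  rewrite mulrC -ltr_pdivlMr//; apply: hk; rewrite normr_ge0/=; near: h; exact: dnbhs0_lt.
have wp : 0 < w s by rewrite lt_neqAle eq_sym ws0 w0.
have iw : is_derive s 1 w (2 * (a s * derive1 a s + b s * derive1 b s)).
  have ia : is_derive s 1 a (derive1 a s) := DeriveDef da (esym (derive1E _ _)).
  have ib : is_derive s 1 b (derive1 b s) := DeriveDef db (esym (derive1E _ _)).
  have -> : w = (a ^+ 2 + b ^+ 2)%R by [].
  have iw := is_deriveD (is_deriveX 2 ia) (is_deriveX 2 ib).
  by apply: is_derive_eq iw _; rewrite /GRing.scale/=; ring.
exists (p / 2 * w s `^ (p / 2 - 1) * (2 * (a s * derive1 a s + b s * derive1 b s))); split.
  rewrite (_ : (fun r => _) = (powR (R:=R))^~ (p / 2) \o w); last by apply/funext => r /=.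
  exact: (is_derive1_comp (is_derive1_powR (p / 2) wp) iw).
rewrite !normrM (gtr0_norm p0) (ger0_norm (powR_ge0 _ _)) !(gtr0_norm (ltr0Sn _ _)) normfV !(gtr0_norm (ltr0Sn _ _)).
have -> : p / 2 * w s `^ (p / 2 - 1) * (2 * `|a s * derive1 a s + b s * derive1 b s|)
  = p * w s `^ (p / 2 - 1) * `|a s * derive1 a s + b s * derive1 b s| by rewrite mulrA (_ : _ * 2 = p * w s `^ (p / 2 - 1))//; lra.
have -> : u s `^ (p - 1) = w s `^ (p / 2 - 1) * u s.
  rewrite /u -/(w s) -powR12_sqrt// -powRrM -powRD; [congr powR; lra|by rewrite ws0 implybT].
rewrite -!mulrA ler_pM2l// ler_wpM2l ?powR_ge0//; exact: cauchy_schwarz2.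
Unshelve. all: by end_near.
Qed.

(** The pointwise inequality behind [truncate_le]: the second maximum dominates the derivative of
    [m * s - h s], and [m] is what cancels after integration. *)
Lemma min_max_split (R : realDomainType) (m l w : R) : 0 <= m -> 0 <= w ->
  Num.min (Num.max l 0) m + Num.max (m - l + w) 0 <= m + (Num.max (- l) 0 + w).
Proof.
move=> m0 w0.
rewrite !maxEle !minEle; case: (leP l 0) => ?; case: (leP (- l) 0) => ?; case: (leP (m - l + w) 0) => ?; try lra; case: (leP _ m) => ?; lra.
Qed.

Section ray_comparison.
Variable R : realType.
Let lam := @lebesgue_measure R.
Let L0 := `]0, +oo[%classic : set (measurableTypeR R).
Variables (h l w : R -> R) (M : R).
Hypothesis dh : forall s, 0 < s -> derivable h s 1.
Hypothesis hM : forall s, M <= s -> h s = 0.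
Hypothesis w0 : forall s, 0 < s -> 0 <= w s.
Hypothesis ml : measurable_fun L0 l.
Hypothesis mw : measurable_fun L0 w.
Hypothesis lh : forall s, 0 < s -> l s - w s <= derive1 h s.
Hypothesis hbnd : (\int[lam]_(s in L0) (w s)%:E < +oo)%E ->
  forall e, 0 < e -> exists2 s, 0 < s < e & - h s < e.

Let LE s : L0 s <-> 0 < s. Proof. by rewrite /L0/= in_itv/= andbT. Qed.
Let mL0 : measurable L0. Proof. exact: measurable_itv. Qed.
Let mwE : measurable_fun L0 (fun s => (w s)%:E).
Proof. exact/measurable_EFinP. Qed.
Let mlE : measurable_fun L0 (fun s => (Num.max (- l s) 0)%:E).
Proof.
apply/measurable_EFinP; apply: measurable_maxr; last exact: measurable_cst.
exact: (@measurableT_comp _ _ _ _ _ _ (@GRing.opp R)).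
Qed.

(** [le_integral_derive1] is applied to [m * s - h s], whose derivative is at most the positive part
    of [m - l + w]. Adding the integral of the truncated positive part of [l] produces [m * (b - a)]
    on both sides, a finite quantity that can be cancelled; [h b = 0] because [b >= M]. *)
Let truncate_le (m : nat) (a b : R) :
  0 < a -> M <= b -> a <= b ->
  (\int[lam]_(s in L0) (Num.max (- l s) 0)%:E < +oo)%E ->
  (\int[lam]_(s in L0) (w s)%:E < +oo)%E ->
  (\int[lam]_(s in `[a, b]) (Num.min (Num.max (l s) 0) m%:R)%:E <=
    \int[lam]_(s in L0) (Num.max (- l s) 0)%:E + \int[lam]_(s in L0) (w s)%:E
    - (h a)%:E)%E.
Proof.
move=> a0 Mb ab lfin wfin.
pose I := `[a, b]%classic : set (measurableTypeR R).
have mI : measurable I by exact: measurable_itv.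
have IL : I `<=` L0.
  by move=> s; rewrite /I/= in_itv/= => /andP[/(lt_le_trans a0)] ? _; apply/LE.
have mlI : measurable_fun I l by exact: measurable_funS ml.
have mwI : measurable_fun I w by exact: measurable_funS mw.
pose k s := Num.max (m%:R - l s + w s) 0.
have mk : measurable_fun I k.
  apply: measurable_maxr; last exact: measurable_cst.
  by apply: measurable_funD => //; apply: measurable_funB => //; exact: measurable_cst.
have mt : measurable_fun I (fun s => Num.min (Num.max (l s) 0) m%:R).
  by apply: measurable_minr; [apply: measurable_maxr|]; do ?exact: measurable_cst.
have sI s : s \in `[a, b] -> 0 < s.
  by rewrite in_itv/= => /andP[/(lt_le_trans a0)].
have := @le_integral_derive1 R a b (fun s => m%:R * s - h s) k ab.
have dms (s : R) : derivable (fun s : R => m%:R * s) s 1.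
  exact: (@derivableM _ _ (cst m%:R) id).
have dq s : 0 < s -> derive1 (fun s => m%:R * s - h s) s = m%:R - derive1 h s.
  move=> s0; rewrite !derive1E (@deriveB _ _ _ (fun s : R => m%:R * s) h)//; last exact: dh.
  congr (_ - _); rewrite (@deriveM _ _ (cst m%:R) id)//= derive_cst derive_id.
  by rewrite /GRing.scale/= mulr1 mulr0 addr0.
move=> /(_ _ _ mk) H.
have {H}: ((m%:R * b - h b - (m%:R * a - h a))%:E <= \int[lam]_(s in I) (k s)%:E)%E.
  apply: H => s /sI s0.
  - exact: (@derivableB _ _ _ (fun s : R => m%:R * s) h _ _ (dms s) (dh s0)).
  - by rewrite le_max lexx orbT.
  - by rewrite dq// le_max; have := lh s0; move: (derive1 h s) => ?; lra.
rewrite (hM Mb) subr0 => H.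
have key : (\int[lam]_(s in I) (Num.min (Num.max (l s) 0) m%:R)%:E + \int[lam]_(s in I) (k s)%:E
   <= (m%:R * (b - a))%:E + (\int[lam]_(s in L0) (Num.max (- l s) 0)%:E + \int[lam]_(s in L0) (w s)%:E))%E.
  have k0 s : I s -> (0 <= (k s)%:E)%E by move=> _; rewrite lee_fin le_max lexx orbT.
  have t0 s : I s -> (0 <= (Num.min (Num.max (l s) 0) m%:R)%:E)%E.
    by move=> _; rewrite lee_fin le_min le_max lexx orbT/=.
  rewrite -ge0_integralD//; [|exact/measurable_EFinP|exact/measurable_EFinP].
  have -> : (m%:R * (b - a))%:E = (\int[lam]_(s in I) (m%:R)%:E)%E.
    rewrite integral_cst// EFinM; congr (_ * _)%E.
    apply/esym/(eq_trans (lebesgue_measure_itv `[a, b])); rewrite /= lte_fin.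
    have [_|ba] := ltP a b; first by rewrite -EFinB.
    by rewrite (le_anti (introT andP (conj ab ba))) subrr.
  apply: (@le_trans _ _ (\int[lam]_(s in I) (m%:R)%:E + (\int[lam]_(s in I) (Num.max (- l s) 0)%:E + \int[lam]_(s in I) (w s)%:E))%E).
    have l0 s : I s -> (0 <= (Num.max (- l s) 0)%:E)%E by move=> _; rewrite lee_fin le_max lexx orbT.
    have w0' s : I s -> (0 <= (w s)%:E)%E by move=> /sI ?; rewrite lee_fin w0.
    have mlI' : measurable_fun I (fun s => (Num.max (- l s) 0)%:E) by exact: measurable_funS mlE.
    have mwI' : measurable_fun I (fun s => (w s)%:E) by exact: measurable_funS mwE.
    rewrite -ge0_integralD// -ge0_integralD//; last 2 first.
    - by move=> s Is; rewrite adde_ge0 ?l0 ?w0'.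
    - exact: emeasurable_funD.
    apply: ge0_le_integral => //.
    - by move=> s Is; rewrite adde_ge0 ?k0 ?t0.
    - by apply: emeasurable_funD; apply/measurable_EFinP.
    - by apply: emeasurable_funD => //; apply: emeasurable_funD.
    move=> s /sI s0; rewrite -!EFinD lee_fin /k.
    exact: min_max_split (ler0n _ _) (w0 s0).
  apply: leeD => //; apply: leeD; apply: ge0_subset_integral => //.
  - by move=> s _; rewrite lee_fin le_max lexx orbT.
  - by move=> s /LE; rewrite lee_fin; exact: w0.
set K := (X in (_ <= X - _)%E).
have Kfin : K \is a fin_num.
  rewrite ge0_fin_numE; first exact: lte_add_pinfty.
  apply: adde_ge0; apply: integral_ge0 => s; first by rewrite lee_fin le_max lexx orbT.
  by move=> /LE; rewrite lee_fin; exact: w0.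
have := le_trans (leeD2l _ H) key.
rewrite -/K -(fineK Kfin) -EFinD -EFinB.
rewrite -leeBrDr// -EFinB => /le_trans; apply.
by rewrite lee_fin; lra.
Qed.

(** The left endpoint runs through the points of [hbnd], where [- h] is almost nonpositive; then the
    truncation level and the interval grow together, by monotone convergence. *)
Lemma ray_comparison :
  (\int[lam]_(s in L0) (Num.max (l s) 0)%:E <=
    \int[lam]_(s in L0) (Num.max (- l s) 0)%:E + \int[lam]_(s in L0) (w s)%:E)%E.
Proof.
set A := (X in (_ <= X + _)%E); set B := (X in (_ <= _ + X)%E).
have A0 : (0 <= A)%E by apply: integral_ge0 => s _; rewrite lee_fin le_max lexx orbT.
have B0 : (0 <= B)%E by apply: integral_ge0 => s /LE; rewrite lee_fin; exact: w0.
have [Afin|] := ltP A +oo%E; last first.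
  by rewrite leye_eq => /eqP ->; rewrite addye ?leey// gt_eqF// (lt_le_trans _ B0).
have [Bfin|] := ltP B +oo%E; last first.
  by rewrite leye_eq => /eqP ->; rewrite addey ?leey// gt_eqF// (lt_le_trans _ A0).
pose I (m : nat) := `[m.+1%:R^-1, `|M| + m.+1%:R]%classic : set (measurableTypeR R).
have mI m : measurable (I m) by exact: measurable_itv.
have IL m : I m `<=` L0.
  move=> s; rewrite /I/= in_itv/= => /andP[+ _] => h1; apply/LE; apply: lt_le_trans h1.
  by rewrite invr_gt0.
pose t (m : nat) s : \bar R := (Num.min (Num.max (l s) 0) m%:R)%:E.
pose F m := t m \_ (I m).
have t0 m s : (0 <= t m s)%E by rewrite lee_fin le_min le_max lexx orbT/=.
have mt m : measurable_fun L0 (t m).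
  apply/measurable_EFinP; apply: measurable_minr; last exact: measurable_cst.
  by apply: measurable_maxr => //; exact: measurable_cst.
have FAB m : (\int[lam]_(s in L0) F m s <= A + B)%E.
  rewrite -integral_mkcondr setIidr; last exact: IL.
  apply/lee_addgt0Pr => e e0.
  (* The point [s] found below [d] makes [- h s < e] and at the same time lies to the left of
     [I m]. *)
  pose d := Num.min e m.+1%:R^-1.
  have d0 : 0 < d by rewrite lt_min e0 invr_gt0/=.
  have [s /andP[s0 sd] hs] := hbnd Bfin d0.
  have sm : s < m.+1%:R^-1 by apply: lt_le_trans sd _; rewrite ge_min lexx orbT.
  have m1 : (m.+1%:R^-1 : R) <= m.+1%:R by apply: (@le_trans _ _ 1); rewrite ?invf_le1 ?ler1n.
  have sb : s <= `|M| + m.+1%:R.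
    by rewrite (le_trans (ltW sm))// (le_trans m1)// ler_wpDl.
  have Mb : M <= `|M| + m.+1%:R by rewrite (le_trans (ler_norm _))// ler_wpDr.
  rewrite /I; set b := _ + _ in sb Mb *.
  apply: (@le_trans _ _ (\int[lam]_(s in `[s, b]) t m s)%E).
    apply: ge0_subset_integral => //.
    - apply: measurable_funS (mt m) => // r.
      by rewrite /= in_itv/= => /andP[/(lt_le_trans s0)] ? _; apply/LE.
    - move=> r; rewrite /= !in_itv/= => /andP[h1 ->]; rewrite andbT.
      by rewrite (le_trans _ h1)// ltW.
  apply: le_trans (truncate_le m s0 Mb sb Afin Bfin) _.
  apply: leeD => //; rewrite -EFinN lee_fin; apply: le_trans (ltW hs) _.
  by rewrite ge_min lexx.
have mF m : measurable_fun L0 (F m).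
  apply: (measurable_restrict _ (mI m) mL0).1.
  by apply: measurable_funS (mt m) => //; exact: subIsetl.
have F0 m s : L0 s -> (0 <= F m s)%E by move=> _; rewrite /F patchE; case: ifP.
have ndF s : L0 s -> {homo F^~ s : n m / (n <= m)%N >-> (n <= m)%E}.
  move=> _ i j ij; rewrite /F !patchE; case: ifPn => [|_]; last by case: ifP.
  rewrite inE /I/= in_itv/= => /andP[h1 h2].
  rewrite ifT; last first.
    rewrite inE/= in_itv/=; apply/andP; split.
      by apply: le_trans h1; rewrite lef_pV2 ?posrE// ler_nat.
    by apply: le_trans h2 _; rewrite lerD2l ler_nat.
  rewrite /t lee_fin; have : (i%:R : R) <= j%:R by rewrite ler_nat.
  by move=> ijR; rewrite le_min !ge_min lexx ijR orbT.
have cF := cvg_monotone_convergence mL0 mF F0 ndF.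
have limF s : L0 s -> limn (F^~ s) = (Num.max (l s) 0)%:E.
  move=> /LE s0; apply: cvg_lim => //; apply: cvg_near_cst.
  have sV0 : 0 < s^-1 by rewrite invr_gt0.
  (* Beyond this bound [m] exceeds [s], [1 / s] and [|l s|]: then [s] lies in [I m] and the
     truncation does nothing. *)
  have K0 : 0 <= s + s^-1 + `|l s| by rewrite !addr_ge0// ltW.
  near=> m.
  have mK : s + s^-1 + `|l s| < m%:R.
    apply: (lt_le_trans (archi_boundP K0)); rewrite ler_nat; near: m; exact: nbhs_infty_ge.
  have lm := ler_norm (l s); have M0 := normr_ge0 M; have l0 := normr_ge0 (l s).
  have m1 : (m%:R : R) < m.+1%:R by rewrite ltr_nat.
  rewrite /F patchE ifT; last first.
    rewrite inE /I/= in_itv/=; apply/andP; split; last lra.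
    by rewrite -[leRHS]invrK lef_pV2 ?posrE//; lra.
  rewrite /t; congr EFin; apply/min_idPl; rewrite ge_max ler0n andbT; lra.
have <- : (\int[lam]_(s in L0) limn (F^~ s))%E = (\int[lam]_(s in L0) (Num.max (l s) 0)%:E)%E.
  by apply: eq_integral => s; rewrite inE; exact: limF.
have {}cF := cF lam; rewrite -(cvg_lim _ cF)//.
apply: lime_le; first by apply: cvgP cF.
by near=> m; exact: FAB.
Unshelve. all: by end_near.
Qed.
End ray_comparison.

Section ray_inequality.
Variable R : realType.
Let lam := @lebesgue_measure R.
Let L0 := `]0, +oo[%classic : set (measurableTypeR R).
Variables (Q p rho M V u0 : R) (phi a b : R -> R).
Hypothesis p1 : 1 < p.
Hypothesis rho0 : 0 < rho.
Hypothesis dphi : forall r, 0 < r -> derivable phi r 1.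
Hypothesis da : forall s, 0 < s -> derivable a s 1.
Hypothesis db : forall s, 0 < s -> derivable b s 1.
Let u s := Num.sqrt (a s ^+ 2 + b s ^+ 2).
Hypothesis uM : forall s, M <= s -> u s = 0.
Hypothesis uV : forall s, 0 < s -> u s <= V.
Hypothesis V0 : 0 < V.
Hypothesis u_near0 : forall e : R, 0 < e ->
  exists2 r : R, 0 < r & forall s : R, 0 < s < r -> `|u s - u0| < e.
Hypothesis h0 : [\/ p <= Q, u0 = 0
  | forall e : R, 0 < e -> exists2 r : R, 0 < r < e & - e < phi r].
(** On the ray through [y], [rho] stands for [N y] and [s * rho] for [|D_s y|]; [a] and [b] are the
    real and imaginary parts of [f]. Then [l] and [w] are the integrands of the two sides times the
    polar density [s^(Q - 1)]. *)
Let l s := derive1 phi (s * rho) / (s * rho) `^ (Q - 1) * u s `^ p * s `^ (Q - 1).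
(** The radial derivative is taken in [|x| = s * rho], whence the division by [rho]. *)
Let du s := Num.sqrt ((derive1 a s / rho) ^+ 2 + (derive1 b s / rho) ^+ 2).
Let w s := (du s `^ p + (p - 1) * (`|phi (s * rho)| `^ (p / (p - 1))
  / (s * rho) `^ (p * (Q - 1) / (p - 1)) * u s `^ p)) * s `^ (Q - 1).
Hypothesis ml : measurable_fun L0 l.
Hypothesis mw : measurable_fun L0 w.

Let v s := u s `^ p.
(** Differentiating [phi (s * rho)] gives a factor [rho], and [s^(Q - 1) / (s * rho)^(Q - 1)] leaves
    [rho^(1 - Q)]; with the normalisation [rho^(- Q)] the term of [h'] containing [phi'] is exactly
    [l]. *)
Let h s := rho `^ (- Q) * (phi (s * rho) * v s).
Let p0 : 0 < p. Proof. exact: lt_trans p1. Qed.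
Let pm0 : 0 < p - 1. Proof. by rewrite subr_gt0. Qed.
Let u_ge0 s : 0 <= u s. Proof. exact: sqrtr_ge0. Qed.
Let v_ge0 s : 0 <= v s. Proof. exact: powR_ge0. Qed.

Let w0 s : 0 <= w s.
Proof.
rewrite mulr_ge0 ?powR_ge0// addr_ge0 ?powR_ge0// mulr_ge0 ?(ltW pm0)//.
by rewrite mulr_ge0 ?powR_ge0// divr_ge0 ?powR_ge0.
Qed.

Let dv s : 0 < s -> derivable v s 1.
Proof. by move=> s0; exact: (derivable_powR_sqrt p1 (da s0) (db s0)).1. Qed.

Let dmul s : derivable (fun s : R => s * rho) s 1.
Proof. exact: (@derivableM _ _ id (cst rho)). Qed.

Let is_derive_phi (s : R) : 0 < s ->
  is_derive s 1 (fun s : R => phi (s * rho)) (derive1 phi (s * rho) * rho).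
Proof.
move=> s0; apply: (is_derive1_comp (f := phi) (g := fun s : R => s * rho)).
  by apply: DeriveDef; [apply: dphi; rewrite mulr_gt0|rewrite derive1E].
apply: DeriveDef => //; rewrite (@deriveM _ _ id (cst rho))//= derive_cst derive_id.
by rewrite /GRing.scale/= mulr0 mulr1 add0r.
Qed.

Let is_derive_h (s : R) : 0 < s -> is_derive s 1 h
  (rho `^ (- Q) * (phi (s * rho) * derive1 v s + v s * (derive1 phi (s * rho) * rho))).
Proof.
move=> s0.
have iv : is_derive s 1 v (derive1 v s) by apply: DeriveDef; [exact: dv|rewrite derive1E].
exact: (is_deriveZ (rho `^ (- Q)) (is_deriveM (is_derive_phi s0) iv)).
Qed.

Let rhoQ : rho `^ (- Q) * rho = (rho `^ (Q - 1))^-1.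
Proof.
rewrite -powRN -{2}(powRr1 (ltW rho0)) -powRD; last by rewrite (gt_eqF rho0) implybT.
by congr powR; ring.
Qed.

Let du_rho s : Num.sqrt (derive1 a s ^+ 2 + derive1 b s ^+ 2) = rho * du s.
Proof.
rewrite /du !expr_div_n -mulrDl sqrtrM ?addr_ge0 ?sqr_ge0// sqrtrV ?sqr_ge0//.
by rewrite sqrtr_sqr gtr0_norm// mulrCA divff ?mulr1// gt_eqF.
Qed.

(** Young's inequality with exponents [p] and [p / (p - 1)]; multiplied by [p], its two coefficients
    become 1 and [p - 1]. *)
Let young s : 0 < s -> `|rho `^ (- Q) * (phi (s * rho) * derive1 v s)| <= w s.
Proof.
move=> s0; have r0 : 0 < s * rho by rewrite mulr_gt0.
have := (derivable_powR_sqrt p1 (da s0) (db s0)).2; rewrite -/(v) du_rho => hv.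
(* The power [p / (p - 1)] turns [u^(p - 1)] into [u^p], so [Y] raised to it is the potential
   integrand. *)
pose Y := `|phi (s * rho)| / (s * rho) `^ (Q - 1) * u s `^ (p - 1).
have Y0 : 0 <= Y by rewrite mulr_ge0 ?divr_ge0 ?powR_ge0.
rewrite !normrM (ger0_norm (powR_ge0 _ _)).
apply: (@le_trans _ _ (p * (du s * Y) * s `^ (Q - 1))).
  rewrite /Y powRM ?(ltW s0) ?(ltW rho0)//.
  have -> : p * (du s * (`|phi (s * rho)| / (s `^ (Q - 1) * rho `^ (Q - 1)) * u s `^ (p - 1))) * s `^ (Q - 1)
    = rho `^ (- Q) * (`|phi (s * rho)| * (p * u s `^ (p - 1) * (rho * du s))).
    transitivity ((rho `^ (- Q) * rho) * (`|phi (s * rho)| * (p * u s `^ (p - 1) * du s))); last by ring.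
    by rewrite rhoQ; field; rewrite !gt_eqF ?powR_gt0.
  by rewrite !ler_wpM2l ?invr_ge0 ?powR_ge0.
rewrite ler_wpM2r ?powR_ge0//.
have conj : p^-1 + (p / (p - 1))^-1 = 1 by field; rewrite ?gt_eqF.
have q0 : 0 < p / (p - 1) by rewrite divr_gt0.
have := conjugate_powR (sqrtr_ge0 _ : 0 <= du s) Y0 p0 q0 conj.
move=> /(ler_wpM2l (ltW p0)) /le_trans; apply.
have -> : p * (du s `^ p / p + Y `^ (p / (p - 1)) / (p / (p - 1))) =
    du s `^ p + (p - 1) * Y `^ (p / (p - 1)) by field; rewrite ?gt_eqF.
rewrite lerD2l ler_pM2l//.
rewrite /Y powRM ?divr_ge0 ?powR_ge0// powRM ?invr_ge0 ?powR_ge0// powRVl ?powR_gt0// -!powRrM.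
rewrite (_ : (p - 1) * (p / (p - 1)) = p); last by rewrite mulrC divfK// gt_eqF.
by rewrite (_ : (Q - 1) * (p / (p - 1)) = p * (Q - 1) / (p - 1))//; ring.
Qed.

Let is_le s : 0 < s -> l s - w s <= derive1 h s.
Proof.
move=> s0; rewrite derive1E (@derive_val _ _ _ _ _ _ _ (is_derive_h s0)) mulrDr.
have := young s0; rewrite ler_norml => /andP[h1 _].
have -> : l s = rho `^ (- Q) * (v s * (derive1 phi (s * rho) * rho)).
  transitivity ((rho `^ (- Q) * rho) * (v s * derive1 phi (s * rho))); last by ring.
  rewrite rhoQ /l -/(v s) powRM ?(ltW s0) ?(ltW rho0)//; field.
  by rewrite !gt_eqF ?powR_gt0.
lra.
Qed.

(** A function whose derivative is at most a multiple of the integrable [w] cannot tend to [- oo] at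
    0. It is used for [ln v] and for [ln], to contradict a bad boundary term. *)
Let growth (q : R -> R) (c K : R) : 0 < c -> 0 <= K ->
  (forall s, 0 < s <= c -> derivable q s 1) ->
  (forall s, 0 < s <= c -> derive1 q s <= w s * K) ->
  (\int[lam]_(s in L0) (w s)%:E < +oo)%E ->
  exists C : R, forall s : R, 0 < s <= c -> q c - q s <= C.
Proof.
move=> c0 K0 dq qw wfin.
have LE s : L0 s <-> 0 < s by rewrite /L0/= in_itv/= andbT.
have mL0 : measurable L0 by exact: measurable_itv.
pose W := (\int[lam]_(s in L0) (w s * K)%:E)%E.
have W0 : (0 <= W)%E by apply: integral_ge0 => s _; rewrite lee_fin mulr_ge0.
have Wfin : (W < +oo)%E.
  rewrite /W; under eq_integral do rewrite EFinM.
  rewrite ge0_integralZr//.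
  - by rewrite muleC; apply: lte_mul_pinfty.
  - exact/measurable_EFinP.
  - by move=> s _; rewrite lee_fin.
exists (fine W) => s /andP[s0 sc].
rewrite -lee_fin fineK ?ge0_fin_numE//.
have sI x : x \in `[s, c] -> 0 < x <= c.
  by rewrite in_itv/= => /andP[/(lt_le_trans s0) -> ->].
have IL : `[s, c]%classic `<=` L0 by move=> x /= /sI /andP[? _]; apply/LE.
have mK : measurable_fun L0 (fun s => w s * K).
  by apply: measurable_funM => //; exact: measurable_cst.
apply: (@le_trans _ _ (\int[lam]_(x in `[s, c]) (w x * K)%:E)%E).
  apply: (@le_integral_derive1 R s c q (fun s => w s * K)) => //.
  - by move=> x /sI; exact: dq.
  - by move=> x _; rewrite mulr_ge0.
  - exact: measurable_funS mK.
  - by move=> x /sI; exact: qw.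
apply: ge0_subset_integral => //.
- exact/measurable_EFinP.
- by move=> x _; rewrite lee_fin mulr_ge0.
Qed.

(* If [phi |f|^p <= - c < 0] near 0, then [|(|f|^p)'| / |f|^p <= C w], so [ln |f|^p]
   is bounded below, contradicting [f 0 = 0]; and if [p <= Q] and [f 0 <> 0],
   then [w s >= C / s], so [ln s] would be bounded below. *)
Let boundary : (\int[lam]_(s in L0) (w s)%:E < +oo)%E ->
  forall e : R, 0 < e -> exists2 s : R, 0 < s < e & - h s < e.
Proof.
move=> wfin e e0; apply: contrapT => hno.
have hge s : 0 < s < e -> e <= - h s.
  by move=> se; rewrite leNgt; apply/negP => hs; apply: hno; exists s.
have rQ : 0 < rho `^ (- Q) by exact: powR_gt0.
pose c0 := e / rho `^ (- Q); have c00 : 0 < c0 by exact: divr_gt0.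
have key s : 0 < s < e -> c0 <= - phi (s * rho) * v s.
  by move=> /hge; rewrite /h /c0 ler_pdivrMr//; move: (rho `^ _) => ?; lra.
have vpos s : 0 < s < e -> 0 < v s.
  move=> /key; rewrite lt_neqAle v_ge0 andbT; apply: contraTneq => <-.
  by rewrite mulr0 -ltNge.
have vV s : 0 < s -> v s <= V `^ p.
  move=> s0; apply: (ge0_ler_powR (ltW p0)); rewrite ?nnegrE ?u_ge0 ?(ltW V0)//.
  exact: uV.
have Vp0 : 0 < V `^ p by exact: powR_gt0.
have e20 : 0 < e / 2 by exact: divr_gt0.
have e2 s : 0 < s <= e / 2 -> 0 < s < e by move=> /andP[s0 se]; rewrite s0/=; lra.
have [u00|u00] := eqVneq u0 0.
  have dln s : 0 < s <= e / 2 -> is_derive s 1 (fun s => ln (v s)) ((v s)^-1 * derive1 v s).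
    move=> /e2 se; have s0 : 0 < s by case/andP: se.
    apply: (is_derive1_comp (f := @ln R) (g := v)); first exact: (is_derive1_ln (vpos _ se)).
    by apply: DeriveDef; [exact: dv|rewrite derive1E].
  have [|s se|s se|C hC] := @growth (fun s => ln (v s)) (e / 2) e^-1 e20 _ _ _ wfin.
  - by rewrite invr_ge0 ltW.
  - exact: (@ex_derive _ _ _ _ _ _ _ (dln _ se)).
  - rewrite derive1E (@derive_val _ _ _ _ _ _ _ (dln _ se)) ler_pdivlMr//.
    have vs := vpos _ (e2 _ se); have s0 : 0 < s by case/andP: se.
    (* Since [e <= - h s], the factor [e] may be replaced by [- h s]; then [v s] cancels and
       [rho^(- Q) * |phi| * |v'|] remains, which [young] bounds by [w]. *)
    apply: (@le_trans _ _ ((v s)^-1 * `|derive1 v s| * - h s)).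
      rewrite -!mulrA; apply: ler_wpM2l; first by rewrite invr_ge0 ltW.
      apply: (@le_trans _ _ (`|derive1 v s| * e)); first by rewrite ler_pM2r// ler_norm.
      by rewrite ler_wpM2l// hge// e2.
    have -> : (v s)^-1 * `|derive1 v s| * - h s = - (rho `^ (- Q) * phi (s * rho)) * `|derive1 v s|.
      by rewrite /h; field; rewrite gt_eqF.
    apply: le_trans (young s0); rewrite mulrA normrM ler_wpM2r//.
    by rewrite -normrN ler_norm.
  have [d d0 hd] := powR_near0 p0 (expR_gt0 (ln (v (e / 2)) - C)).
  have [r r0 hr] := u_near0 d0.
  pose s := Num.min (r / 2) (e / 2).
  have s0 : 0 < s by rewrite lt_min e20 divr_gt0.
  have se : 0 < s <= e / 2 by rewrite s0/= ge_min lexx orbT.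
  have sr : 0 < s < r.
    by rewrite s0/= (@le_lt_trans _ _ (r / 2))// ?ge_min ?lexx// ltr_pdivrMr// ltr_pMr// ltr1n.
  have := hr _ sr; rewrite u00 subr0 ger0_norm// => ud.
  have := hd _ (introT andP (conj (u_ge0 s) ud)).
  rewrite -/(v s) -ltr_ln ?posrE ?expR_gt0 ?vpos ?e2// expRK => hlt.
  by have := hC _ se; rewrite lerBlDl -lerBlDr => /(lt_le_trans hlt); rewrite ltxx.
have u0p : 0 < u0.
  rewrite lt_neqAle eq_sym u00/= leNgt; apply/negP => un.
  have un0 : 0 < - u0 by rewrite oppr_gt0.
  have [r r0 hr] := u_near0 un0.
  have r2 : 0 < r / 2 < r by rewrite divr_gt0//= ltr_pdivrMr// ltr_pMr// ltr1n.
  have := hr _ r2; have := u_ge0 (r / 2); have := ler_norm (u (r / 2) - u0).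
  by move: (u _) (`|_|) => ? ?; lra.
case: h0 => [pQ|/eqP|hphi]; last 2 first.
- by rewrite (negPf u00).
(* The first bound puts [r / rho] in the range of [key]; the second makes
   [- phi * v < d * V^p <= c0], against [key]. *)
- pose d := Num.min (e * rho) (c0 / V `^ p).
  have d0 : 0 < d by rewrite lt_min mulr_gt0 ?divr_gt0.
  have [r /andP[r0 rd] hr] := hphi d d0.
  have re : 0 < r / rho < e.
    by rewrite divr_gt0//= ltr_pdivrMr// (lt_le_trans rd)// ge_min lexx.
  have := key _ re; rewrite leNgt divfK ?gt_eqF// => /negP; apply.
  apply: (@lt_le_trans _ _ (d * v (r / rho))).
    by rewrite ltr_pM2r ?vpos//; lra.
  apply: (@le_trans _ _ (d * V `^ p)).
    by rewrite ler_pM2l// vV//; case/andP: re.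
  by rewrite -ler_pdivlMr// ge_min lexx orbT.
have u02 : 0 < u0 / 2 by exact: divr_gt0.
have [r r0 hr] := u_near0 u02.
pose c := Num.min (e / 2) (Num.min (r / 2) 1).
have c0' : 0 < c by rewrite !lt_min e20 divr_gt0//= ltr01.
have cle s : 0 < s <= c -> [/\ 0 < s < e, 0 < s < r & 0 < s <= 1].
  move=> /andP[s0]; rewrite !le_min => /and3P[se sr s1]; rewrite s0 s1; split => //=; lra.
have vlow s : 0 < s <= c -> (u0 / 2) `^ p <= v s.
  move=> /cle[_ sr _]; apply: (ge0_ler_powR (ltW p0)); rewrite ?nnegrE ?u_ge0 ?(ltW u02)//.
  have := hr _ sr; rewrite distrC => /(le_lt_trans (ler_norm _)).
  by move: (u s) => ?; lra.
have philow s : 0 < s <= c -> c0 / V `^ p <= `|phi (s * rho)|.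
  move=> /cle[se _ _]; rewrite ler_pdivrMr//; apply: (le_trans (key _ se)).
  apply: (@le_trans _ _ (`|phi (s * rho)| * v s)).
    by rewrite ler_wpM2r// -normrN ler_norm.
  by rewrite ler_wpM2l// vV//; case/andP: se.
pose q := p / (p - 1).
have q0 : 0 < q by exact: divr_gt0.
(* What is left of the potential term after [|phi|] and [v] are replaced by their lower bounds and
   all powers of [s] are split off. *)
pose B := (p - 1) * ((c0 / V `^ p) `^ q * (rho `^ (p * (Q - 1) / (p - 1)))^-1 * (u0 / 2) `^ p).
have B0 : 0 < B by rewrite !mulr_gt0 ?invr_gt0 ?powR_gt0 ?divr_gt0.
have wlow s : 0 < s <= c -> B * s^-1 <= w s.
  move=> sc; have [se _ /andP[s0 s1]] := cle _ sc.
  (* The total exponent of [s] is [- (Q - 1) / (p - 1)], which is at most [- 1] exactly when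
     [p <= Q]; the comparison of powers needs [s <= 1], whence the 1 in [c]. *)
  have hs : s^-1 <= s `^ (Q - 1) / s `^ (p * (Q - 1) / (p - 1)).
    rewrite -powRB; last by rewrite (gt_eqF s0) implybT.
    rewrite -[s^-1]powR_inv1 ?(ltW s0)//; apply: ger_powR; first by rewrite s0.
    have -> : Q - 1 - p * (Q - 1) / (p - 1) = - ((Q - 1) / (p - 1)) by field; rewrite gt_eqF.
    by rewrite lerN2 ler_pdivlMr// mul1r; lra.
  have h1 : B * s^-1 <= (p - 1) * (`|phi (s * rho)| `^ q * (rho `^ (p * (Q - 1) / (p - 1)))^-1 * v s)
     * (s `^ (Q - 1) / s `^ (p * (Q - 1) / (p - 1))).
    apply: ler_pM => //; [exact: ltW|by rewrite invr_ge0 ltW|].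
    rewrite ler_pM2l//; apply: ler_pM; rewrite ?mulr_ge0 ?invr_ge0 ?powR_ge0//; last exact: vlow.
    rewrite ler_wpM2r ?invr_ge0 ?powR_ge0//; apply: (ge0_ler_powR (ltW q0)); last exact: philow.
      by rewrite nnegrE divr_ge0// ltW.
    by rewrite nnegrE.
  apply: (le_trans h1); rewrite /w -/q -/(v s) powRM ?(ltW s0) ?(ltW rho0)// [leRHS]mulrDl.
  rewrite (_ : forall x y z : R, x = y -> 0 <= z -> x <= z + y)//; last by rewrite mulr_ge0 ?powR_ge0.
    by move=> x y z -> ?; lra.
  by field; rewrite !gt_eqF ?powR_gt0.
have [|s sc|s sc|C hC] := @growth (@ln R) c B^-1 c0' _ _ _ wfin.
- by rewrite invr_ge0 ltW.
- by case/andP: sc => s0 _; exact: (@ex_derive _ _ _ _ _ _ _ (is_derive1_ln s0)).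
- case/andP: (sc) => s0 _.
  rewrite derive1E (@derive_val _ _ _ _ _ _ _ (is_derive1_ln s0)) ler_pdivlMr//.
  by rewrite mulrC; exact: wlow.
(* Chosen so that [ln c - ln s >= C + 1], against the bound [C] from [growth]. *)
pose s := Num.min c (expR (ln c - C - 1)).
have s0 : 0 < s by rewrite lt_min c0' expR_gt0.
have sc : 0 < s <= c by rewrite s0/= ge_min lexx.
have : ln s <= ln c - C - 1.
  rewrite -[leRHS]expRK ler_ln ?posrE ?expR_gt0// ge_min lexx orbT//.
move=> lnle; have := hC _ sc; rewrite lerBlDl -lerBlDr => /le_trans /(_ lnle).
by rewrite lerBrDr gerDl ler10.
Qed.

Lemma ray_inequality :
  (\int[lam]_(s in L0) (Num.max (l s) 0)%:E <=
    \int[lam]_(s in L0) (Num.max (- l s) 0)%:E + \int[lam]_(s in L0) (w s)%:E)%E.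
Proof.
have dh s : 0 < s -> derivable h s 1.
  by move=> s0; exact: (@ex_derive _ _ _ _ _ _ _ (is_derive_h s0)).
have hM s : M <= s -> h s = 0.
  by move=> Ms; rewrite /h /v uM// powR0 ?mulr0// gt_eqF.
exact: (@ray_comparison R h l w M dh hM (fun s _ => w0 s) ml mw is_le boundary).
Qed.
End ray_inequality.

(** * Integration over rays *)

Lemma normcE (R : rcfType) (z : R[i]) :
  ComplexField.Normc.normc z = Num.sqrt (complex.Re z ^+ 2 + complex.Im z ^+ 2).
Proof. by case: z. Qed.

Lemma is_derive_quotient_cvg (R : realType) (q : R -> R) (x d : R) :
  is_derive x 1 q d ->
  (m.+1%:R * (q (x + m.+1%:R^-1) - q x))%R @[m --> \oo] --> d.
Proof.
move=> qd; have dq := @ex_derive _ _ _ _ _ _ _ qd.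
have h0 : (m.+1%:R^-1 : R) @[m --> \oo] --> (0 : R)^'.
  move=> A A0.
  have hH : \forall m \near \oo, (harmonic m : R) != 0 -> A (harmonic m) := @cvg_harmonic R _ A0.
  change (\forall m \near \oo, A (m.+1%:R^-1)).
  apply: filterS hH => m Am; have hm : (m.+1%:R^-1 : R) != 0 by rewrite gt_eqF.
  exact: (Am hm).
pose D h := h^-1 *: ((q \o shift x) (h *: 1) - q x).
have DE : D \o (fun m => m.+1%:R^-1) = (fun m => m.+1%:R * (q (x + m.+1%:R^-1) - q x)).
  by apply/funext => m; rewrite /D /= /GRing.scale/= invrK mulr1 [_ + x]addrC.
have dD : D h @[h --> 0^'] --> d by rewrite -(@derive_val _ _ _ _ _ _ _ qd); exact: dq.
by rewrite -DE; exact: (@cvg_comp _ _ _ _ D _ _ _ h0 dD).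
Qed.

Lemma continuous_quotient (R : realType) (q : R -> R) (c k r : R) :
  {for r, continuous q} -> {for r + c, continuous q} ->
  {for r, continuous (fun x : R => k * (q (x + c) - q x))}.
Proof.
move=> cq cq'.
have cs : {for r, continuous (fun x : R => x + c)}.
  by apply: cvgD; [exact: cvg_id|exact: cvg_cst].
by apply: cvgM; [exact: cvg_cst|apply: cvgB => //; exact: (continuous_comp cs cq')].
Qed.

Section measurable_pieces.
Variable R : realType.
Let L0 := `]0, +oo[%classic : set (measurableTypeR R).

Lemma measurable_pos_continuous (q : R -> R) :
  (forall r, 0 < r -> {for r, continuous q}) -> measurable_fun L0 q.
Proof.
move=> cq; apply: open_continuous_measurable_fun; first exact: interval_open.
by move=> r; rewrite inE /L0/= in_itv/= andbT; exact: cq.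
Qed.

(** A derivative need not be continuous, but it is the pointwise limit of the continuous quotients
    with step [1 / (m + 1)]. *)
Lemma measurable_pos_derive (q dq : R -> R) :
  (forall r : R, 0 < r -> is_derive r 1 q (dq r)) -> measurable_fun L0 dq.
Proof.
move=> hq.
have cq r : 0 < r -> {for r, continuous q}.
  move=> r0; apply: differentiable_continuous; apply/derivable1_diffP.
  exact: (@ex_derive _ _ _ _ _ _ _ (hq _ r0)).
apply: (@measurable_fun_cvg _ (measurableTypeR R) R L0 (fun m r => m.+1%:R * (q (r + m.+1%:R^-1) - q r)) dq) => [m|r].
  apply: measurable_pos_continuous => r r0.
  by apply: continuous_quotient; apply: cq => //; rewrite addr_gt0// invr_gt0.
by rewrite /L0/= in_itv/= andbT => /hq; exact: is_derive_quotient_cvg.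
Qed.
End measurable_pieces.

(** * Radial derivatives along dilation orbits *)

Section radial.
Variables (R : realType) (n : nat) (G : homogeneous_group R n).
Local Notation V := 'rV[R]_n.+1.
Local Notation B := (borel_space R n).
Variable N : V -> R.
Hypothesis hN : quasi_norm G N.

Let cN : continuous N. Proof. by case: hN. Qed.
Let N_dil s x : 0 < s -> N (dil G s x) = s * N x.
Proof. by case: hN => _ _ _ + _; apply. Qed.

Lemma measurable_off0 (F : B -> R) :
  measurable_fun (~` [set (0 : V)] : set B) F -> measurable_fun setT F.
Proof.
move=> mF; rewrite -(setvU [set (0 : V)]).
have m0 : measurable ([set (0 : V)] : set B).
  by apply: borel_closed; apply: accessible_closed_set1; exact: hausdorff_accessible (@norm_hausdorff _ _).
apply/measurable_funU => //; first exact: measurableC.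
by split => //; exact: measurable_fun_set1.
Qed.

Lemma measurable_comp_quasi_norm (q : R -> R) :
  measurable_fun (`]0, +oo[%classic : set (measurableTypeR R)) q ->
  measurable_fun setT (fun x : B => q (N x)).
Proof.
move=> mq; apply: measurable_off0.
pose L0 := `]0, +oo[%classic : set (measurableTypeR R).
have mL0 : measurable L0 by exact: measurable_itv.
apply: (@measurable_comp _ _ _ B (measurableTypeR R) R L0 q _ N mL0 _ mq).
- by move=> _ [x /= x0 <-]; rewrite /L0/= in_itv/= andbT; exact: (quasi_norm_gt0 hN).
- by apply: measurable_funTS; exact: borel_continuous_measurable.
Qed.

Section along_rays.
Variable g : V -> R.
Hypothesis hg : Ck 1 g.

Let cg : continuous g. Proof. by case: hg. Qed.

Lemma derivable_comp_dil x (s : R) : 0 < s -> derivable (fun t => g (dil G t x)) s 1.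
Proof.
move=> s0; apply: derivable_comp_coords => [k|k|].
- exact: (Ck1_real (delta_mx 0 k) hg).1.
- exact: (Ck1_real (delta_mx 0 k) hg).2.
- exact: derivable_dil.
Qed.

(** Starting from [D_s y] gives the same unit vector as starting from [y], and [D_r] of it is
    [D_(r / N y) y]; the chain rule yields the factor [1 / N y]. *)
Lemma radial_derivative_dil y (s : R) : y <> 0 -> 0 < s ->
  radial_derivative_real G N g (dil G s y) = derive1 (fun t => g (dil G t y)) s / N y.
Proof.
move=> y0 s0; have Ny := quasi_norm_gt0 hN y0.
rewrite /radial_derivative_real N_dil//.
have sN : 0 < s * N y by rewrite mulr_gt0.
have iG : is_derive s 1 (fun t => g (dil G t y)) (derive1 (fun t => g (dil G t y)) s).
  by apply: DeriveDef; [exact: derivable_comp_dil|rewrite derive1E].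
have iD : is_derive (s * N y) 1 (fun r : R => r / N y) (N y)^-1.
  apply: DeriveDef; first exact: (@derivableM _ _ id (cst (N y)^-1)).
  rewrite (@deriveM _ _ id (cst (N y)^-1))//= derive_cst derive_id.
  by rewrite /GRing.scale/= mulr0 mulr1 add0r.
rewrite -[X in is_derive X _ _ _](mulfK (lt0r_neq0 Ny)) in iG.
rewrite derive1E -(@derive_val _ _ _ _ _ _ _ (is_derive1_comp (f := fun t => g (dil G t y)) (g := fun r : R => r / N y) iG iD)).
apply: near_eq_derive; do ?exact: oner_neq0.
near=> r; rewrite /=; congr (g _).
have r0 : 0 < r by near: r; exact: lt_nbhsr.
have sNV : 0 < (s * N y)^-1 by rewrite invr_gt0.
rewrite (dilM G _ sNV s0) dilM ?mulr_gt0//; congr dil; congr (_ * _).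
by rewrite invfM mulrAC mulVf ?mul1r// lt0r_neq0.
Unshelve. all: by end_near.
Qed.

(** By [radial_derivative_dil] with [s = 1] the value at [x <> 0] is a derivative at time 1 along
    the orbit of [x], hence a limit of difference quotients that are measurable in [x]. *)
Lemma measurable_radial_derivative : measurable_fun setT (radial_derivative_real G N g : B -> R).
Proof.
apply: measurable_off0.
pose h (m : nat) (x : B) : R := m.+1%:R * (g (dil G (1 + m.+1%:R^-1) x) - g (dil G 1 x)) / N x.
apply: (@measurable_fun_cvg _ _ _ _ h) => [m|x /= x0].
  apply: measurable_funTS; apply: measurable_funM; last first.
    apply: (measurable_comp_quasi_norm (q := fun r => r^-1)).
    apply: measurable_pos_continuous => r r0; apply: inv_continuous; exact: lt0r_neq0.
  apply: measurable_funM; first exact: measurable_cst.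
  have mg (s : R) : measurable_fun setT (fun x : B => g (dil G s x)).
    apply: borel_continuous_measurable => y.
    by apply: continuous_comp; [exact: continuous_dil|exact: cg].
  exact: measurable_funB.
have -> : radial_derivative_real G N g x = derive1 (fun t => g (dil G t x)) 1 / N x.
  by rewrite -(radial_derivative_dil x0 ltr01) dil1.
have iG : is_derive (1 : R) 1 (fun t : R => g (dil G t x)) (derive1 (fun t => g (dil G t x)) 1).
  by apply: DeriveDef; [exact: derivable_comp_dil|rewrite derive1E].
exact: (cvgM (is_derive_quotient_cvg iG) (cvg_cst (N x)^-1)).
Qed.
End along_rays.
End radial.

(** * The inequality on the group, with positive and negative parts separated *)

Section hardy.
Variables (R : realType) (n : nat) (G : homogeneous_group R n).
Local Notation V := 'rV[R]_n.+1.
Local Notation B := (borel_space R n).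
Variable mu : {measure set B -> \bar R}.
Hypothesis hmu : haar_measure G mu.
Variable N : V -> R.
Hypothesis hN : quasi_norm G N.
Let Q := hom_dim G.
Hypothesis Q0 : 0 < Q.
Variables (p : R) (f : V -> R[i]).
Hypothesis p1 : 1 < p.
Hypothesis hf : C1_compact_support f.

Let lam := @lebesgue_measure R.
Let L0 := `]0, +oo[%classic : set (measurableTypeR R).
Let fr x := complex.Re (f x).
Let fi x := complex.Im (f x).
Let hfr : Ck 1 fr. Proof. by case: hf. Qed.
Let hfi : Ck 1 fi. Proof. by case: hf. Qed.
Let F x := ComplexField.Normc.normc (f x).
Let FE x : F x = Num.sqrt (fr x ^+ 2 + fi x ^+ 2). Proof. exact: normcE. Qed.
Let p0 : 0 < p. Proof. exact: lt_trans p1. Qed.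
Let N_dil s x : 0 < s -> N (dil G s x) = s * N x.
Proof. by case: hN => _ _ _ + _; apply. Qed.
Let cN : continuous N. Proof. by case: hN. Qed.
Let N_ge0 x : 0 <= N x. Proof. by case: hN. Qed.
Let F_ge0 x : 0 <= F x. Proof. by rewrite FE sqrtr_ge0. Qed.

Lemma continuous_normc_C1 : continuous F.
Proof.
rewrite (funext FE).
have c2 (g : V -> R) : continuous g -> continuous (fun x => g x ^+ 2).
  by move=> cg x; exact: (@continuousM _ _ g g x (cg x) (cg x)).
have cs : continuous (fun x => fr x ^+ 2 + fi x ^+ 2).
  move=> x; exact: (@continuousD _ _ _ (fun x => fr x ^+ 2) (fun x => fi x ^+ 2) x (c2 _ hfr.1 x) (c2 _ hfi.1 x)).
by move=> x; exact: (continuous_comp (cs x) (@sqrt_continuous R _)).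
Qed.

Let F_eq0 x : f x = 0 -> F x = 0.
Proof. by rewrite FE /fr /fi => -> /=; rewrite expr0n addr0 sqrtr0. Qed.

Let supp x : ~ closure [set x | f x != 0] x -> f x = 0.
Proof.
move=> h; apply: contrapT => fx; apply: h; apply: subset_closure => /=.
exact/eqP.
Qed.

Lemma normc_C1_bounded : exists2 C : R, 0 < C & forall x, F x <= C.
Proof.
have [_ _ cK] := hf; have [C C0 hC] := compact_bound cK continuous_normc_C1.
exists C => // x; have [Kx|Kx] := pselect (closure [set x | f x != 0] x).
  exact: le_trans (ler_norm _) (hC _ Kx).
by rewrite F_eq0 ?supp// ltW.
Qed.

Lemma normc_C1_supp : exists2 C : R, 0 < C & forall x, C < N x -> F x = 0.
Proof.
have [_ _ cK] := hf; have [C C0 hC] := compact_bound cK cN.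
exists C => // x CN; apply/F_eq0/supp => Kx.
by have := le_lt_trans (le_trans (ler_norm _) (hC _ Kx)) CN; rewrite ltxx.
Qed.

Lemma measurable_along_ray (H : B -> R) y : measurable_fun setT H ->
  measurable_fun L0 (fun s => H (dil G s y) * s `^ (Q - 1)).
Proof.
move=> mH; apply: measurable_funTS; apply: measurable_funM; last exact: measurable_powR.
apply/measurable_EFinP.
have mHE : measurable_fun setT (fun x : B => (H x)%:E) by exact/measurable_EFinP.
exact: (@measurableT_comp _ _ _ _ _ _ (fun z : B * measurableTypeR R => (H (dil G z.2 z.1))%:E)
  setT (pair (y : B)) (measurable_dil_pair G mHE) (pair1_measurable (y : B))).
Qed.

Definition hardy_lhs (psi : R -> R) x := psi (N x) / N x `^ (Q - 1) * F x `^ p.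
Definition hardy_grad x := ComplexField.Normc.normc (radial_derivative G N f x) `^ p.
Definition hardy_pot (phi : R -> R) x :=
  `|phi (N x)| `^ (p / (p - 1)) / N x `^ (p * (Q - 1) / (p - 1)) * F x `^ p.

Let measurable_Fp : measurable_fun setT (fun x : B => F x `^ p).
Proof. exact: (measurableT_comp (measurable_powR p) (borel_continuous_measurable continuous_normc_C1)). Qed.

Lemma measurable_hardy_grad : measurable_fun setT (hardy_grad : B -> R).
Proof.
rewrite /hardy_grad.
under eq_fun do rewrite normcE/=.
apply: (measurableT_comp (measurable_powR p)).
apply: (measurableT_comp (continuous_measurable_fun (@sqrt_continuous R))).
by apply: measurable_funD; apply: measurable_funX; exact: measurable_radial_derivative.
Qed.

Let measurable_pos_powRV r : measurable_fun L0 (fun s : R => (s `^ r)^-1).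
Proof.
rewrite (_ : (fun s => _) = fun s : R => s `^ (- r)); last by apply/funext => s; rewrite powRN.
by apply: measurable_funTS; exact: measurable_powR.
Qed.

Section weight.
Variables phi psi : R -> R.
Hypothesis hphi : forall r : R, 0 < r -> is_derive r 1 phi (psi r).

Lemma measurable_hardy_lhs : measurable_fun setT (hardy_lhs psi : B -> R).
Proof.
apply: measurable_funM => //.
apply: (measurable_comp_quasi_norm hN (q := fun r => psi r / r `^ (Q - 1))).
by apply: measurable_funM => //; exact: measurable_pos_derive hphi.
Qed.

Lemma measurable_hardy_pot : measurable_fun setT (hardy_pot phi : B -> R).
Proof.
apply: measurable_funM => //.
apply: (measurable_comp_quasi_norm hN
  (q := fun r => `|phi r| `^ (p / (p - 1)) / r `^ (p * (Q - 1) / (p - 1)))).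
apply: measurable_funM => //; apply: (measurableT_comp (measurable_powR _)).
apply: (measurableT_comp (@normr_measurable _ setT)).
apply: measurable_pos_continuous => r r0.
apply: differentiable_continuous; apply/derivable1_diffP.
exact: (@ex_derive _ _ _ _ _ _ _ (hphi r0)).
Qed.

Let ray_integralE (H : B -> R) y : (forall x, 0 <= H x) ->
  ray_integral G (fun x => (H x)%:E) y =
    (\int[lam]_(s in L0) (H (dil G s y) * s `^ (Q - 1))%:E)%E.
Proof. by move=> H0; rewrite /ray_integral; apply: eq_integral => s _; rewrite EFinM. Qed.

Let A := hardy_grad.
Let P := hardy_pot phi.
Let L := hardy_lhs psi.

Hypothesis h0 : [\/ p <= Q, f 0 = 0
  | forall e : R, 0 < e -> exists2 r : R, 0 < r < e & - e < phi r].

Let hardy_ray y : y <> 0 ->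
  (ray_integral G (fun x => (Num.max (L x) 0)%:E) y <=
   ray_integral G (fun x => (Num.max (- L x) 0)%:E) y
   + ray_integral G (fun x => (A x + (p - 1) * P x)%:E) y)%E.
Proof.
move=> y0; have Ny := quasi_norm_gt0 hN y0.
have A0 x : 0 <= A x by exact: powR_ge0.
have P0 x : 0 <= P x by rewrite mulr_ge0 ?powR_ge0// divr_ge0 ?powR_ge0.
have pm0 : 0 < p - 1 by rewrite subr_gt0.
rewrite !ray_integralE; last 3 first.
- by move=> x; rewrite addr_ge0// mulr_ge0// ltW.
- by move=> x; rewrite le_max lexx orbT.
- by move=> x; rewrite le_max lexx orbT.
pose a s := fr (dil G s y); pose b s := fi (dil G s y).
pose u s := Num.sqrt (a s ^+ 2 + b s ^+ 2).
have uF s : F (dil G s y) = u s by rewrite FE.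
pose l s := derive1 phi (s * N y) / (s * N y) `^ (Q - 1) * u s `^ p * s `^ (Q - 1).
pose w s := (Num.sqrt ((derive1 a s / N y) ^+ 2 + (derive1 b s / N y) ^+ 2) `^ p
  + (p - 1) * (`|phi (s * N y)| `^ (p / (p - 1))
  / (s * N y) `^ (p * (Q - 1) / (p - 1)) * u s `^ p)) * s `^ (Q - 1).
have LE s : L0 s -> 0 < s by rewrite /L0/= in_itv/= andbT.
have lE s : 0 < s -> L (dil G s y) * s `^ (Q - 1) = l s.
  move=> s0; rewrite /L /hardy_lhs uF N_dil// /l derive1E.
  by rewrite (@derive_val _ _ _ _ _ _ _ (hphi (mulr_gt0 s0 Ny))).
have wE s : 0 < s -> (A (dil G s y) + (p - 1) * P (dil G s y)) * s `^ (Q - 1) = w s.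
  move=> s0; rewrite /A /P /hardy_grad /hardy_pot normcE /= uF N_dil//.
  by rewrite !radial_derivative_dil.
have maxE (s x : R) : Num.max x 0 * s `^ (Q - 1) = Num.max (x * s `^ (Q - 1)) 0.
  by rewrite maxr_pMl ?powR_ge0// mul0r.
have -> : (\int[lam]_(s in L0) (Num.max (L (dil G s y)) 0 * s `^ (Q - 1))%:E =
    \int[lam]_(s in L0) (Num.max (l s) 0)%:E)%E.
  by apply: eq_integral => s /[1!inE] /LE s0; rewrite maxE lE.
have -> : (\int[lam]_(s in L0) (Num.max (- L (dil G s y)) 0 * s `^ (Q - 1))%:E =
    \int[lam]_(s in L0) (Num.max (- l s) 0)%:E)%E.
  by apply: eq_integral => s /[1!inE] /LE s0; rewrite maxE mulNr lE.
have -> : (\int[lam]_(s in L0) ((A (dil G s y) + (p - 1) * P (dil G s y)) * s `^ (Q - 1))%:E =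
    \int[lam]_(s in L0) (w s)%:E)%E.
  by apply: eq_integral => s /[1!inE] /LE s0; rewrite wE.
have [U U0 hU] := normc_C1_bounded; have [C C0 hC] := normc_C1_supp.
have dphi r : 0 < r -> derivable phi r 1.
  by move=> r0; exact: (@ex_derive _ _ _ _ _ _ _ (hphi r0)).
have da s : 0 < s -> derivable a s 1 by exact: derivable_comp_dil.
have db s : 0 < s -> derivable b s 1 by exact: derivable_comp_dil.
have uM s : (C + 1) / N y <= s -> u s = 0.
  move=> Cs; have s0 : 0 < s by rewrite (lt_le_trans _ Cs)// divr_gt0// addr_gt0.
  rewrite -uF hC// N_dil// (@lt_le_trans _ _ (C + 1)) ?ltrDl//.
  by rewrite -ler_pdivrMr.
have uV s : 0 < s -> u s <= U by move=> _; rewrite -uF.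
have u_near0 (e : R) : 0 < e -> exists2 r : R, 0 < r & forall s : R, 0 < s < r -> `|u s - F 0| < e.
  move=> e0; have c0 : F x @[x --> (0 : V)] --> F 0 by exact: continuous_normc_C1.
  have := (cvgrPdist_lt F (F 0)).1 c0 _ e0.
  move=> /(_ _) /nbhs_ballP[d /= d0 hd].
  have [r r0 hr] := dil_near0 G y d0.
  exists r => // s /hr sd; rewrite -uF distrC; apply: hd.
  by rewrite -ball_normE /ball_/= sub0r normrN.
have h0' : [\/ p <= Q, F 0 = 0
  | forall e : R, 0 < e -> exists2 r : R, 0 < r < e & - e < phi r].
  by case: h0 => [?|/F_eq0 ?|?]; [exact: Or31|exact: Or32|exact: Or33].
have ml : measurable_fun L0 l.
  apply: eq_measurable_fun (measurable_along_ray y measurable_hardy_lhs).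
  by move=> s /[1!inE] /LE s0; rewrite -lE.
have mw : measurable_fun L0 w.
  apply: (@eq_measurable_fun _ _ _ _ _ (fun s => (A (dil G s y) + (p - 1) * P (dil G s y)) * s `^ (Q - 1))).
    by move=> s /[1!inE] /LE s0; rewrite wE.
  apply: (@measurable_along_ray (fun x => A x + (p - 1) * P x)).
  apply: measurable_funD; first exact: measurable_hardy_grad.
  by apply: measurable_funM; [exact: measurable_cst|exact: measurable_hardy_pot].
exact: (ray_inequality p1 Ny dphi da db uM uV U0 u_near0 h0' ml mw).
Qed.

(** All integrals are multiplied by [ln 2] and written in polar form; the inequality on rays is then
    integrated over the annulus, which does not contain the origin. *)
Lemma hardy_split :
  (\int[mu]_x (Num.max (L x) 0)%:E <= \int[mu]_x (Num.max (- L x) 0)%:E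
    + (\int[mu]_x (A x)%:E + (p - 1)%:E * \int[mu]_x (P x)%:E))%E.
Proof.
have pm0 : 0 < p - 1 by rewrite subr_gt0.
have mL : measurable_fun setT (L : B -> R) by exact: measurable_hardy_lhs.
have mA : measurable_fun setT (A : B -> R) by exact: measurable_hardy_grad.
have mP : measurable_fun setT (P : B -> R) by exact: measurable_hardy_pot.
have A0 x : 0 <= A x by exact: powR_ge0.
have P0 x : 0 <= P x by rewrite mulr_ge0 ?powR_ge0// divr_ge0 ?powR_ge0.
pose W x : R := A x + (p - 1) * P x.
have W0 x : 0 <= W x by rewrite addr_ge0// mulr_ge0// ltW.
have mW : measurable_fun setT (W : B -> R).
  by apply: measurable_funD => //; apply: measurable_funM => //; exact: measurable_cst.
have -> : (\int[mu]_x (A x)%:E + (p - 1)%:E * \int[mu]_x (P x)%:E = \int[mu]_x (W x)%:E)%E.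
  rewrite -ge0_integralZl//; first last.
  - by rewrite lee_fin ltW.
  - by move=> x _; rewrite lee_fin.
  - exact/measurable_EFinP.
  rewrite -ge0_integralD//.
  - by move=> x _; rewrite lee_fin.
  - exact/measurable_EFinP.
  - by move=> x _; rewrite -EFinM lee_fin mulr_ge0// ltW.
  - by apply: measurable_funeM; exact/measurable_EFinP.
have mpos (H : B -> R) : measurable_fun setT H -> measurable_fun setT (fun x => (Num.max (H x) 0)%:E).
  by move=> mH; apply/measurable_EFinP; apply: measurable_maxr => //; exact: measurable_cst.
have mLp := mpos _ mL.
have mLm : measurable_fun setT (fun x : B => (Num.max (- L x) 0)%:E).
  by apply: (mpos (fun x => - L x)); exact: (@measurableT_comp _ _ _ _ _ _ (@GRing.opp R)).
have mWE : measurable_fun setT (fun x : B => (W x)%:E) by exact/measurable_EFinP.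
have pos0 (H : B -> R) x : (0 <= (Num.max (H x) 0)%:E)%E by rewrite lee_fin le_max lexx orbT.
have pos0L := pos0 L; have pos0M := pos0 (fun x => - L x).
have W0E x : (0 <= (W x)%:E)%E by rewrite lee_fin.
have l2 : 0 < ln 2 :> R by rewrite ln_gt0// ltr1n.
rewrite -(@lee_pmul2l _ (ln 2)%:E)// ?lte_fin// [X in (_ <= X)%E]ge0_muleDr; last 2 first.
- by apply: integral_ge0.
- by apply: integral_ge0.
rewrite !(polar_coordinates hmu hN Q0)//.
rewrite -ge0_integralD; first last.
- by apply: measurable_funTS; exact: measurable_ray_integral.
- by move=> x _; exact: ray_integral_ge0.
- by apply: measurable_funTS; exact: measurable_ray_integral.
- by move=> x _; exact: ray_integral_ge0.
- exact: (measurable_annulus hN).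
apply: ge0_le_integral.
- exact: (measurable_annulus hN).
- by move=> x _; exact: ray_integral_ge0.
- by apply: measurable_funTS; exact: measurable_ray_integral.
- apply: emeasurable_funD; apply: measurable_funTS; exact: measurable_ray_integral.
move=> y; rewrite /annulus/= => /andP[Ny _]; apply: hardy_ray => y0.
by move: Ny; rewrite y0; have [_ _ _ _ /(_ 0)[_ ->]//] := hN; rewrite ler10.
Qed.
End weight.
End hardy.

(** * Optimising over multiples of the weight *)

Lemma le_optimal_scale (R : realType) (p a b D : R) : 1 < p -> 0 <= a -> 0 <= b ->
  (forall c : R, 0 < c -> c * D <= a + (p - 1) * (c `^ (p / (p - 1)) * b)) ->
  D <= p * a `^ (p^-1) * b `^ ((p - 1) / p).
Proof.
move=> p1 a0 b0 h.
have p0 : 0 < p by exact: lt_trans p1.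
have pm0 : 0 < p - 1 by rewrite subr_gt0.
have rhs0 : 0 <= p * a `^ (p^-1) * b `^ ((p - 1) / p).
  by rewrite !mulr_ge0 ?powR_ge0// ltW.
have [D0|D0] := leP D 0; first exact: le_trans D0 rhs0.
(* For [a = 0], dividing by [c] leaves [D <= (p - 1) * c^(1 / (p - 1)) * b], false for small [c] if
   [D > 0]; [b + 1] keeps the chosen threshold meaningful when [b = 0]. *)
have [a00|an0] := eqVneq a 0.
  have k0 : 0 < (p - 1)^-1 by rewrite invr_gt0.
  have k1 : 0 < (p - 1) * (b + 1) by rewrite mulr_gt0// ltr_wpDl.
  have e0 := divr_gt0 D0 k1.
  have [d d0 hd] := powR_near0 k0 e0.
  have d2 : 0 < d / 2 < d by rewrite divr_gt0//= ltr_pdivrMr// ltr_pMr// ltr1n.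
  case/andP: d2 => d20 d2; have := hd _ (introT andP (conj (ltW d20) d2)).
  rewrite ltr_pdivlMr// => hlt.
  have := h _ d20; rewrite a00 add0r.
  have -> : p / (p - 1) = 1 + (p - 1)^-1 by field; rewrite gt_eqF.
  rewrite powRD; last by rewrite (gt_eqF d20) implybT.
  rewrite powRr1 ?(ltW d20)//.
  have -> : (p - 1) * (d / 2 * (d / 2) `^ (p - 1)^-1 * b) =
     d / 2 * ((d / 2) `^ (p - 1)^-1 * ((p - 1) * b)) by ring.
  rewrite ler_pM2l// leNgt => /negP; case; apply: le_lt_trans hlt.
  by rewrite ler_wpM2l ?powR_ge0// ler_pM2l// lerDl.
have ap : 0 < a by rewrite lt_neqAle eq_sym an0.
(* For [b = 0] large [c] is contradictory: [c = (a + 1) / D] gives [a + 1 <= a]. *)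
have [b00|bn0] := eqVneq b 0.
  have c0 : 0 < (a + 1) / D by rewrite divr_gt0// addr_gt0.
  have := h _ c0; rewrite b00 !mulr0 addr0 divfK ?gt_eqF//.
  by rewrite gerDl ler10.
have bp : 0 < b by rewrite lt_neqAle eq_sym bn0.
(* The optimal scale is [c = (a / b)^((p - 1) / p)], where [c^(p / (p - 1)) * b = a] and the bound
   becomes [p * a]. *)
pose r := (p - 1) / p; have r0 : 0 < r by exact: divr_gt0.
have c0 : 0 < (a / b) `^ r by rewrite powR_gt0// divr_gt0.
have := h _ c0; rewrite -powRrM.
have -> : r * (p / (p - 1)) = 1 by rewrite /r; field; rewrite !gt_eqF.
rewrite powRr1 ?divr_ge0// divfK// => hD.
have {}hD : (a / b) `^ r * D <= p * a by move: hD; lra.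
rewrite -(ler_pM2l c0); apply: (le_trans hD).
rewrite powRM ?invr_ge0// powRVl// -/r.
have -> : a `^ r / b `^ r * (p * a `^ p^-1 * b `^ r) = p * (a `^ r * a `^ p^-1).
  by field; rewrite gt_eqF// powR_gt0.
rewrite -powRD; last by rewrite (gt_eqF ap) implybT.
have -> : r + p^-1 = 1 by rewrite /r; field; rewrite gt_eqF.
by rewrite powRr1.
Qed.

(** If [b = +oo] the difference is [-oo] by convention, even when [a = +oo]. *)
Lemma lee_sub_of_split (R : realType) (a b c : \bar R) :
  (0 <= a -> 0 <= b -> a <= b + c -> a - b <= c)%E.
Proof.
move=> a0; case: b => [b| |]// b0.
  by move=> h; rewrite leeBlDl.
by move=> _; rewrite addeNy leNye.
Qed.

(** * The additive and the product inequality *)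

Section conclusion.
Variables (R : realType) (n : nat) (G : homogeneous_group R n).
Local Notation V := 'rV[R]_n.+1.
Local Notation B := (borel_space R n).
Variable mu : {measure set B -> \bar R}.
Hypothesis hmu : haar_measure G mu.
Variable N : V -> R.
Hypothesis hN : quasi_norm G N.
Let Q := hom_dim G.
Hypothesis Q0 : 0 < Q.
Variables (p : R) (f : V -> R[i]).
Hypothesis p1 : 1 < p.
Hypothesis hf : C1_compact_support f.
Let F x := ComplexField.Normc.normc (f x).
Let A := hardy_grad G N p f.
Let P := hardy_pot G N p f.
Let L := hardy_lhs G N p f.
Let p0 : 0 < p. Proof. exact: lt_trans p1. Qed.
Let pm0 : 0 < p - 1. Proof. by rewrite subr_gt0. Qed.
Let cF : continuous F := continuous_normc_C1 hf.
Let F_ge0 x : 0 <= F x. Proof. by rewrite /F normcE sqrtr_ge0. Qed.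
Let cN : continuous N. Proof. by case: hN. Qed.
Let A_ge0 x : 0 <= A x. Proof. exact: powR_ge0. Qed.
Let P_ge0 phi x : 0 <= P phi x.
Proof. by rewrite mulr_ge0 ?powR_ge0// divr_ge0 ?powR_ge0. Qed.
Let intA_ge0 : (0 <= \int[mu]_x (A x)%:E)%E.
Proof. by apply: integral_ge0 => x _; rewrite lee_fin. Qed.
Let intP_ge0 phi : (0 <= \int[mu]_x (P phi x)%:E)%E.
Proof. by apply: integral_ge0 => x _; rewrite lee_fin. Qed.
Let mpos (H : B -> R) : measurable_fun setT H ->
  measurable_fun setT (fun x => (Num.max (H x) 0)%:E).
Proof. by move=> mH; apply/measurable_EFinP; apply: measurable_maxr => //; exact: measurable_cst. Qed.
Let mneg (H : B -> R) : measurable_fun setT H ->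
  measurable_fun setT (fun x => (Num.max (- H x) 0)%:E).
Proof.
by move=> mH; apply: (mpos (H := fun x => - H x)); exact: (@measurableT_comp _ _ _ _ _ _ (@GRing.opp R)).
Qed.
Let pos_ge0 (H : B -> R) : (0 <= \int[mu]_x (Num.max (H x) 0)%:E)%E.
Proof. by apply: integral_ge0 => x _; rewrite lee_fin le_max lexx orbT. Qed.

Let integral_split (H : B -> R) :
  (\int[mu]_x (H x)%:E = \int[mu]_x (Num.max (H x) 0)%:E - \int[mu]_x (Num.max (- H x) 0)%:E)%E.
Proof.
rewrite integralE; congr (_ - _)%E; apply: eq_integral => x _.
  by rewrite funeposE EFin_max.
by rewrite funenegE EFin_max.
Qed.

Let integral0_off0 (H : B -> R) : (forall x : V, x <> 0 -> H x = 0) ->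
  measurable_fun setT H -> (forall x, 0 <= H x) -> (\int[mu]_x (H x)%:E = 0)%E.
Proof.
move=> H0 mH Hge.
rewrite -(integral0 mu setT); apply: ge0_ae_eq_integral => //.
- exact/measurable_EFinP.
- by move=> x _; rewrite lee_fin.
exists [set (0 : V)]; split.
- by apply: borel_closed; apply: accessible_closed_set1; exact: hausdorff_accessible (@norm_hausdorff _ _).
- exact: (haar_set0 hmu Q0).
by move=> x /= h; apply: contrapT => x0; apply: h => _; rewrite H0.
Qed.

(** Such an open set is contained in a null set, but nonempty open sets have positive Haar
    measure. *)
Let integral0_open (H : B -> R) (U : set V) : measurable_fun setT H ->
  (forall x, 0 <= H x) -> (\int[mu]_x (H x)%:E = 0)%E -> open U ->
  (forall x, U x -> 0 < H x) -> forall x, ~ U x.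
Proof.
move=> mH Hge H0 oU HU x Ux.
have mHE : measurable_fun setT (fun x : B => (H x)%:E) by exact/measurable_EFinP.
have : (\int[mu]_x `|(H x)%:E| = 0)%E.
  by rewrite -H0; apply: eq_integral => y _; rewrite gee0_abs// lee_fin.
move/(ae_eq_integral_abs mu measurableT mHE).1 => [Z [mZ Z0 hZ]].
have UZ : U `<=` Z.
  by move=> y Uy; apply: hZ => /= /(_ I) []; apply/eqP; rewrite gt_eqF// HU.
have : (0 < mu U)%E.
  by apply: (haar_open_gt0 (haar_left_invariant hmu)) => //; [case: hmu|exists x].
rewrite ltNge -Z0 => /negP; apply; apply: le_measure => //; rewrite inE//.
exact: borel_open.
Qed.

Let open_comp_N (q : R -> R) : (forall r, 0 < r -> {for r, continuous q}) ->
  open [set x : V | x <> 0 /\ q (N x) * F x != 0].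
Proof.
move=> cq; rewrite openE => x /= [x0 qx]; rewrite /interior.
have Nx := quasi_norm_gt0 hN x0.
have cqF : {for x, continuous (fun x => q (N x) * F x)}.
  have cqN : {for x, continuous (fun x => q (N x))}.
    by apply: (@continuous_comp _ _ _ N q); [exact: cN|exact: cq].
  exact: (@continuousM _ _ (fun x => q (N x)) F x cqN (cF (x := x))).
have h1 : \forall y \near x, q (N y) * F y != 0 := cvgr_neq0 _ cqF qx.
have cNx : N y @[y --> x] --> N x by exact: cN.
have h2 : \forall y \near x, 0 < N y := cvgr_gt _ cNx _ Nx.
apply: filterS2 (h1 _) (h2 _) => y {}h1 {}h2; split => // y0.
by move: h2; rewrite y0; have [_ _ _ _ /(_ 0)[_ ->]//] := hN; rewrite ltxx.
Qed.

(* [psi] is the derivative of [phi] on the positive reals; it is kept separate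
   because [derive1 (c * phi)] and [c * derive1 phi] may differ at [r <= 0]. *)
Section weight.
Variables phi psi : R -> R.
Hypothesis hphi : forall r : R, 0 < r -> is_derive r 1 phi (psi r).
Hypothesis h0 : [\/ p <= Q, f 0 = 0
  | forall e : R, 0 < e -> exists2 r : R, 0 < r < e & - e < phi r].

Let mL : measurable_fun setT (L psi : B -> R).
Proof. exact: measurable_hardy_lhs hphi. Qed.
Let mP : measurable_fun setT (P phi : B -> R).
Proof. exact: measurable_hardy_pot hphi. Qed.

Lemma hardy_additive : (\int[mu]_x (L psi x)%:E <=
  \int[mu]_x (A x)%:E + (p - 1)%:E * \int[mu]_x (P phi x)%:E)%E.
Proof.
rewrite integral_split; apply: lee_sub_of_split => //.
exact: (hardy_split hmu hN Q0 p1 hf hphi h0).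
Qed.

(** Replacing [phi] by [c * phi] multiplies the left-hand side by [c] and the potential by
    [c^(p / (p - 1))], leaves the gradient term alone and preserves the condition at the origin. *)
Let hardy_scaled (c : R) : 0 < c ->
  (c%:E * \int[mu]_x (Num.max (L psi x) 0)%:E <=
   c%:E * \int[mu]_x (Num.max (- L psi x) 0)%:E + (\int[mu]_x (A x)%:E
   + (p - 1)%:E * ((c `^ (p / (p - 1)))%:E * \int[mu]_x (P phi x)%:E)))%E.
Proof.
move=> c0.
have hc (r : R) : 0 < r -> is_derive r 1 (fun r => c * phi r) (c * psi r).
  by move=> r0; exact: (is_deriveZ c (hphi r0)).
have hc0 : [\/ p <= Q, f 0 = 0
    | forall e : R, 0 < e -> exists2 r : R, 0 < r < e & - e < c * phi r].
  case: h0 => [?|?|h]; [exact: Or31|exact: Or32|apply: Or33 => e e0].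
  have m0 : 0 < Num.min e (e / c) by rewrite lt_min e0 divr_gt0.
  have [r /andP[r0 re] hr] := h _ m0; exists r.
    by rewrite r0 (lt_le_trans re)// ge_min lexx.
  rewrite mulrC -ltr_pdivrMr// mulNr (le_lt_trans _ hr)// lerN2.
  by rewrite ge_min lexx orbT.
have := hardy_split hmu hN Q0 p1 hf hc hc0.
have Lc x : hardy_lhs G N p f (fun r => c * psi r) x = c * L psi x.
  by rewrite /L /hardy_lhs !mulrA.
have Pc x : hardy_pot G N p f (fun r => c * phi r) x = c `^ (p / (p - 1)) * P phi x.
  by rewrite /P /hardy_pot normrM powRM// (gtr0_norm c0) !mulrA.
have maxc (x : R) : Num.max (c * x) 0 = c * Num.max x 0.
  by rewrite maxr_pMr ?(ltW c0)// mulr0.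
have -> : (\int[mu]_x (Num.max (hardy_lhs G N p f (fun r => c * psi r) x) 0)%:E =
    c%:E * \int[mu]_x (Num.max (L psi x) 0)%:E)%E.
  rewrite -ge0_integralZl ?lee_fin ?(ltW c0)//; [|exact: mpos|by move=> x _; rewrite lee_fin le_max lexx orbT].
  by apply: eq_integral => x _; rewrite Lc maxc EFinM.
have -> : (\int[mu]_x (Num.max (- hardy_lhs G N p f (fun r => c * psi r) x) 0)%:E =
    c%:E * \int[mu]_x (Num.max (- L psi x) 0)%:E)%E.
  rewrite -ge0_integralZl ?lee_fin ?(ltW c0)//; [|exact: mneg|by move=> x _; rewrite lee_fin le_max lexx orbT].
  by apply: eq_integral => x _; rewrite Lc -mulrN maxc EFinM.
have -> : (\int[mu]_x (hardy_pot G N p f (fun r => c * phi r) x)%:E =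
    (c `^ (p / (p - 1)))%:E * \int[mu]_x (P phi x)%:E)%E.
  rewrite -ge0_integralZl ?lee_fin ?powR_ge0//; [|exact/measurable_EFinP|by move=> x _; rewrite lee_fin].
  by apply: eq_integral => x _; rewrite Pc EFinM.
by [].
Qed.

Let rhs := (p%:E * (\int[mu]_x (A x)%:E) `^ (p^-1)
  * (\int[mu]_x (P phi x)%:E) `^ ((p - 1) / p))%E.

Let rhs_ge0 : (0 <= rhs)%E.
Proof. by rewrite !mule_ge0 ?poweR_ge0// lee_fin ltW. Qed.

(** If the negative part is finite, the scaled inequality at [c = 1] makes the positive part finite
    too, so all four integrals are real numbers and [le_optimal_scale] applies. *)
Lemma hardy_multiplicative_fin : (\int[mu]_x (A x)%:E < +oo)%E ->
  (\int[mu]_x (P phi x)%:E < +oo)%E ->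
  (\int[mu]_x (Num.max (L psi x) 0)%:E - \int[mu]_x (Num.max (- L psi x) 0)%:E <= rhs)%E.
Proof.
move=> Afin Pfin.
have [Mfin|] := ltP (\int[mu]_x (Num.max (- L psi x) 0)%:E)%E +oo%E; last first.
  by rewrite leye_eq => /eqP ->; rewrite addeNy leNye.
have Lfin : (\int[mu]_x (Num.max (L psi x) 0)%:E < +oo)%E.
  have := hardy_scaled ltr01; rewrite !mul1e powR1 mul1e => /le_lt_trans; apply.
  rewrite lte_add_pinfty// lte_add_pinfty//; apply: lte_mul_pinfty => //.
  by rewrite lee_fin ltW.
have fA : (\int[mu]_x (A x)%:E)%E \is a fin_num by rewrite ge0_fin_numE.
have fP : (\int[mu]_x (P phi x)%:E)%E \is a fin_num by rewrite ge0_fin_numE.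
have fM : (\int[mu]_x (Num.max (- L psi x) 0)%:E)%E \is a fin_num by rewrite ge0_fin_numE.
have fL : (\int[mu]_x (Num.max (L psi x) 0)%:E)%E \is a fin_num by rewrite ge0_fin_numE.
have h c := @hardy_scaled c.
rewrite /rhs; move: intA_ge0 (intP_ge0 phi) h.
rewrite -(fineK fA) -(fineK fP) -(fineK fM) -(fineK fL).
set a := fine _; set b := fine _; set m := fine _; set l := fine _.
rewrite !lee_fin => a0 b0 h.
apply: le_optimal_scale => // c c0.
by have := h c c0; rewrite -!EFinM -!EFinD lee_fin; lra.
Qed.

Let hardy_multiplicative_lhs0 : (\int[mu]_x (Num.max (L psi x) 0)%:E = 0 ->
  \int[mu]_x (L psi x)%:E <= rhs)%E.
Proof.
move=> h; rewrite integral_split h add0e; apply: le_trans rhs_ge0.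
by rewrite oppe_le0.
Qed.

Lemma hardy_multiplicative_off0 : (forall x, x <> 0 -> L psi x = 0) ->
  (\int[mu]_x (L psi x)%:E <= rhs)%E.
Proof.
move=> h; apply: hardy_multiplicative_lhs0; apply: integral0_off0.
- by move=> x x0; rewrite h// maxxx.
- by apply: measurable_maxr => //; exact: measurable_cst.
- by move=> x; rewrite le_max lexx orbT.
Qed.

(** By continuity [phi (N y) * F y] vanishes at every [y <> 0]. Where [F x <> 0] it does not vanish
    nearby on the orbit of [x], so [phi] is 0 near [N x] and its derivative there is 0; hence the
    left integrand vanishes off the origin. *)
Lemma hardy_multiplicative_pot0 : (\int[mu]_x (P phi x)%:E = 0)%E ->
  (\int[mu]_x (L psi x)%:E <= rhs)%E.
Proof.
move=> hP; apply: hardy_multiplicative_off0 => x x0; have Nx := quasi_norm_gt0 hN x0.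
have cphi r : 0 < r -> {for r, continuous phi}.
  move=> r0; apply: differentiable_continuous; apply/derivable1_diffP.
  exact: (@ex_derive _ _ _ _ _ _ _ (hphi r0)).
have key y : y <> 0 -> phi (N y) * F y = 0.
  move=> y0; apply: contrapT => /eqP h.
  apply: (integral0_open mP (P_ge0 phi) hP (open_comp_N cphi) _ (conj y0 h)).
  move=> z [z0]; rewrite mulf_eq0 negb_or => /andP[hz Fz].
  have Nz := quasi_norm_gt0 hN z0.
  rewrite /P /hardy_pot mulr_gt0 ?divr_gt0 ?powR_gt0 ?normr_gt0//.
  by rewrite lt_neqAle eq_sym Fz F_ge0.
have [Fx|Fx] := eqVneq (F x) 0.
  by rewrite /L /hardy_lhs -/(F x) Fx powR0 ?mulr0// gt_eqF.
suff -> : L psi x = psi (N x) * (F x `^ p / N x `^ (Q - 1)).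
  have iphi : is_derive (1 : R) 1 (fun s : R => phi (s * N x)) (psi (N x) * N x).
    have is1 : is_derive (1 : R) 1 (fun s : R => s * N x) (N x).
      apply: DeriveDef; first exact: (@derivableM _ _ id (cst (N x))).
      rewrite (@deriveM _ _ id (cst (N x)))//= derive_cst derive_id.
      by rewrite /GRing.scale/= mulr0 mulr1 add0r.
    have := hphi Nx; rewrite -{1}[N x]mul1r => ip.
    exact: (is_derive1_comp (f := phi) (g := fun s : R => s * N x) ip is1).
  suff : psi (N x) * N x = 0.
    by move=> /eqP; rewrite mulf_eq0 (gt_eqF Nx) orbF => /eqP ->; rewrite mul0r.
  rewrite -(@derive_val _ _ _ _ _ _ _ iphi).
  rewrite (@near_eq_derive _ _ _ _ (cst 0)) ?derive_cst//.
  have cs : {for (1 : R), continuous (fun s => F (dil G s x))}.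
    apply: (@continuous_comp _ _ _ (fun s => dil G s x) F); last exact: cF.
    apply: differentiable_continuous; apply/derivable1_diffP.
    exact: derivable_dil.
  have Fx1 : F (dil G 1 x) != 0 by rewrite dil1.
  have h1 : \forall s \near (1 : R), F (dil G s x) != 0 := cvgr_neq0 _ cs Fx1.
  have h2 : \forall s \near (1 : R), 0 < s := lt_nbhsr ltr01.
  apply: filterS2 (h1 _) h2 => s Fs s0 /=.
  have [_ _ _ Ndil _] := hN; rewrite -Ndil//.
  have sx0 : dil G s x <> 0.
    by move=> h; move: x0; rewrite -(dilK G s0 x) h dil0.
  by have /eqP := key _ sx0; rewrite mulf_eq0 (negPf Fs) orbF => /eqP.
by rewrite /L /hardy_lhs -/(F x) mulrAC mulrA.
Qed.

End weight.

(* When the gradient term vanishes, the weight [r^Q], whose potential term is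
   finite, gives [Q * \int |f|^p <= 0]. *)
Let hardy_grad_eq0 : (\int[mu]_x (A x)%:E = 0)%E -> forall x, x <> 0 -> F x = 0.
Proof.
move=> hA.
pose phi0 (r : R) := r `^ Q; pose psi0 (r : R) := Q * r `^ (Q - 1).
have h (r : R) : 0 < r -> is_derive r 1 phi0 (psi0 r) by exact: is_derive1_powR.
have h0 : [\/ p <= Q, f 0 = 0
    | forall e : R, 0 < e -> exists2 r : R, 0 < r < e & - e < phi0 r].
  apply: Or33 => e e0; exists (e / 2).
    by rewrite divr_gt0//= ltr_pdivrMr// ltr_pMr// ltr1n.
  by rewrite (@lt_le_trans _ _ 0) ?oppr_lt0// powR_ge0.
have Pfin : (\int[mu]_x (P phi0 x)%:E < +oo)%E.
  have [_ _ cK] := hf; set K := closure _ in cK.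
  have mK : measurable (K : set B) by exact: borel_compact.
  have [C C0 hC] := compact_bound cK cN.
  have [U U0 hU] := normc_C1_bounded hf.
  pose q := p / (p - 1); have q0 : 0 < q by exact: divr_gt0.
  pose c := C `^ q * U `^ p; have c0 : 0 <= c by rewrite mulr_ge0 ?powR_ge0.
  apply: (@le_lt_trans _ _ (\int[mu]_x (c%:E * (\1_K x : R)%:E))%E).
    apply: ge0_le_integral => //.
    - by move=> x _; rewrite lee_fin.
    - by apply/measurable_EFinP; exact: measurable_hardy_pot h.
    - by apply: measurable_funeM; exact: measurable_indicE.
    move=> x _; rewrite -EFinM lee_fin indicE.
    have [Kx|Kx] := boolP (x \in K); last first.
      rewrite mulr0 /P /hardy_pot -/(F x).
      suff -> : F x = 0 by rewrite powR0 ?mulr0// gt_eqF.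
      have fx : f x = 0.
        apply: contrapT => fx; move/negP: Kx; apply; rewrite inE.
        by apply: subset_closure => /=; exact/eqP.
      by rewrite /F fx normcE /= expr0n addr0 sqrtr0.
    rewrite mulr1 /P /hardy_pot -/(F x) -/q.
    have [x0|x0] := eqVneq (N x) 0.
      rewrite x0 /phi0 (powR0 (lt0r_neq0 Q0)) normr0 (powR0 (lt0r_neq0 q0)).
      by rewrite !mul0r.
    have Nx : 0 < N x by rewrite lt_neqAle eq_sym x0; case: hN => _ ->.
    (* For the weight [r^Q] the exponents combine to [q * Q - q * (Q - 1) = q > 0], so the potential
       integrand is bounded on the support of [f]. *)
    have -> : `|phi0 (N x)| `^ q / N x `^ (p * (Q - 1) / (p - 1)) = N x `^ q.
      rewrite /phi0 ger0_norm ?powR_ge0// -powRrM -powRB; last by rewrite (gt_eqF Nx) implybT.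
      by congr powR; rewrite /q; field; rewrite gt_eqF.
    rewrite ler_pM ?powR_ge0//.
      apply: (ge0_ler_powR (ltW q0)); rewrite ?nnegrE ?(ltW Nx) ?(ltW C0)//.
      by apply: le_trans (ler_norm _) (hC _ _); move: Kx; rewrite inE.
    by apply: (ge0_ler_powR (ltW p0)); rewrite ?nnegrE ?F_ge0 ?(ltW U0)//; exact: hU.
  rewrite ge0_integralZl//; last exact: measurable_indicE.
  rewrite integral_indic// setIT; apply: lte_mul_pinfty => //.
  by case: hmu => _ + _; apply.
have L0 x : 0 <= L psi0 x.
  by rewrite /L /hardy_lhs mulr_ge0 ?powR_ge0// divr_ge0 ?powR_ge0// mulr_ge0 ?powR_ge0// ltW.
have Afin : (\int[mu]_x (A x)%:E < +oo)%E by rewrite hA.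
have := hardy_multiplicative_fin h h0 Afin Pfin.
rewrite hA poweR0r ?invr_eq0 ?gt_eqF// mule0 mul0e.
have -> : (\int[mu]_x (Num.max (- L psi0 x) 0)%:E = 0)%E.
  by apply: integral0_eq => x _; rewrite max_r// oppr_le0.
rewrite sube0 => hle.
have mL0 : measurable_fun setT (L psi0 : B -> R) by exact: measurable_hardy_lhs h.
have L00 : (\int[mu]_x (L psi0 x)%:E = 0)%E.
  apply/eqP; rewrite eq_le integral_ge0 ?andbT; last by move=> x _; rewrite lee_fin.
  apply: le_trans hle; under [leRHS]eq_integral do rewrite max_l//.
  by [].
move=> x x0; apply: contrapT => /eqP Fx.
have cst1 (r : R) : 0 < r -> {for r, continuous (fun=> 1 : R)} by move=> _; exact: cst_continuous.
suff Lpos y : y <> 0 /\ 1 * F y != 0 -> 0 < L psi0 y.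
  by apply: (integral0_open mL0 L0 L00 (open_comp_N cst1) Lpos (conj x0 _)); rewrite mul1r.
rewrite mul1r => -[y0 Fy]; have Ny := quasi_norm_gt0 hN y0.
rewrite /L /hardy_lhs -/(F y) mulr_gt0 ?divr_gt0 ?mulr_gt0 ?powR_gt0//.
by rewrite lt_neqAle eq_sym Fy F_ge0.
Qed.

(** A vanishing factor is treated first, because the product may then be [0 * +oo = 0]. If both
    factors are positive and one is infinite, the right-hand side is [+oo]; otherwise the finite
    case applies. *)
Lemma hardy_multiplicative phi psi :
  (forall r : R, 0 < r -> is_derive r 1 phi (psi r)) ->
  [\/ p <= Q, f 0 = 0
    | forall e : R, 0 < e -> exists2 r : R, 0 < r < e & - e < phi r] ->
  (\int[mu]_x (L psi x)%:E <= p%:E * (\int[mu]_x (A x)%:E) `^ (p^-1)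
    * (\int[mu]_x (P phi x)%:E) `^ ((p - 1) / p))%E.
Proof.
move=> hphi h0.
have pV0 : p^-1 != 0 by rewrite invr_eq0 gt_eqF.
have r0 : (p - 1) / p != 0 by rewrite gt_eqF// divr_gt0.
have [A0|A0] := eqVneq (\int[mu]_x (A x)%:E)%E 0%E.
  apply: (hardy_multiplicative_off0 hphi) => x x0; rewrite /L /hardy_lhs -/(F x).
  by rewrite hardy_grad_eq0// powR0 ?mulr0// gt_eqF.
have [P0|P0] := eqVneq (\int[mu]_x (P phi x)%:E)%E 0%E.
  exact: (hardy_multiplicative_pot0 hphi).
have Ap : (0 < \int[mu]_x (A x)%:E)%E by rewrite lt0e A0 intA_ge0.
have Pp : (0 < \int[mu]_x (P phi x)%:E)%E by rewrite lt0e P0 intP_ge0.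
have [Afin|] := ltP (\int[mu]_x (A x)%:E)%E +oo%E; last first.
  rewrite leye_eq => /eqP ->; rewrite poweRyr// gt0_muley ?lte_fin//.
  by rewrite gt0_mulye ?leey// poweR_gt0.
have [Pfin|] := ltP (\int[mu]_x (P phi x)%:E)%E +oo%E; last first.
  rewrite leye_eq => /eqP ->; rewrite poweRyr// gt0_muley ?leey//.
  by rewrite mule_gt0 ?lte_fin// poweR_gt0.
by rewrite integral_split; exact: hardy_multiplicative_fin.
Qed.
End conclusion.

(* h0 discards the boundary term at the origin in the integration by parts along
   the rays.  For hom_dim G < p, f 0 != 0 and phi bounded above by a negative
   constant near 0 the inequalities can fail, e.g. on R^2 with p = 3, f = 1 on
   the unit disc and phi r = - expR (- r / e) for small e. *)
Theorem theorem6p1 (R : realType) (n : nat) (G : homogeneous_group R n)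
    (hQ : 2 <= hom_dim G)
    (mu : {measure set (borel_space R n) -> \bar R}) (hmu : haar_measure G mu)
    (N : 'rV[R]_n.+1 -> R) (hN : quasi_norm G N)
    (phi : R -> R) (hphi : forall r : R, 0 < r -> derivable phi r 1)
    (p : R) (hp : 1 < p)
    (f : 'rV[R]_n.+1 -> R[i]) (hf : C1_compact_support f)
    (h0 : [\/ p <= hom_dim G, f 0 = 0
            | forall e : R, 0 < e -> exists2 r : R, 0 < r < e & - e < phi r]) :
  ((\int[mu]_x (derive1 phi (N x) / N x `^ (hom_dim G - 1)
                * ComplexField.Normc.normc (f x) `^ p)%:E
    <= \int[mu]_x
         (ComplexField.Normc.normc (radial_derivative G N f x) `^ p)%:E
     + (p - 1)%:E
       * \int[mu]_x (`|phi (N x)| `^ (p / (p - 1))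
                     / N x `^ (p * (hom_dim G - 1) / (p - 1))
                     * ComplexField.Normc.normc (f x) `^ p)%:E)%E)
  /\
  ((\int[mu]_x (derive1 phi (N x) / N x `^ (hom_dim G - 1)
                * ComplexField.Normc.normc (f x) `^ p)%:E
    <= p%:E
       * (\int[mu]_x
            (ComplexField.Normc.normc (radial_derivative G N f x) `^ p)%:E)
         `^ (p^-1)
       * (\int[mu]_x (`|phi (N x)| `^ (p / (p - 1))
                      / N x `^ (p * (hom_dim G - 1) / (p - 1))
                      * ComplexField.Normc.normc (f x) `^ p)%:E)
         `^ ((p - 1) / p))%E).
Proof.
have Q0 : 0 < hom_dim G by exact: lt_le_trans hQ.
have h (r : R) : 0 < r -> is_derive r 1 phi (derive1 phi r).
  by move=> /hphi dphi; apply: DeriveDef => //; rewrite derive1E.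
split; first exact: (hardy_additive hmu hN Q0 hp hf h h0).
exact: (hardy_multiplicative hmu hN Q0 hp hf h h0).
Qed.
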